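(* Let $(\Omega,\mathcal F,\mathbb P,\{\theta_t\}_{t\in\mathbb R})$ be an invertible measure-preserving dynamical system, let $\mathbf X$ be a rough path cocycle and let $\mathbf Z$ be an $\mathbf X$-controlled rough path cocycle. If $F\in C_b^3(W,\mathcal L(U,W))$ and $F_0\in C_b^1(W,W)$, then the map $$\phi:\mathbb R\times\Omega\times\bigl(W\times\mathcal L(V,W)\bigr)\to W\times\mathcal L(V,W),\qquad(t,\omega,\mathbf Y_0)\mapsto\phi_t^\omega(\mathbf Y_0),$$ is a measurable cocycle; that is, $\phi$ is measurable and $\phi_{t+s}^\omega=\phi_t^{\theta_s\omega}\circ\phi_s^\omega$ for all $s,t\in\mathbb R$ and $\omega\in\Omega$.
   Context: $U,V,W$ are finite-dimensional Banach spaces, $\alpha\in(1/3,1/2]$, $X_{s,t}:=X_t-X_s$. $C_b^k$ denotes $k$-times continuously differentiable maps with bounded derivatives up to order $k$. An invertible measure-preserving dynamical system is a probability space with measurable, $\mathbb P$-preserving maps $\theta_t$, $t\in\mathbb R$, with $\theta_0=\mathrm{id}$, $\theta_{t+s}=\theta_t\circ\theta_s$ and $(t,\omega)\mapsto\theta_t\omega$ jointly measurable. An $\alpha$-Hölder rough path $\mathbf X=(X,\mathbb X)$ on an interval: $X$ is $V$-valued and $\alpha$-Hölder, $\mathbb X$ is $V\otimes V$-valued with $\sup\|\mathbb X_{s,t}\|/|t-s|^{2\alpha}<\infty$, and $\mathbb X_{s,t}=\mathbb X_{s,u}+\mathbb X_{u,t}+X_{s,u}\otimes X_{u,t}$. An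 $\mathbf X$-controlled path in $U$ is $(Z,Z')$ with $Z'$ $\mathcal L(V,U)$-valued and $\alpha$-Hölder and $R^Z_{s,t}=Z_{s,t}-Z'_sX_{s,t}$ satisfying $\sup\|R^Z_{s,t}\|/|t-s|^{2\alpha}<\infty$. On $\mathbb R$ these conditions are required on every compact interval. A rough path cocycle is a random process $\mathbf X=(X,\mathbb X)$ such that each $\mathbf X(\omega)$ is an $\alpha$-Hölder rough path on $\mathbb R$ and $X_{s,s+t}(\omega)=X_{0,t}(\theta_s\omega)$, $\mathbb X_{s,s+t}(\omega)=\mathbb X_{0,t}(\theta_s\omega)$ for $s\in\mathbb R,t\ge0$. An $\mathbf X$-controlled rough path cocycle is a random process $\mathbf Z=(Z,Z')$ such that each $\mathbf Z(\omega)$ is $\mathbf X(\omega)$-controlled on $\mathbb R$ (values in $U$) and $Z_{s,s+t}(\omega)=Z_{0,t}(\theta_s\omega)$, $Z'_{s+t}(\omega)=Z'_t(\theta_s\omega)$ for $s\in\mathbb R,t\ge0$. Controlled integral: $\int_s^tF(Y_r)\,d\mathbf Z_r:=\lim_{|\mathcal P|\to0}\sum_{[u,v]\in\mathcal P}\bigl(F(Y_u)Z_{u,v}+DF(Y_u)Y'_uZ'_u\mathbb X_{u,v}\bigr)$. Solution map: for $\omega\in\Omega$, $y\in W$, let $(Y,Y')$ be the unique $\mathbf X(\omega)$-controlled path on $\mathbb R$ with $Y_t=y+\int_0^tF(Y_r)\,d\mathbf Z_r(\omega)+\int_0^tF_0(Y_r)\,dr$ and $Y'_t=F(Y_t)Z'_t(\omega)$;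 put $\phi_t^\omega(y):=(Y_t,Y'_t)\in W\times\mathcal L(V,W)$. The initial value $y$ has associated initial state $\mathbf Y_0=(y,F(y)Z'_0(\omega))$ and $\phi_t^\omega(\mathbf Y_0):=\phi_t^\omega(y)$; accordingly, for $(y,y')\in W\times\mathcal L(V,W)$, $\phi_t^\omega(y,y'):=\phi_t^\omega(y)$. *)

(* Defs.v *)
From HB Require Import structures.
From mathcomp Require Import all_boot all_order all_algebra.
From mathcomp Require Import all_classical all_reals all_analysis.

Set Implicit Arguments.
Unset Strict Implicit.
Unset Printing Implicit Defensive.

Import Order.TTheory GRing.Theory Num.Theory.
Import numFieldNormedType.Exports.

Local Open Scope classical_set_scope.
Local Open Scope ring_scope.

(* Completeness is automatic in finite dimension, so for R : realType this is
   the interface of finite-dimensional Banach spaces over R. *)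
#[short(type="normedVectType")]
HB.structure Definition NormedVector (R : numDomainType) :=
  {E of NormedModule R E & Vector R E}.

HB.instance Definition _ (R : realType) := NormedModule.on R^o.

Section linear_bounded.
Context {R : realType} {E : normedVectType R}.
Let n := \dim {:E}.
Let e : n.-tuple E := vbasis {:E}.
Let comb (v : 'rV[R]_n) : E := \sum_(i < n) v ord0 i *: e`_i.

Let combB v w : comb v - comb w = comb (v - w).
Proof.
rewrite /comb -sumrB; apply: eq_bigr => i _.
by rewrite -scalerBl !mxE.
Qed.

Let combZ a v : comb (a *: v) = a *: comb v.
Proof.
rewrite /comb scaler_sumr; apply: eq_bigr => i _.
by rewrite scalerA !mxE.
Qed.

Let coord_le (v : 'rV[R]_n) i : `|v ord0 i| <= `|v|.
Proof.
rewrite [leRHS]/Num.norm /= mx_normE -[leLHS]nngE num_le.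
exact: (le_bigmax _ (fun ij : 'I_1 * 'I_n => `|v ij.1 ij.2|%:nng) (ord0, i)).
Qed.

Let comb_coord x : comb (\row_i coord e i x) = x.
Proof.
rewrite [RHS](coord_vbasis (memvf x)); apply: eq_bigr => i _.
by rewrite mxE.
Qed.

Let comb_eq0 v : comb v = 0 -> v = 0.
Proof.
move=> v0; apply/rowP => i; rewrite mxE.
have /freeP := basis_free (vbasisP {:E}).
by move=> /(_ (v ord0) v0 i).
Qed.

Let comb_bound : exists2 C, 0 < C & forall v, `|comb v| <= C * `|v|.
Proof.
exists (1 + \sum_(i < n) `|e`_i|); first by rewrite ltr_pwDl// sumr_ge0.
move=> v; rewrite mulrDl mul1r ler_wpDl// mulr_suml.
rewrite (le_trans (ler_norm_sum _ _ _))// ler_sum// => i _.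
by rewrite normrZ mulrC ler_wpM2l.
Qed.

Let comb_continuous : continuous (fun v => `|comb v|).
Proof.
move=> v; apply: (@cvg_norm _ _ _ (nbhs v)); apply/cvgrPdist_le => eps eps0.
have [C C0 Cb] := comb_bound.
near=> w; rewrite combB (le_trans (Cb _))// -ler_pdivlMl//.
by near: w; apply: cvgr_dist_le => //; rewrite mulr_gt0 ?invr_gt0.
Unshelve. all: by end_near. Qed.

Let coord_bound : exists2 c, 0 < c & forall v, c * `|v| <= `|comb v|.
Proof.
pose S := [set v : 'rV[R]_n | `|v| = 1].
have [S0|S0] := pselect (S !=set0); last first.
  exists 1 => // v; have [->|v0] := eqVneq v 0; first by rewrite normr0 mulr0.
  by exfalso; apply: S0; exists (`|v|^-1 *: v); exact: normfZV.
have S_compact : compact S.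
  apply: bounded_closed_compact.
    by exists 1; split => // M M1 v /= ->; exact: ltW.
  rewrite (_ : S = Num.norm @^-1` [set 1])//.
  by apply: closed_comp => [v _|]; [exact: norm_continuous|exact: closed_eq].
have [c /set_mem c1 cmin] := EVT_min_rV S0 S_compact
  (continuous_subspaceT comb_continuous).
exists `|comb c|.
  rewrite normr_gt0; apply/eqP => /comb_eq0 c0.
  by move: c1; rewrite /S /= c0 normr0 => /esym/eqP; rewrite oner_eq0.
move=> v; have [->|v0] := eqVneq v 0; first by rewrite normr0 mulr0.
have : `|v|^-1 *: v \in S by apply/mem_set; exact: normfZV.
move=> /cmin; rewrite combZ normrZ normfV normr_id mulrC ler_pdivlMr ?normr_gt0//.
Qed.

Lemma lfun_bounded (G : normedVectType R) (f : 'Hom(E, G)) :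
  exists2 C, 0 <= C & forall x, `|f x| <= C * `|x|.
Proof.
have [c c0 cb] := coord_bound.
pose D := \sum_(i < n) `|f e`_i|.
have D0 : 0 <= D by apply: sumr_ge0.
exists (D / c); first by rewrite divr_ge0// ltW.
move=> x; set v := \row_i coord e i x.
have vx : `|v| <= c^-1 * `|x| by rewrite ler_pdivlMl// -[in leRHS](comb_coord x).
rewrite -[in leLHS](comb_coord x) -/v -mulrA (le_trans _ (ler_wpM2l D0 vx))//.
rewrite linear_sum mulr_suml (le_trans (ler_norm_sum _ _ _))// ler_sum// => i _.
by rewrite linearZ normrZ mulrC ler_wpM2l.
Qed.

End linear_bounded.

Section operator_norm.
Context {R : realType} {E G : normedVectType R}.
Implicit Types f g : 'Hom(E, G).

Definition opnorm f : R := sup [set `|f x| | x in [set x : E | `|x| <= 1]].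

Let opnorm_has_sup f : has_sup [set `|f x| | x in [set x : E | `|x| <= 1]].
Proof.
split; first by exists `|f 0|, 0 => //=; rewrite normr0.
have [C C0 fC] := lfun_bounded f; exists C => _ [x x1 <-].
by rewrite (le_trans (fC x))// ler_piMr.
Qed.

Lemma opnorm_ge0 f : 0 <= opnorm f.
Proof.
apply: le_trans (normr_ge0 (f 0)) _; apply: sup_upper_bound => //.
by exists 0 => //=; rewrite normr0.
Qed.

Lemma opnormP f x : `|f x| <= opnorm f * `|x|.
Proof.
have [->|x0] := eqVneq x 0; first by rewrite linear0 !normr0 mulr0.
rewrite -ler_pdivrMr ?normr_gt0//; apply: sup_upper_bound => //.
exists (`|x|^-1 *: x); first by rewrite /= normfZV.
by rewrite linearZ normrZ normfV normr_id mulrC.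
Qed.

Lemma opnorm_le f C : 0 <= C -> (forall x, `|f x| <= C * `|x|) -> opnorm f <= C.
Proof.
move=> C0 fC; apply: ge_sup; first by have [] := opnorm_has_sup f.
by move=> _ [x x1 <-]; rewrite (le_trans (fC x))// ler_piMr.
Qed.

Let opnormD f g : opnorm (f + g) <= opnorm f + opnorm g.
Proof.
apply: opnorm_le => [|x]; first by rewrite addr_ge0// opnorm_ge0.
by rewrite add_lfunE (le_trans (ler_normD _ _))// mulrDl lerD// opnormP.
Qed.

Let opnormZ (a : R) f : opnorm (a *: f) = `|a| * opnorm f.
Proof.
have le_Z b h : opnorm (b *: h) <= `|b| * opnorm h.
  apply: opnorm_le => [|x]; first by rewrite mulr_ge0// opnorm_ge0.
  by rewrite scale_lfunE normrZ -mulrA ler_wpM2l// opnormP.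
apply/eqP; rewrite eq_le le_Z /=.
have [->|a0] := eqVneq a 0; first by rewrite normr0 mul0r opnorm_ge0.
rewrite -ler_pdivlMl ?normr_gt0// -normfV (le_trans _ (le_Z _ _))//.
by rewrite scalerA mulVf// scale1r.
Qed.

Let opnorm_eq0 f : opnorm f = 0 -> f = 0.
Proof.
move=> f0; apply/lfunP => x; rewrite zero_lfunE; apply/normr0_eq0/eqP.
by rewrite eq_le normr_ge0 andbT (le_trans (opnormP _ _))// f0 mul0r.
Qed.

HB.instance Definition _ :=
  Lmodule_isNormed.Build R 'Hom(E, G) opnormD opnormZ opnorm_eq0.

End operator_norm.

(* V (x) V is modelled, without choosing coordinates, as L(V^*, V) : the
   elementary tensor v (x) w is the map l |-> l(v) w.  The operator norm on
   L(V^*, V) is then the injective tensor norm. *)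
Section tensor_square.
Context {R : realType} {V : normedVectType R}.

Definition tensor2 := 'Hom('Hom(V, R^o), V).

Definition tens (v w : V) : tensor2 :=
  linfun (fun l : 'Hom(V, R^o) => (l v : R) *: w).

Definition dual_vbasis (i : 'I_(\dim {:V})) : 'Hom(V, R^o) :=
  linfun (coord (vbasis {:V}) i : V -> R^o).

(* The linear map V (x) V -> W induced by a bilinear map B : V x V -> W,
   evaluated at T ; see [tens_liftE]. *)
Definition tens_lift {W : normedVectType R} (B : V -> V -> W) (T : tensor2) : W :=
  \sum_(i < \dim {:V}) B (vbasis {:V})`_i (T (dual_vbasis i)).

Lemma tensE v w l : tens v w l = (l v : R) *: w.
Proof.
have lin : linear (fun l : 'Hom(V, R^o) => (l v : R) *: w).
  by move=> a l1 l2; rewrite add_lfunE scale_lfunE scalerDl -scalerA.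
pose m := GRing.isLinear.Build _ _ _ _ _ lin.
pose f : {linear 'Hom(V, R^o) -> V} := HB.pack (fun l : 'Hom(V, R^o) => (l v : R) *: w) m.
exact: (lfunE f).
Qed.

Lemma dual_vbasisE i v : dual_vbasis i v = coord (vbasis {:V}) i v.
Proof.
have lin : linear (coord (vbasis {:V}) i : V -> R^o).
  by move=> a x y; rewrite linearP.
pose m := GRing.isLinear.Build _ _ _ _ _ lin.
pose f : {linear V -> R^o} := HB.pack (coord (vbasis {:V}) i : V -> R^o) m.
exact: (lfunE f).
Qed.

Lemma tens_liftE (W : normedVectType R) (B : 'Hom(V, 'Hom(V, W))) v w :
  tens_lift (fun x y => B x y) (tens v w) = B v w.
Proof.
rewrite [in RHS](coord_vbasis (memvf v)) linear_sum sum_lfunE.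
apply: eq_bigr => i _.
by rewrite tensE dual_vbasisE !linearZ scale_lfunE.
Qed.

End tensor_square.
Arguments tensor2 {R} V.

Section differentiability_class.
Context {R : realType} {E : normedVectType R}.

Definition fderive {G : normedVectType R} (F : E -> G) (x : E) : 'Hom(E, G) :=
  linfun ('d F x).

(* The boundedness requirement includes the derivative of order 0, F itself. *)
Fixpoint Cb (k : nat) (G : normedVectType R) (F : E -> G) : Prop :=
  (exists M : R, forall x, `|F x| <= M) /\
  match k with
  | 0 => continuous F
  | k'.+1 => (forall x, differentiable F x) /\ Cb k' (fderive F)
  end.

End differentiability_class.

Section integrals.
Context {R : realType} {W : normedVectType R}.

(* [p] lists the points of the partition other than [s]; see [itv_partition]. *)
Definition partition_sum (A : R -> R -> W) (s : R) (p : seq R) : W :=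
  \sum_(i < size p) A (s :: p)`_i (s :: p)`_i.+1.

Definition mesh (s : R) (p : seq R) : R :=
  \big[Num.max/0]_(i < size p) ((s :: p)`_i.+1 - (s :: p)`_i).

Definition vanishing_mesh (s t : R) : set_system (seq R) :=
  filter_from [set e : R | 0 < e]
    (fun e => [set p | itv_partition s t p /\ mesh s p <= e]).

(* Extends I, meant for s <= t, by the convention I t s = - I s t *)
Definition oriented (I : R -> R -> W) (s t : R) : W :=
  if s <= t then I s t else - I t s.

Definition sewing_integral (A : R -> R -> W) : R -> R -> W :=
  oriented (fun s t => lim (partition_sum A s @ vanishing_mesh s t)).

(* Lebesgue integral, coordinatewise in a basis of W *)
Definition time_integral (f : R -> W) : R -> R -> W :=
  oriented (fun s t =>
    \sum_(i < \dim {:W})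
      Rintegral (@lebesgue_measure R) `[s, t]
        (fun r => coord (vbasis {:W}) i (f r)) *: (vbasis {:W})`_i).

End integrals.

Section rough_paths.
Context {R : realType} {V : normedVectType R}.
Variable alpha : R.

Definition loc_holder {E : normedVectType R} (b : R) (A : R -> R -> E) :=
  forall T1 T2 : R, exists C : R, forall s t : R,
    T1 <= s -> s < t -> t <= T2 -> `|A s t| <= C * (t - s) `^ b.

Definition increment {E : normedVectType R} (X : R -> E) (s t : R) : E := X t - X s.

Definition rough_path (X : R -> V) (XX : R -> R -> tensor2 V) : Prop :=
  [/\ loc_holder alpha (increment X),
      loc_holder (2 * alpha) XX &
      forall s u t, s <= u -> u <= t ->
        XX s t = XX s u + XX u t + tens (increment X s u) (increment X u t)].

Definition remainder {U : normedVectType R} (X : R -> V) (Z : R -> U)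
    (Z' : R -> 'Hom(V, U)) (s t : R) : U :=
  increment Z s t - Z' s (increment X s t).

Definition controlled {U : normedVectType R} (X : R -> V) (Z : R -> U)
    (Z' : R -> 'Hom(V, U)) : Prop :=
  loc_holder alpha (increment Z') /\ loc_holder (2 * alpha) (remainder X Z Z').

Section equation.
Context {U W : normedVectType R}.
Variables (X : R -> V) (XX : R -> R -> tensor2 V).
Variables (Z : R -> U) (Z' : R -> 'Hom(V, U)).
Variables (F : W -> 'Hom(U, W)) (F0 : W -> W).

Definition controlled_integral (Y : R -> W) (Y' : R -> 'Hom(V, W)) : R -> R -> W :=
  sewing_integral (fun u v =>
    F (Y u) (increment Z u v) +
    tens_lift (fun x y => fderive F (Y u) (Y' u x) (Z' u y)) (XX u v)).

Definition rde_solution (y : W) (Y : (R -> W) * (R -> 'Hom(V, W))) : Prop :=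
  [/\ controlled X Y.1 Y.2,
      forall t, Y.1 t = y + controlled_integral Y.1 Y.2 0 t
                          + time_integral (F0 \o Y.1) 0 t &
      forall t, Y.2 t = (F (Y.1 t) \o Z' t)%VF].

(* The solution started from y, which exists and is unique when X is a rough
   path, Z is controlled by X, F is Cb 3 and F0 is Cb 1; in general, some
   solution if there is one, and (0, 0) otherwise. *)
Definition rde_sol (y : W) : (R -> W) * (R -> 'Hom(V, W)) :=
  xget (fun=> 0, fun=> 0) [set Y | rde_solution y Y].

End equation.
End rough_paths.

Definition borel (T : ptopologicalType) := g_sigma_algebraType (@open T).

Section cocycles.
Context {R : realType} {d : measure_display} {Omega : measurableType d}.

Record invertible_mpds (P : probability Omega R) (theta : R -> Omega -> Omega) : Prop := {
  mpds_measurable : forall t, measurable_fun setT (theta t) ;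
  mpds_preserving : forall t A, measurable A -> P (theta t @^-1` A) = P A ;
  mpds_id : forall w, theta 0 w = w ;
  mpds_flow : forall t s w, theta (t + s) w = theta t (theta s w) ;
  mpds_joint : measurable_fun setT
    (fun tw : measurableTypeR R * Omega => theta tw.1 tw.2) }.

Variables (theta : R -> Omega -> Omega) (alpha : R).

Record rough_path_cocycle {V : normedVectType R}
    (X : Omega -> R -> V) (XX : Omega -> R -> R -> tensor2 V) : Prop := {
  rpc_measurable1 : forall t, measurable_fun setT (fun w => X w t : borel V) ;
  rpc_measurable2 : forall s t, s <= t ->
    measurable_fun setT (fun w => XX w s t : borel (tensor2 V)) ;
  rpc_rough_path : forall w, rough_path alpha (X w) (XX w) ;
  rpc_cocycle1 : forall s t w, 0 <= t ->
    increment (X w) s (s + t) = increment (X (theta s w)) 0 t ;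
  rpc_cocycle2 : forall s t w, 0 <= t -> XX w s (s + t) = XX (theta s w) 0 t }.

Record controlled_cocycle {V U : normedVectType R} (X : Omega -> R -> V)
    (Z : Omega -> R -> U) (Z' : Omega -> R -> 'Hom(V, U)) : Prop := {
  cc_measurable1 : forall t, measurable_fun setT (fun w => Z w t : borel U) ;
  cc_measurable2 : forall t, measurable_fun setT (fun w => Z' w t : borel 'Hom(V, U)) ;
  cc_controlled : forall w, controlled alpha (X w) (Z w) (Z' w) ;
  cc_cocycle1 : forall s t w, 0 <= t ->
    increment (Z w) s (s + t) = increment (Z (theta s w)) 0 t ;
  cc_cocycle2 : forall s t w, 0 <= t -> Z' w (s + t) = Z' (theta s w) t }.

Definition measurable_cocycle {E : normedModType R} (phi : R -> Omega -> E -> E) : Prop :=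
  measurable_fun setT
    (fun x : measurableTypeR R * Omega * borel E => phi x.1.1 x.1.2 x.2 : borel E) /\
  forall s t w, phi (t + s) w = phi t (theta s w) \o phi s w.

(* The second component of the initial state is ignored. *)
Definition solution_map {V U W : normedVectType R}
    (X : Omega -> R -> V) (XX : Omega -> R -> R -> tensor2 V)
    (Z : Omega -> R -> U) (Z' : Omega -> R -> 'Hom(V, U))
    (F : W -> 'Hom(U, W)) (F0 : W -> W)
    (t : R) (w : Omega) (Y0 : W * 'Hom(V, W)) : W * 'Hom(V, W) :=
  let Y := rde_sol alpha (X w) (XX w) (Z w) (Z' w) F F0 Y0.1 in (Y.1 t, Y.2 t).

End cocycles.

(* Main.v *)
Require Import Defs.
From mathcomp Require Import all_boot all_order all_algebra.
From mathcomp Require Import all_classical all_reals all_analysis.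
From mathcomp Require Import measurable_realfun.
From mathcomp Require Import zify ring lra.

(** The equation is traded for a local expansion, following Davie.  Let
        A s t y = F(y) (Z_t - Z_s) + DF(y) (F(y) Z'_s) Z'_s XX_{s,t}
    be the summand of the controlled integral, as a function of the current
    state y ([rde_germ]).  A path Y started from y solves the equation if and
    only if, locally uniformly in s and t,
        Y_t - Y_s = A s t (Y_s) + (t - s) F0(Y_s) + O(|t - s|^(3 alpha))
    ([rde_solution_davie], [davie_rde_solution]).  In one direction a solution
    is controlled, hence satisfies the expansion at order 2 alpha, which makes
    A s t (Y_s) additive in (s, t) up to order 3 alpha > 1; its compensated
    Riemann sums therefore converge to the increments of a path, and these differ
    from A s t (Y_s) by that order.  In the other direction the expansion says
    that Y minus the time integral is such a path.

    The expansion has exactly one solution for every initial value because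
    A is a rough germ ([rde_germ_rough]): by Chen's relation and the
    controlled remainders, the defect A s t y - A s u y - A u t (y + A s u y)
    is of order 3 alpha, with a Lipschitz constant in y of the same order,
    which is where the three derivatives of F enter.  A sewing lemma on a grid
    ([discrete_sewing]) turns one-step errors h^(3 alpha) into bounds uniform
    in h: every sequence that follows the Euler steps up to such errors obeys
    the expansion over longer windows ([almost_euler_window]), and two of them
    stay close if they start close ([almost_euler_stable]).  Applied to Euler
    schemes with steps 2^-n this gives convergence, hence existence; applied
    to two solutions sampled on finer and finer grids it gives uniqueness.
    Negative times are reached by extending the area to s > t through Chen's
    relation and running the time-reversed germ ([davie_exists],
    [davie_unique]).

    Both claims about the solution map follow.  The germ at theta_s omega is
    the germ at omega translated by s ([cocycle_germ]), so that the translate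
    of a solution is a solution and uniqueness yields the cocycle identity
    ([solution_map_cocycle]).  The solution is the pointwise limit of Euler
    schemes ([euler_approx_cvg]); each of these is a countable patchwork, over
    the number of steps, of explicit compositions of measurable maps of
    (t, omega, y), so the limit is measurable as well. *)

Set Implicit Arguments.
Unset Strict Implicit.
Unset Printing Implicit Defensive.

Import Order.TTheory GRing.Theory Num.Theory.
Import numFieldNormedType.Exports.

Local Open Scope classical_set_scope.
Local Open Scope ring_scope.

(** * Powers and a sewing lemma on a grid *)

Section powers.
Context {R : realType}.
Implicit Types x y p q : R.

Lemma le_powR p x y : 0 <= p -> 0 <= x -> x <= y -> x `^ p <= y `^ p.
Proof.
by move=> p0 x0 xy; apply: ge0_ler_powR; rewrite // nnegrE// (le_trans x0).
Qed.

Lemma powR_le1 p x : 0 <= p -> 0 <= x <= 1 -> x `^ p <= 1.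
Proof.
by move=> p0 /andP[x0 x1]; rewrite -[leRHS](congr1 (fun f => f p) (@powR1 R)) le_powR.
Qed.

Lemma powR_expo_anti p q x : 0 < p -> p <= q -> 0 <= x <= 1 -> x `^ q <= x `^ p.
Proof.
move=> p0 pq /andP[x0 x1]; have [->|xn0] := eqVneq x 0.
  by rewrite !powR0 ?gt_eqF// (lt_le_trans p0).
by apply: ger_powR => //; rewrite lt_def xn0 x0.
Qed.

Lemma powR_add p q x : 0 < p -> 0 < q -> x `^ (p + q) = x `^ p * x `^ q.
Proof. by move=> p0 q0; rewrite powRD// gt_eqF// addr_gt0. Qed.

End powers.

Section discrete_sewing.
Context {R : realType}.

Lemma split_in_three n : exists m k : nat,
  [/\ (m + 1 + k)%N = n.+1, (2 * m <= n.+1)%N & (2 * k <= n.+1)%N].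
Proof. by exists n./2, (n - n./2)%N; split; lia. Qed.

(** Here r i j bounds the error over the grid interval from i to j, h is the step
    and th > 1.  An interval is cut into two halves separated by a single step:
    the bounds for the halves add up to 2^(1 - th) < 1 times the bound for the
    whole, and the room left over absorbs the factor 1 + eta, the single step and
    the additivity defect. *)
Lemma discrete_sewing (th : R) : 1 < th ->
  exists2 rho : R, 0 < rho <= 1 &
  forall (h eta e C : R) (N : nat) (r : nat -> nat -> R),
    0 <= h -> 0 <= eta <= rho -> 0 <= e -> 0 <= C ->
    (forall i, (i <= N)%N -> r i i = 0) ->
    (forall i, (i < N)%N -> r i i.+1 <= e * h `^ th) ->
    (forall i m n, (i + m + n <= N)%N ->
      r i (i + m + n)%N <= (1 + eta) * r i (i + m)%N +
         r (i + m)%N (i + m + n)%N + C * ((m + n)%:R * h) `^ th) ->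
  forall n i, (i + n <= N)%N ->
    r i (i + n)%N <= (2 * e + 2 * C) / rho * (n%:R * h) `^ th.
Proof.
move=> th1; have th0 : 0 < th by apply: lt_trans th1.
pose kap : R := 2 `^ (1 - th).
have kap0 : 0 < kap by rewrite powR_gt0.
have kap1 : kap < 1.
  have -> : kap = (2 `^ (th - 1))^-1 by rewrite -powRN opprB.
  rewrite invf_lt1 ?powR_gt0// /powR pnatr_eq0 /= -[ltLHS]expR0 ltr_expR.
  by rewrite mulr_gt0 ?ln_gt0 ?ltr1n ?subr_gt0.
exists ((1 - kap) / 2); first by apply/andP; split; lra.
set rho := (1 - kap) / 2 => h eta e C N r h0 /andP[eta0 eta1] e0 C0 rii rS rD.
have rho0 : 0 < rho by rewrite /rho; lra.
set K := (2 * e + 2 * C) / rho.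
have K0 : 0 <= K by apply: divr_ge0; [lra|exact: ltW].
have KE : K * rho = 2 * e + 2 * C by rewrite /K mulfVK// gt_eqF.
have half_split (k m : nat) : (2 * k <= m)%N ->
    (k%:R * h) `^ th <= 2 `^ (- th) * (m%:R * h) `^ th.
  move=> km; rewrite powRN ler_pdivlMl ?powR_gt0//.
  rewrite -powRM ?mulr_ge0//; apply: le_powR; [exact: ltW|by rewrite !mulr_ge0|].
  by rewrite mulrA ler_wpM2r// -natrM ler_nat.
have kapE : kap = 2 * 2 `^ (- th).
  by rewrite /kap powRD ?powRr1// pnatr_eq0 implybT.
elim/ltn_ind => -[|n] IH i iN.
  by rewrite addn0 in iN *; rewrite rii// mul0r powR0 ?gt_eqF// mulr0.
have [m [k [nE m2 k2]]] := split_in_three n.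
pose P := (n.+1%:R * h) `^ th.
have iE : (i + n.+1 = i + m + (1 + k))%N by clear -nE; lia.
have := rD i m (1 + k)%N; rewrite -iE => /(_ iN).
have -> : (m + (1 + k) = n.+1)%N by clear -nE; lia.
rewrite -/P => H1.
have := rD (i + m)%N 1%N k; rewrite -addnA -iE => /(_ iN) H2.
have H3 : r (i + m)%N (i + m + 1)%N <= e * P.
  rewrite addn1 (le_trans (rS _ _))//; first by clear -nE iN; lia.
  rewrite ler_wpM2l//; apply: le_powR => //; first exact: ltW.
  by rewrite ler_peMl// ler1n.
have H4 : r i (i + m)%N <= K * (2 `^ (- th) * P).
  rewrite (le_trans (IH m _ _ _))//; [by clear -nE; lia|by clear -nE iN; lia|].
  by rewrite ler_wpM2l// half_split.
have H5 : r (i + m + 1)%N (i + n.+1)%N <= K * (2 `^ (- th) * P).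
  have -> : (i + n.+1 = i + m + 1 + k)%N by clear -nE; lia.
  rewrite (le_trans (IH k _ _ _))//; [by clear -nE; lia|by clear -nE iN; lia|].
  by rewrite ler_wpM2l// half_split.
have H6 : ((1 + k)%:R * h) `^ th <= P.
  apply: le_powR; [exact: ltW|by rewrite mulr_ge0|].
  by rewrite ler_wpM2r// ler_nat; clear -nE; lia.
have P0 : 0 <= P by exact: powR_ge0.
rewrite (le_trans H1)//.
have -> : K * P = K * rho * P + K * (1 - rho) * P by ring.
rewrite KE.
set Q := 2 `^ (- th) * P in H4 H5.
have Q0 : 0 <= Q by rewrite mulr_ge0// powR_ge0.
have kapQ : kap * P = 2 * Q by rewrite kapE /Q mulrA.
have L1 : (1 + eta) * r i (i + m)%N <= (1 + eta) * (K * Q).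
  by rewrite ler_wpM2l// addr_ge0.
have L2 : (1 + eta) * r (i + m)%N (i + m + 1)%N <= 2 * (e * P).
  rewrite (@le_trans _ _ ((1 + eta) * (e * P)))//.
    by rewrite ler_wpM2l// addr_ge0.
  rewrite ler_wpM2r// ?mulr_ge0//; rewrite /rho in eta1; lra.
have L3 : C * ((1 + k)%:R * h) `^ th <= C * P by rewrite ler_wpM2l.
have L4 : eta * (K * Q) <= rho * (K * P).
  apply: ler_pM => //; first exact: mulr_ge0.
  apply: ler_wpM2l => //.
  by rewrite /Q ler_piMl// powRN invf_le1 ?powR_gt0// -[leLHS](powRr0 2) ler_powR ?ler1n// ltW.
have L5 : K * (1 - rho) * P = K * Q + K * Q + rho * (K * P).
  have -> : 1 - rho = kap + rho by rewrite /rho; lra.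
  by rewrite mulrDr mulrDl -mulrA kapQ; ring.
rewrite L5; lra.
Qed.

End discrete_sewing.

(** * Identities in abelian groups *)

Section zmodule_normalization.

Inductive zmod_expr :=
  ZVar of nat | ZAdd of zmod_expr & zmod_expr | ZOpp of zmod_expr | ZZero.

Fixpoint zmod_eval (V : zmodType) (env : seq V) e : V :=
  match e with
  | ZVar n => env`_n
  | ZAdd a b => zmod_eval env a + zmod_eval env b
  | ZOpp a => - zmod_eval env a
  | ZZero => 0
  end.

Fixpoint zmod_coef e (i : nat) : int :=
  match e with
  | ZVar n => if n == i then 1 else 0
  | ZAdd a b => zmod_coef a i + zmod_coef b i
  | ZOpp a => - zmod_coef a i
  | ZZero => 0
  end.

Lemma zmod_evalE (V : zmodType) (env : seq V) e :
  zmod_eval env e = \sum_(i < size env) env`_i *~ zmod_coef e i.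
Proof.
elim: e => [n|a iha b ihb|a iha|] /=.
- have [nlt|nge] := ltnP n (size env).
    rewrite (bigD1 (Ordinal nlt))//= eqxx mulr1z big1 ?addr0// => i ne.
    rewrite ifN ?mulr0z//; apply: contra ne => /eqP ni.
    by apply/eqP/val_inj; rewrite /= -ni.
  rewrite nth_default// big1// => i _.
  by rewrite ifN ?mulr0z// gtn_eqF// (leq_trans (ltn_ord i)).
- by rewrite iha ihb -big_split /=; apply: eq_bigr => i _; rewrite mulrzDr.
- by rewrite iha -sumrN; apply: eq_bigr => i _; rewrite mulrNz.
- by rewrite big1.
Qed.

(** An identity between sums holds in every abelian group as soon as each atom
    has the same total coefficient on both sides. *)
Lemma zmod_eval_eq (V : zmodType) (env : seq V) e1 e2 :
  all (fun i => zmod_coef e1 i == zmod_coef e2 i) (iota 0 (size env)) ->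
  zmod_eval env e1 = zmod_eval env e2.
Proof.
move=> /allP H; rewrite !zmod_evalE; apply: eq_bigr => i _; congr (_ *~ _).
by apply/eqP/H; rewrite mem_iota /= add0n.
Qed.

End zmodule_normalization.

(** Atoms are identified by [same]: syntactically in a first attempt, which is
    fast, then up to conversion, for terms that reach one operation through two
    different structures. *)
Ltac zmod_find same x l :=
  match l with
  | cons ?y _ => let _ := match goal with _ => same x y end in constr:(0%N)
  | cons _ ?l' => let n := zmod_find same x l' in constr:(S n)
  end.
Ltac zmod_atoms same e l :=
  lazymatch e with
  | GRing.add ?a ?b => let l' := zmod_atoms same a l in zmod_atoms same b l'
  | GRing.opp ?a => zmod_atoms same a l
  | GRing.zero => l
  | _ => match l with
         | _ => let n := zmod_find same e l in l
         | _ => constr:(cons e l)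
         end
  end.
Ltac zmod_reify same e l :=
  lazymatch e with
  | GRing.add ?a ?b =>
      let a' := zmod_reify same a l in
      let b' := zmod_reify same b l in constr:(ZAdd a' b')
  | GRing.opp ?a => let a' := zmod_reify same a l in constr:(ZOpp a')
  | GRing.zero => constr:(ZZero)
  | _ => let n := zmod_find same e l in constr:(ZVar n)
  end.
Ltac zmod_with same :=
  lazymatch goal with
  | |- @eq ?T ?x ?y =>
    let l := zmod_atoms same x (@nil T) in
    let l := zmod_atoms same y l in
    let ex := zmod_reify same x l in
    let ey := zmod_reify same y l in
    refine (@zmod_eval_eq _ l ex ey _); vm_compute; reflexivity
  end.
Ltac zmod_same x y := constr_eq x y.
Ltac zmod_conv x y := unify x y.
Ltac zmod := first [zmod_with zmod_same | zmod_with zmod_conv].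

(** * Euler steps along a rough germ *)

Section norm_tools.
Context {R : realType} {E : normedModType R}.
Implicit Types a b c : E.

Lemma normD_le a b (x y : R) : `|a| <= x -> `|b| <= y -> `|a + b| <= x + y.
Proof. by move=> ax bY; rewrite (le_trans (ler_normD _ _))// lerD. Qed.

Lemma normB_le a b (x y : R) : `|a| <= x -> `|b| <= y -> `|a - b| <= x + y.
Proof. by move=> ax bY; rewrite (le_trans (ler_normB _ _))// lerD. Qed.

Lemma small_power (p eps : R) : 0 < p -> 0 < eps ->
  exists2 tau : R, 0 < tau <= 1 & tau `^ p <= eps.
Proof.
move=> p0 e0; exists (Num.min 1 (eps `^ p^-1)).
  by rewrite lt_min ltr01 powR_gt0//= ge_min lexx.
rewrite (@le_trans _ _ ((eps `^ p^-1) `^ p))//.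
  apply: le_powR; [exact: ltW| |by rewrite ge_min lexx orbT].
  by rewrite le_min ler01 powR_ge0.
by rewrite -powRrM mulVf ?gt_eqF// powRr1// ltW.
Qed.

End norm_tools.

Section germs.
Context {R : realType} {W : normedModType R}.
Variable alpha : R.

Definition chen_defect (A : R -> R -> W -> W) (s u t : R) (y : W) : W :=
  A s t y - A s u y - A u t (y + A s u y).

(** The properties of a second-order expansion that drive the whole argument.
    Perturbing the arguments a and b of [germ_diff2] by r and q makes it contain
    both the Lipschitz bound (q = 0) and the bound on second differences
    (r = q).  The defects are measured against a common bound h of the two
    time steps, which spares the case distinctions of a bound in |t - s|, as the
    times need not be ordered.  [germ_time] allows the passage from grid times
    to arbitrary ones. *)
Record germ_bound (T C : R) (A : R -> R -> W -> W) : Prop := GermBound {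
  germ_ge1 : 1 <= C ;
  germ_norm : forall (s t : R) y, `|s| <= T -> `|t| <= T ->
    `|A s t y| <= C * `|t - s| `^ alpha ;
  germ_diff2 : forall (s t : R) a r b q, `|s| <= T -> `|t| <= T ->
    `|A s t (a + r) - A s t a - (A s t (b + q) - A s t b)| <=
      C * `|t - s| `^ alpha * (`|r - q| + `|q| * `|a - b|) ;
  germ_defect : forall (h s u t : R) y, `|s| <= T -> `|u| <= T -> `|t| <= T ->
    `|u - s| <= h -> `|t - u| <= h ->
    `|chen_defect A s u t y| <= C * h `^ (3 * alpha) ;
  germ_defect_lip : forall (h s u t : R) y z, `|s| <= T -> `|u| <= T -> `|t| <= T ->
    `|u - s| <= h -> `|t - u| <= h ->
    `|chen_defect A s u t y - chen_defect A s u t z| <=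
      C * h `^ (3 * alpha) * `|y - z| ;
  germ_time : forall (s t s' t' : R) y,
    `|s| <= T -> `|t| <= T -> `|s'| <= T -> `|t'| <= T ->
    `|A s' t' y - A s t y| <= C * (`|s' - s| `^ alpha + `|t' - t| `^ alpha) }.

Definition rough_germ A := forall T, exists C, germ_bound T C A.

Lemma germ_lip T C A s t y z : germ_bound T C A -> `|s| <= T -> `|t| <= T ->
  `|A s t y - A s t z| <= C * `|t - s| `^ alpha * `|y - z|.
Proof.
move=> gA sT tT; have := germ_diff2 gA z (y - z) 0 0 sT tT.
by rewrite [z + _]addrC subrK addr0 !subrr !subr0 normr0 mul0r addr0.
Qed.

Lemma germ_diag T C A t y : 0 < alpha -> germ_bound T C A -> `|t| <= T -> A t t y = 0.
Proof.
move=> al0 gA tT; apply/eqP; rewrite -normr_le0 (le_trans (germ_norm gA _ tT tT))//.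
by rewrite subrr normr0 powR0 ?gt_eqF// mulr0.
Qed.

End germs.

Section grid.
Context {R : realType}.
Implicit Types (i m n N : nat).

Lemma grid_dist (h : R) i n : 0 <= h -> `|(i + n)%:R * h - i%:R * h| = n%:R * h.
Proof. by move=> h0; rewrite -mulrBl natrD addrAC subrr add0r ger0_norm// mulr_ge0. Qed.

Lemma grid_bound (h T : R) i N : 0 <= h -> (i <= N)%N -> N%:R * h <= T -> `|i%:R * h| <= T.
Proof.
by move=> h0 iN; apply: le_trans; rewrite ger0_norm ?mulr_ge0// ler_wpM2r// ler_nat.
Qed.

End grid.

Section euler_scheme.
Context {R : realType} {W : normedModType R}.
Variables (alpha T C L : R) (A : R -> R -> W -> W) (F0 : W -> W).
Hypothesis halpha : 3^-1 < alpha <= 2^-1.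
Hypothesis gA : germ_bound alpha T C A.
Hypothesis F0_bd : forall y, `|F0 y| <= L.
Hypothesis F0_lip : forall y z, `|F0 y - F0 z| <= L * `|y - z|.

Let L0 : 0 <= L. Proof. exact: le_trans (normr_ge0 _) (F0_bd 0). Qed.
Let C1 : 1 <= C. Proof. exact: germ_ge1 gA. Qed.
Let C0 : 0 <= C. Proof. exact: le_trans C1. Qed.
Let al0 : 0 < alpha.
Proof. by case/andP: halpha => + _; apply: lt_trans; rewrite invr_gt0. Qed.
Let al3 : 1 < 3 * alpha.
Proof. by case/andP: halpha => + _; lra. Qed.
Let al2 : 3 * alpha <= 1 + alpha.
Proof. by case/andP: halpha => _; lra. Qed.
Let al1 : alpha <= 1.
Proof. by case/andP: halpha => _; lra. Qed.

Definition drift (h : R) (y : nat -> W) i j : W := \sum_(i <= l < j) h *: F0 (y l).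

Definition davie_defect (h : R) (y : nat -> W) i j : W :=
  y j - y i - A (i%:R * h) (j%:R * h) (y i) - drift h y i j.

(** Exact schemes, their subsequences on coarser grids and solutions sampled on a
    grid all follow the Euler steps up to an error of this order; one stability
    estimate for such sequences hence gives both convergence and uniqueness. *)
Definition almost_euler (E h : R) (N : nat) (y : nat -> W) :=
  forall i, (i < N)%N ->
    `|y i.+1 - y i - A (i%:R * h) (i.+1%:R * h) (y i) - h *: F0 (y i)| <=
      E * h `^ (3 * alpha).

Lemma drift_norm (h : R) y i n : 0 <= h -> `|drift h y i (i + n)| <= L * (n%:R * h).
Proof.
move=> h0; rewrite /drift (le_trans (ler_norm_sum _ _ _))//.
rewrite (@le_trans _ _ (\sum_(i <= l < i + n) L * h))//.
  by apply: ler_sum => l _; rewrite normrZ ger0_norm// mulrC ler_wpM2r.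
by rewrite sumr_const_nat addKn -mulr_natl; lra.
Qed.

Lemma drift_lip (h : R) y z i n (S : R) : 0 <= h ->
  (forall l, (i <= l < i + n)%N -> `|y l - z l| <= S) ->
  `|drift h y i (i + n) - drift h z i (i + n)| <= L * (n%:R * h) * S.
Proof.
move=> h0 yzS; rewrite /drift -sumrB (le_trans (ler_norm_sum _ _ _))//.
rewrite (@le_trans _ _ (\sum_(i <= l < i + n) L * h * S))//.
  apply: ler_sum_nat => l il; rewrite -scalerBr normrZ ger0_norm//.
  rewrite (@le_trans _ _ (h * (L * `|y l - z l|)))// ?ler_wpM2l//.
  by rewrite mulrCA -mulrA !ler_wpM2l// yzS.
by rewrite sumr_const_nat addKn -mulr_natl; lra.
Qed.

Lemma davie_defect_step (h : R) y i : davie_defect h y i i.+1 =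
  y i.+1 - y i - A (i%:R * h) (i.+1%:R * h) (y i) - h *: F0 (y i).
Proof. by rewrite /davie_defect /drift big_nat1. Qed.

(** The expansion errors over adjacent windows add up to the one over the union,
    up to the effect of the first error on the germ and the Chen defect. *)
Lemma davie_defect_add (h : R) y i j k : (i <= j)%N -> (j <= k)%N ->
  davie_defect h y i k = davie_defect h y i j + davie_defect h y j k +
    (A (j%:R * h) (k%:R * h) (y j)
       - A (j%:R * h) (k%:R * h) (y i + A (i%:R * h) (j%:R * h) (y i))
       - chen_defect A (i%:R * h) (j%:R * h) (k%:R * h) (y i)).
Proof.
move=> ij jk; rewrite /davie_defect /chen_defect {1}/drift.
by rewrite (big_cat_nat ij jk)/= -!/(drift _ _ _ _); zmod.
Qed.

Lemma davie_defect_split (h : R) y i j :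
  y j = y i + A (i%:R * h) (j%:R * h) (y i) + (drift h y i j + davie_defect h y i j).
Proof. by rewrite /davie_defect; zmod. Qed.

Let grid_facts (h : R) N i m n : 0 < h -> N%:R * h <= T -> (i + m + n <= N)%N ->
  [/\ `|i%:R * h| <= T, `|(i + m)%:R * h| <= T, `|(i + m + n)%:R * h| <= T,
      `|(i + m)%:R * h - i%:R * h| <= (m + n)%:R * h &
      `|(i + m + n)%:R * h - (i + m)%:R * h| <= (m + n)%:R * h].
Proof.
move=> h0 NT iN; have h0' := ltW h0.
split; rewrite ?grid_dist ?ler_wpM2r ?ler_nat ?leq_addr ?leq_addl//.
- by apply: grid_bound NT => //; rewrite (leq_trans _ iN)// -addnA leq_addr.
- by apply: grid_bound NT => //; rewrite (leq_trans _ iN)// leq_addr.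
- exact: grid_bound NT.
Qed.

(* alpha <= 1/2 makes a drift of size H, seen through a germ of size H^alpha,
   as small as the Chen defect *)
Let powH (H : R) : 0 <= H <= 1 -> H `^ alpha * H <= H `^ (3 * alpha).
Proof.
move=> /andP[H0 H1]; rewrite -[X in _ * X](@powRr1 _ H)// -powR_add//.
by apply: powR_expo_anti; rewrite ?H0// ?mulr_gt0// addrC.
Qed.

(** By [davie_defect_add] the norm of the expansion error satisfies the
    hypotheses of [discrete_sewing] with eta = C tau^alpha, on windows short
    enough for eta to be at most rho. *)
Lemma almost_euler_apriori : exists2 tau : R, 0 < tau <= 1 &
  forall E : R, 0 <= E -> exists2 K : R, 0 <= K &
  forall (h : R) N y, 0 < h -> N%:R * h <= T -> almost_euler E h N y ->
  forall i n, (i + n <= N)%N -> n%:R * h <= tau ->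
    `|davie_defect h y i (i + n)| <= K * (n%:R * h) `^ (3 * alpha).
Proof.
have [rho /andP[rho0 rho1] sew] := discrete_sewing al3.
have [tau tau01 tauC] : exists2 tau : R, 0 < tau <= 1 & tau `^ alpha <= rho / C.
  by apply: small_power => //; rewrite divr_gt0// (lt_le_trans _ C1).
have etaC : C * tau `^ alpha <= rho by rewrite mulrC -ler_pdivlMr// (lt_le_trans _ C1).
exists tau => // E E0; have /andP[tau0 tau1] := tau01.
exists ((2 * E + 2 * (C + C * L)) / rho).
  by rewrite divr_ge0 ?(ltW rho0)// addr_ge0// mulr_ge0// addr_ge0// mulr_ge0.
move=> h N y h0 NT yE i n inN nh; have h0' := ltW h0.
pose r a b := `|davie_defect h y (i + a) (i + b)|.
have := sew h (C * tau `^ alpha) E (C + C * L) n r h0' _ E0 _ _ _ _ n 0%N (leqnn _).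
rewrite /r add0n addn0; apply.
- by rewrite etaC andbT mulr_ge0// powR_ge0.
- by rewrite addr_ge0// mulr_ge0.
- move=> a an; rewrite /davie_defect /drift big_geq// (germ_diag _ al0 gA) ?subrr ?subr0 ?normr0//.
  by apply: (grid_bound _ _ NT) => //; clear -an inN; lia.
- move=> a an; rewrite addnS davie_defect_step; apply: yE; clear -an inN; lia.
move=> a m k amkn.
set H := (m + k)%:R * h.
have H0 : 0 <= H by rewrite mulr_ge0.
have Htau : H <= tau.
  by rewrite (le_trans _ nh)// ler_wpM2r// ler_nat; clear -amkn; lia.
have H1 : H <= 1 by rewrite (le_trans Htau).
have imkN : (i + a + m + k <= N)%N by clear -amkn inN; lia.
have [sT uT tT us tu] := grid_facts h0 NT imkN.
rewrite !addnA (@davie_defect_add _ _ _ (i + a + m)%N) ?leq_addr//.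
set D1 := davie_defect h y (i + a) _; set D2 := davie_defect h y _ (i + a + m + k).
set J := drift h y (i + a) (i + a + m).
have HJ : `|J| <= L * H.
  rewrite (le_trans (drift_norm _ _ _ h0'))// ler_wpM2l// ler_wpM2r// ler_nat.
  exact: leq_addr.
have lipb := germ_lip (y (i + a + m)) (y (i + a) +
  A ((i + a)%:R * h) ((i + a + m)%:R * h) (y (i + a))) gA uT tT.
have {lipb} : `|A ((i + a + m)%:R * h) ((i + a + m + k)%:R * h) (y (i + a + m)%N) -
  A ((i + a + m)%:R * h) ((i + a + m + k)%:R * h) (y (i + a)%N +
  A ((i + a)%:R * h) ((i + a + m)%:R * h) (y (i + a)%N))| <=
    C * H `^ alpha * (L * H + `|D1|).
  apply: (le_trans lipb); apply: ler_pM => //.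
  - by rewrite mulr_ge0// powR_ge0.
  - by rewrite ler_wpM2l// le_powR// ltW.
  rewrite (davie_defect_split h y (i + a) (i + a + m)) addrAC subrr add0r.
  exact: normD_le.
move=> /normB_le /(_ (germ_defect gA (y (i + a)%N) sT uT tT us tu)) bd.
rewrite (le_trans (normD_le (ler_normD _ _) bd))// -/H.
have e1 := powH (introT andP (conj H0 H1)).
have e2 : H `^ alpha <= tau `^ alpha by rewrite le_powR// ltW.
have e3 : C * L * (H `^ alpha * H) <= C * L * H `^ (3 * alpha).
  by rewrite ler_wpM2l// mulr_ge0.
have e4 : C * H `^ alpha * `|D1| <= C * tau `^ alpha * `|D1|.
  by rewrite ler_wpM2r// ler_wpM2l.
rewrite -/H; lra.
Qed.

(** The difference, for two sequences, of the additivity errors in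
    [davie_defect_add]: linear in the distance S of the sequences, thanks to the
    bound on second differences of the germ and the Lipschitz bound on its
    Chen defect. *)
Lemma chen_defect_perturb (S H Q s u t : R) a ra b rb :
  `|s| <= T -> `|u| <= T -> `|t| <= T -> `|u - s| <= H -> `|t - u| <= H ->
  0 <= H <= 1 -> `|a - b| <= S -> `|rb| <= Q * H ->
  `|(A u t (a + A s u a + ra) - A u t (a + A s u a) - chen_defect A s u t a)
    - (A u t (b + A s u b + rb) - A u t (b + A s u b) - chen_defect A s u t b)| <=
  C * H `^ alpha * `|ra - rb| + (C * Q * (1 + C) + C) * S * H `^ (3 * alpha).
Proof.
move=> sT uT tT us tu H01 abS rbQ; have /andP[H0 H1] := H01.
have S0 : 0 <= S by apply: le_trans abS.
have Q0 : 0 <= Q * H by apply: le_trans rbQ.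
rewrite (_ : _ - _ - _ = A u t (a + A s u a + ra) - A u t (a + A s u a)
  - (A u t (b + A s u b + rb) - A u t (b + A s u b))
  - (chen_defect A s u t a - chen_defect A s u t b)); last by zmod.
have e1 := germ_diff2 gA (a + A s u a) ra (b + A s u b) rb uT tT.
have e2 := germ_defect_lip gA a b sT uT tT us tu.
rewrite (le_trans (normB_le e1 e2))//.
have pw (x : R) : 0 <= x -> x <= H -> x `^ alpha <= H `^ alpha.
  by move=> x0 xH; apply: le_powR => //; exact: ltW.
have ut := pw _ (normr_ge0 _) tu; have su := pw _ (normr_ge0 _) us.
have Ha1 : H `^ alpha <= 1 by apply: powR_le1 => //; exact: ltW.
have Ha0 : 0 <= H `^ alpha by exact: powR_ge0.
have e3 : `|a + A s u a - (b + A s u b)| <= (1 + C) * S.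
  rewrite (_ : _ - _ = (a - b) + (A s u a - A s u b)); last by zmod.
  rewrite mulrDl mul1r; apply: normD_le => //.
  rewrite (le_trans (germ_lip _ _ gA sT uT))//; apply: ler_pM => //.
    by rewrite mulr_ge0// powR_ge0.
  by rewrite ler_piMr// (le_trans su).
have e4 : C * `|t - u| `^ alpha * (`|ra - rb| + `|rb| * `|a + A s u a - (b + A s u b)|)
    <= C * H `^ alpha * (`|ra - rb| + Q * H * ((1 + C) * S)).
  apply: ler_pM; rewrite ?addr_ge0 ?mulr_ge0 ?powR_ge0//.
    by rewrite ler_wpM2l.
  by rewrite lerD2l; apply: ler_pM.
have e5 : C * H `^ (3 * alpha) * `|a - b| <= C * H `^ (3 * alpha) * S.
  by rewrite ler_wpM2l// mulr_ge0// powR_ge0.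
rewrite (le_trans (lerD e4 e5))//.
have [H00|Hn0] := eqVneq H 0; first by rewrite H00 !powR0 ?gt_eqF// ?mulr_gt0// !(mul0r,mulr0) addr0.
have Q0' : 0 <= Q by move: Q0; rewrite pmulr_lge0// lt_def Hn0.
have : C * Q * (1 + C) * S * (H `^ alpha * H) <= C * Q * (1 + C) * S * H `^ (3 * alpha).
  by rewrite ler_wpM2l ?powH// !mulr_ge0// addr_ge0.
lra.
Qed.

(** Sewing is applied to the difference of the two expansion errors, with an
    exponent th strictly between 1 and 3 alpha: the one-step error h^(3 alpha)
    then equals h^th times a power of h that tends to 0.  This bounds
    |y - z| in terms of its own supremum S over the window, with a factor 1/2
    when the window is short. *)
Lemma almost_euler_diff_short (E : R) : 0 <= E ->
  exists K tau : R, [/\ 0 <= K, 0 < tau <= 1 &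
  forall (h : R) N y z, 0 < h -> N%:R * h <= T ->
    almost_euler E h N y -> almost_euler E h N z ->
  forall i n, (i + n <= N)%N -> n%:R * h <= tau ->
    `|y (i + n)%N - z (i + n)%N| <=
      2 * `|y i - z i| + K * h `^ ((3 * alpha - 1) / 2)].
Proof.
move=> E0.
have [tau1 /andP[tau10 tau11] apriori] := almost_euler_apriori.
have {apriori} [K1 K10 apriori] := apriori E E0.
pose th := (1 + 3 * alpha) / 2; pose del := (3 * alpha - 1) / 2.
have th1 : 1 < th by rewrite /th; move: al3; lra.
have thdel : th + del = 3 * alpha by rewrite /th /del; lra.
have thal : th <= 3 * alpha by rewrite /th; move: al3; lra.
have th0 : 0 < th by rewrite (lt_trans _ th1).
have del0 : 0 < del by rewrite /del; move: al3; lra.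
have [rho /andP[rho0 rho1] sew] := discrete_sewing th1.
pose C' := C * L + (C * (L + K1) * (1 + C) + C).
have C'0 : 0 <= C' by rewrite /C' !addr_ge0// !mulr_ge0// ?addr_ge0.
pose K2 := 2 * C' / rho.
have K20 : 0 <= K2 by rewrite divr_ge0 ?mulr_ge0// ltW.
pose M := C + L + K2.
have M0 : 0 < M by rewrite /M (lt_le_trans (lt_le_trans ltr01 C1))// -addrA lerDl addr_ge0.
have [tau2 /andP[tau20 tau21] tau2C] : exists2 tau : R, 0 < tau <= 1 &
    tau `^ alpha <= Num.min (rho / C) (2^-1 / M).
  apply: small_power => //.
  by rewrite lt_min !divr_gt0// ?(lt_le_trans _ C1)// invr_gt0.
move: tau2C; rewrite le_min !ler_pdivlMr// ?(lt_le_trans _ C1)// => /andP[tauC tauM].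
pose tau := Num.min tau1 tau2.
exists (8 * E / rho), tau; split.
- by rewrite divr_ge0 ?mulr_ge0// ltW.
- by rewrite /tau lt_min tau10 tau20 ge_min tau11.
move=> h N y z h0 NT yE zE i n inN nh; have h0' := ltW h0.
have {nh} [nh1 nh2] : n%:R * h <= tau1 /\ n%:R * h <= tau2.
  by apply/andP; rewrite -le_min.
pose S := \big[Num.max/0]_(l < n.+1) `|y (i + l)%N - z (i + l)%N|.
have SP l : (l <= n)%N -> `|y (i + l)%N - z (i + l)%N| <= S.
  by move=> ln; rewrite /S -ltnS in ln *;
    exact: (le_bigmax _ (fun l : 'I_n.+1 => `|y (i + l)%N - z (i + l)%N|) (Ordinal ln)).
have S0 : 0 <= S by exact: le_trans (SP 0%N _).
pose Dl a b := davie_defect h y a b - davie_defect h z a b.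
pose eps := h `^ del.
have eps0 : 0 <= eps by exact: powR_ge0.
have DlE l : (l <= n)%N ->
    `|Dl i (i + l)%N| <= (4 * E * eps + 2 * (C' * S)) / rho * (l%:R * h) `^ th.
  move=> ln.
  pose r a b := `|Dl (i + a)%N (i + b)%N|.
  have := sew h (C * tau2 `^ alpha) (2 * E * eps) (C' * S) n r h0' _ _ _ _ _ _ l 0%N ln.
  rewrite /r add0n addn0 (_ : 2 * (2 * E * eps) = 4 * E * eps); last by ring.
  apply.
  - by rewrite mulrC tauC andbT mulr_ge0// powR_ge0.
  - by rewrite !mulr_ge0.
  - by rewrite mulr_ge0.
  - move=> a an; rewrite /Dl /davie_defect /drift !big_geq//.
    rewrite !(germ_diag _ al0 gA) ?subrr ?subr0 ?subrr ?normr0//;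
    by apply: (grid_bound _ _ NT) => //; clear -an inN; lia.
  - move=> a an; rewrite addnS /Dl !davie_defect_step.
    have iaN : (i + a < N)%N by clear -an inN; lia.
    rewrite (le_trans (normB_le (yE _ iaN) (zE _ iaN)))//.
    by rewrite -thdel powR_add// -/eps; lra.
  move=> a m k amkn.
  set H := (m + k)%:R * h.
  have H0 : 0 <= H by rewrite mulr_ge0.
  have Hn : H <= n%:R * h by rewrite ler_wpM2r// ler_nat; clear -amkn; lia.
  have H1 : H <= 1 by rewrite (le_trans Hn)// (le_trans nh1).
  have H01 : 0 <= H <= 1 by rewrite H0.
  have imkN : (i + a + m + k <= N)%N by clear -amkn inN; lia.
  have imN : (i + a + m <= N)%N by clear -amkn inN; lia.
  have [sT uT tT us tu] := grid_facts h0 NT imkN.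
  have mH : m%:R * h <= H by rewrite ler_wpM2r// ler_nat leq_addr.
  rewrite !addnA {1}/Dl.
  rewrite !(@davie_defect_add _ _ (i + a)%N (i + a + m)%N (i + a + m + k)%N) ?leq_addr//.
  have ys := davie_defect_split h y (i + a) (i + a + m).
  have zs := davie_defect_split h z (i + a) (i + a + m).
  set ry := _ + davie_defect h y _ _ in ys.
  set rz := _ + davie_defect h z _ _ in zs.
  have rzE : `|rz| <= (L + K1) * H.
    rewrite mulrDl; apply: normD_le.
      by rewrite (le_trans (drift_norm _ _ _ h0'))// ler_wpM2l.
    rewrite (le_trans (apriori _ _ _ h0 NT zE _ _ imN _))//.
      by rewrite (le_trans mH)// (le_trans Hn).
    rewrite ler_wpM2l// (@le_trans _ _ (H `^ (3 * alpha)))//.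
      by apply: le_powR; rewrite ?mulr_ge0// ltW.
    by rewrite -[leRHS](powRr1 H0); apply: powR_expo_anti => //; exact: ltW.
  have ryz : `|ry - rz| <= L * H * S + `|Dl (i + a)%N (i + a + m)%N|.
    rewrite (_ : ry - rz = (drift h y (i + a) (i + a + m) - drift h z (i + a) (i + a + m))
      + Dl (i + a)%N (i + a + m)%N); last by rewrite /ry /rz /Dl; zmod.
    apply: normD_le => //; rewrite (le_trans (drift_lip h0' (S := S) _))//.
      move=> b bam; rewrite (_ : b = i + (b - i))%N; last by clear -bam; lia.
      by apply: SP; clear -bam amkn; lia.
    by rewrite ler_wpM2r// ler_wpM2l.
  have yzS : `|y (i + a)%N - z (i + a)%N| <= S by apply: SP; clear -amkn; lia.
  have := chen_defect_perturb ry sT uT tT us tu H01 yzS rzE.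
  rewrite -ys -zs.
  set ey := _ - chen_defect _ _ _ _ (y _).
  set ez := _ - chen_defect _ _ _ _ (z _) => pert.
  rewrite (_ : _ - _ = (Dl (i + a)%N (i + a + m)%N + Dl (i + a + m)%N (i + a + m + k)%N)
    + (ey - ez)); last by rewrite /Dl; zmod.
  rewrite (le_trans (normD_le (ler_normD _ _) pert))//.
  have e1 : H `^ alpha <= tau2 `^ alpha.
    by apply: le_powR; [exact: ltW| |rewrite (le_trans Hn)].
  have e2 : H `^ (3 * alpha) <= H `^ th by apply: powR_expo_anti.
  have e3 : C * H `^ alpha * `|ry - rz| <=
      C * H `^ alpha * (L * H * S) + C * tau2 `^ alpha * `|Dl (i + a)%N (i + a + m)%N|.
    rewrite (@le_trans _ _ (C * H `^ alpha * (L * H * S + `|Dl (i + a)%N (i + a + m)%N|)))//.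
      by rewrite ler_wpM2l// mulr_ge0// powR_ge0.
    by rewrite mulrDr lerD2l ler_wpM2r// ler_wpM2l.
  have e4 : C * L * S * (H `^ alpha * H) <= C * L * S * H `^ (3 * alpha).
    by rewrite ler_wpM2l ?powH// !mulr_ge0.
  have e5 : C' * S * H `^ (3 * alpha) <= C' * S * H `^ th by rewrite ler_wpM2l// mulr_ge0.
  move: e5; rewrite {1}/C' => e5; lra.
have key l : (l <= n)%N -> `|y (i + l)%N - z (i + l)%N| <=
    `|y i - z i| + 4 * E / rho * eps + S / 2.
  move=> ln; have /= := DlE l ln; set H := l%:R * h.
  have H0 : 0 <= H by rewrite mulr_ge0.
  have Hn : H <= n%:R * h by rewrite ler_wpM2r// ler_nat.
  have H1 : H <= 1 by rewrite (le_trans Hn)// (le_trans nh1).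
  have iT : `|i%:R * h| <= T by apply: grid_bound NT => //; clear -inN; lia.
  have ilT : `|(i + l)%:R * h| <= T by apply: grid_bound NT => //; clear -inN ln; lia.
  move=> Dle.
  rewrite (_ : _ - _ = (y i - z i) + (A (i%:R * h) ((i + l)%:R * h) (y i)
     - A (i%:R * h) ((i + l)%:R * h) (z i)) + (drift h y i (i + l) - drift h z i (i + l))
     + Dl i (i + l)%N); last by rewrite /Dl /davie_defect; zmod.
  have yz0 : `|y i - z i| <= S by have := SP 0%N isT; rewrite addn0.
  have e1 : `|A (i%:R * h) ((i + l)%:R * h) (y i) - A (i%:R * h) ((i + l)%:R * h) (z i)|
     <= C * H `^ alpha * S.
    rewrite (le_trans (germ_lip _ _ gA iT ilT))// grid_dist//.
    by rewrite ler_wpM2l// mulr_ge0// powR_ge0.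
  have e2 : `|drift h y i (i + l) - drift h z i (i + l)| <= L * H * S.
    apply: drift_lip => // a ila; rewrite (_ : a = i + (a - i))%N; last by clear -ila; lia.
    by apply: SP; clear -ila ln; lia.
  rewrite (le_trans (normD_le (normD_le (normD_le (lexx _) e1) e2) Dle))//.
  have e3 : H `^ alpha <= tau2 `^ alpha.
    by apply: le_powR; [exact: ltW| |rewrite (le_trans Hn)].
  have e4 : H <= tau2 `^ alpha.
    by rewrite (le_trans _ e3)// -[leLHS](powRr1 H0); apply: powR_expo_anti; rewrite ?H0.
  have e5 : H `^ th <= tau2 `^ alpha.
    rewrite (le_trans _ e3)//; apply: powR_expo_anti; rewrite ?H0// (le_trans al1)// ltW//.
  have e6 : H `^ th <= 1 by apply: powR_le1; [exact: ltW|rewrite H0].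
  have -> : (4 * E * eps + 2 * (C' * S)) / rho = 4 * E / rho * eps + K2 * S.
    by rewrite /K2; field; rewrite gt_eqF.
  have f1 : C * S * H `^ alpha <= C * S * tau2 `^ alpha by rewrite ler_wpM2l// mulr_ge0.
  have f2 : L * S * H <= L * S * tau2 `^ alpha by rewrite ler_wpM2l// mulr_ge0.
  have f3 : K2 * S * H `^ th <= K2 * S * tau2 `^ alpha by rewrite ler_wpM2l// mulr_ge0.
  have f4 : 4 * E / rho * eps * H `^ th <= 4 * E / rho * eps.
    by rewrite ler_piMr// !mulr_ge0// invr_ge0 ltW.
  have f5 : tau2 `^ alpha * M * S <= 2^-1 * S by rewrite ler_wpM2r.
  move: f5; rewrite /M; lra.
have S2 : S <= `|y i - z i| + 4 * E / rho * eps + S / 2.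
  apply/bigmax_leP; split => [|[l ln] _ /=]; last exact: key.
  by rewrite !addr_ge0 ?divr_ge0 ?mulr_ge0 ?invr_ge0// ltW.
have := SP n (leqnn n); rewrite -/del -/eps; lra.
Qed.

(** Iterates the previous bound over consecutive blocks, whose number depends on
    T and tau only. *)
Lemma almost_euler_stable (E : R) : 0 <= E ->
  exists K tau : R, [/\ 0 <= K, 0 < tau <= 1 &
  forall (h : R) N y z, 0 < h -> h <= tau -> N%:R * h <= T ->
    almost_euler E h N y -> almost_euler E h N z ->
  forall j, (j <= N)%N ->
    `|y j - z j| <= K * (`|y 0%N - z 0%N| + h `^ ((3 * alpha - 1) / 2))].
Proof.
move=> E0; have [K1 [tau [K10 tau01 short]]] := almost_euler_diff_short E0.
have /andP[tau0 tau1] := tau01.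
pose m := Num.bound (2 * T / tau).
exists (4 ^+ m * (1 + K1)), tau; split => //.
  by rewrite mulr_ge0 ?exprn_ge0 ?addr_ge0.
move=> h N y z h0 htau NT yE zE; have h0' := ltW h0.
pose X := `|y 0%N - z 0%N| + K1 * h `^ ((3 * alpha - 1) / 2).
have X0 : 0 <= X by rewrite addr_ge0// mulr_ge0// powR_ge0.
(* p steps form a block, of length between tau / 2 and tau *)
pose p := Num.truncn (tau / h).
have th1 : 1 <= tau / h by rewrite ler_pdivlMr// mul1r.
have th0 : 0 <= tau / h by rewrite (le_trans _ th1).
have p0 : (0 < p)%N by rewrite truncn_gt0.
have ph : p%:R * h <= tau by rewrite -ler_pdivlMr// -truncn_ge_nat.
have ph2 : tau <= 2 * (p%:R * h).
  rewrite mulrA -ler_pdivrMr// -natrM (le_trans (ltW (truncnS_gt _)))// -/p ler_nat.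
  by rewrite mul2n -addnn -addn1 leq_add2l.
(* each block costs a factor 2 and an error of at most X, whence 4^k *)
have claim k j : (j <= N)%N -> (j <= k * p)%N -> `|y j - z j| <= 4 ^+ k * X.
  elim: k j => [|k IH] j jN jp.
    move: jp; rewrite mul0n leqn0 => /eqP ->.
    by rewrite expr0 mul1r /X lerDl mulr_ge0// powR_ge0.
  pose i := (j - p)%N; pose n := (j - i)%N.
  have np : (n <= p)%N by rewrite /n /i; clear; lia.
  have inj : (i + n = j)%N by rewrite /n /i; clear; lia.
  have ikp : (i <= k * p)%N by rewrite /i; move: jp; rewrite mulSn; clear; lia.
  have iN : (i <= N)%N by rewrite (leq_trans _ jN)// -inj leq_addr.
  have := @short h N y z h0 NT yE zE i n; rewrite inj => /(_ jN).
  have nht : n%:R * h <= tau by rewrite (le_trans _ ph)// ler_wpM2r// ler_nat.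
  move=> /(_ nht) bd; rewrite (le_trans bd)//.
  have ih := IH i iN ikp.
  have K1h : K1 * h `^ ((3 * alpha - 1) / 2) <= 4 ^+ k * X.
    rewrite (@le_trans _ _ X)//; first by rewrite /X lerDr.
    by rewrite ler_peMl// exprn_ege1// ler1n.
  have X4 : 0 <= 4 ^+ k * X by rewrite mulr_ge0// exprn_ge0.
  by rewrite exprS -mulrA; lra.
move=> j jN; have T0 : 0 <= T by rewrite (le_trans _ NT)// mulr_ge0.
have Nmp : (N <= m * p)%N.
  rewrite -(ler_nat R) -(ler_pM2r h0) (le_trans NT)//.
  have : 2 * T / tau <= m%:R.
    by rewrite ltW// archi_boundP// divr_ge0 ?mulr_ge0// ltW.
  rewrite ler_pdivrMr// natrM -mulrA => Tm.
  have : m%:R * tau <= m%:R * (2 * (p%:R * h)) by rewrite ler_wpM2l.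
  by lra.
rewrite (le_trans (claim m j jN (leq_trans jN Nmp)))// -mulrA ler_wpM2l ?exprn_ge0//.
rewrite /X.
set a := h `^ _; have a0 : 0 <= a by exact: powR_ge0.
have : 0 <= K1 * `|y 0%N - z 0%N| by rewrite mulr_ge0.
by lra.
Qed.

Lemma almost_euler_holder (E : R) : 0 <= E -> exists K tau : R, [/\ 0 <= K, 0 < tau <= 1 &
  forall (h : R) N y, 0 < h -> N%:R * h <= T -> almost_euler E h N y ->
  forall i n, (i + n <= N)%N -> n%:R * h <= tau ->
    `|davie_defect h y i (i + n)| <= K * (n%:R * h) `^ (3 * alpha) /\
    `|y (i + n)%N - y i| <= K * (n%:R * h) `^ alpha].
Proof.
move=> E0; have [tau tau01 apriori] := almost_euler_apriori.
have {apriori} [K K0 apriori] := apriori E E0; have /andP[tau0 tau1] := tau01.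
exists (K + (C + L)), tau; split => //; first by rewrite !addr_ge0.
move=> h N y h0 NT yE i n inN nh; have h0' := ltW h0.
have D := apriori _ _ _ h0 NT yE _ _ inN nh.
have H0 : 0 <= n%:R * h by rewrite mulr_ge0.
have H1 : n%:R * h <= 1 by rewrite (le_trans nh).
split.
  by rewrite (le_trans D)// ler_wpM2r ?powR_ge0// lerDl addr_ge0.
rewrite (davie_defect_split h y i (i + n)) [X in `|X|](_ : _ =
  davie_defect h y i (i + n) + (A (i%:R * h) ((i + n)%:R * h) (y i) + drift h y i (i + n)));
  last by zmod.
have inT : `|(i + n)%:R * h| <= T by exact: grid_bound NT.
have iT : `|i%:R * h| <= T by apply: grid_bound NT => //; rewrite (leq_trans _ inN)// leq_addr.
rewrite !mulrDl; apply: normD_le; [|apply: normD_le].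
- rewrite (le_trans D)// ler_wpM2l// powR_expo_anti ?H0//.
  by rewrite ler_peMl ?ler1n// ltW.
- by rewrite (le_trans (germ_norm gA _ _ _))// grid_dist.
- rewrite (le_trans (drift_norm _ _ _ h0'))// ler_wpM2l//.
  by rewrite -[leLHS](powRr1 H0) powR_expo_anti ?H0.
Qed.

(** The sum of the drift over the window is replaced by its value at the left
    end: the sequence is alpha-Hölder there, and H^alpha H <= H^(3 alpha). *)
Lemma almost_euler_window (E : R) : 0 <= E -> exists K tau : R, [/\ 0 <= K, 0 < tau <= 1 &
  forall (h : R) N y, 0 < h -> N%:R * h <= T -> almost_euler E h N y ->
  forall i n, (i + n <= N)%N -> n%:R * h <= tau ->
    `|y (i + n)%N - y i - A (i%:R * h) ((i + n)%:R * h) (y i)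
       - (n%:R * h) *: F0 (y i)| <= K * (n%:R * h) `^ (3 * alpha)].
Proof.
move=> E0; have [K [tau [K0 tau01 hol]]] := almost_euler_holder E0.
have /andP[tau0 tau1] := tau01.
exists (K + L * K), tau; split => //; first by rewrite addr_ge0// mulr_ge0.
move=> h N y h0 NT yE i n inN ph; have h0' := ltW h0.
set H := n%:R * h in ph *.
have H0 : 0 <= H by rewrite mulr_ge0.
have H1 : H <= 1 by rewrite (le_trans ph).
have [D _] := hol _ _ _ h0 NT yE _ _ inN ph.
pose z := fun _ : nat => y i.
have zE : drift h z i (i + n) = H *: F0 (y i).
  by rewrite /drift /z /= sumr_const_nat addKn scalerMnl -mulr_natl.
rewrite [X in `|X|](_ : _ = davie_defect h y i (i + n) +
  (drift h y i (i + n) - drift h z i (i + n))).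
  rewrite mulrDl; apply: normD_le; first exact: D.
  rewrite (le_trans (drift_lip h0' (S := K * H `^ alpha) _))//.
    move=> l /andP[il ilp]; rewrite /z.
    rewrite (_ : l = i + (l - i))%N; last by rewrite subnKC.
    have lp : (l - i <= n)%N by clear -ilp; lia.
    have lh : (l - i)%:R * h <= H by rewrite ler_wpM2r// ler_nat.
    have ilN : (i + (l - i) <= N)%N by rewrite (leq_trans _ inN)// leq_add2l.
    have [_ hb] := hol _ _ _ h0 NT yE _ _ ilN (le_trans lh ph).
    rewrite (le_trans hb)//.
    by rewrite ler_wpM2l// le_powR// ?mulr_ge0// ltW.
  have : L * K * (H `^ alpha * H) <= L * K * H `^ (3 * alpha).
    by rewrite ler_wpM2l ?powH ?H0// mulr_ge0.
  by rewrite -/H; lra.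
by rewrite zE /davie_defect; zmod.
Qed.

(** The error constant on the coarse grid is independent of the number p of
    fine steps merged into one; this makes schemes of very different steps
    comparable. *)
Lemma almost_euler_coarsen (E : R) : 0 <= E -> exists E' tau : R, [/\ 0 <= E', 0 < tau <= 1 &
  forall (h : R) N p y, 0 < h -> p%:R * h <= tau -> (N * p)%:R * h <= T ->
    almost_euler E h (N * p) y ->
    almost_euler E' (p%:R * h) N (fun i => y (i * p)%N)].
Proof.
move=> E0; have [K [tau [K0 tau01 win]]] := almost_euler_window E0.
exists K, tau; split => // h N p y h0 ph NT yE i iN.
have ipN : (i * p + p <= N * p)%N by rewrite addnC -mulSn leq_mul2r iN orbT.
have := win _ _ _ h0 NT yE _ _ ipN ph.
by rewrite !mulrA -!natrM addnC -mulSn.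
Qed.

End euler_scheme.

(** * Coordinates and convergence with a rate *)

Section coordinates.
Context {R : realType} {E : normedVectType R}.
Let n := \dim {:E}.
Implicit Types x y : E.

Definition crd (i : 'I_n) x : R := coord (vbasis {:E}) i x.

Lemma crd_sum x : x = \sum_(i < n) crd i x *: (vbasis {:E})`_i.
Proof. exact: coord_vbasis (memvf x). Qed.

Lemma crdB i x y : crd i (x - y) = crd i x - crd i y.
Proof. by rewrite /crd linearB. Qed.

Lemma crd_le : exists2 c : R, 0 < c & forall i x, `|crd i x| <= c * `|x|.
Proof.
have /choice[c cP] i : exists c : R, 0 <= c /\ forall x, `|crd i x| <= c * `|x|.
  have [c c0 cx] := lfun_bounded (@dual_vbasis R E i).
  by exists c; split => // x; have := cx x; rewrite dual_vbasisE.
exists (1 + \sum_i c i) => [|i x].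
  by rewrite ltr_pwDl// sumr_ge0// => i _; case: (cP i).
have [ci0 /(_ x) /le_trans] := cP i; apply; rewrite ler_wpM2r//.
rewrite (bigD1 i)//= ler_wpDl// lerDl sumr_ge0// => j _.
by case: (cP j).
Qed.

Lemma norm_le_crd : exists2 c : R, 0 < c & forall x (m : R),
  0 <= m -> (forall i, `|crd i x| <= m) -> `|x| <= c * m.
Proof.
exists (1 + \sum_(i < n) `|(vbasis {:E})`_i|); first by rewrite ltr_pwDl// sumr_ge0.
move=> x m m0 xm; rewrite mulrDl mul1r ler_wpDl// {1}(crd_sum x) mulr_suml.
rewrite (le_trans (ler_norm_sum _ _ _))// ler_sum// => i _.
by rewrite normrZ mulrC ler_wpM2l.
Qed.

Lemma crd_continuous i : continuous (crd i).
Proof.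
have [c c0 cE] := crd_le => x; apply/cvgrPdist_le => eps eps0.
near=> z; rewrite -crdB (le_trans (cE _ _))// -ler_pdivlMl//.
by near: z; apply: cvgr_dist_le => //; rewrite mulr_gt0 ?invr_gt0.
Unshelve. all: by end_near. Qed.

Lemma crd_cvg (u : nat -> E) (l : E) :
  (forall i, crd i (u k) @[k --> \oo] --> crd i l) -> u @ \oo --> l.
Proof.
have [c c0 cE] := norm_le_crd => ul; apply/cvgrPdist_le => eps eps0.
have /= : \forall k \near \oo, forall i, `|crd i l - crd i (u k)| <= c^-1 * eps.
  apply: filter_forall => i.
  by have /cvgrPdist_le := ul i; apply; rewrite mulr_gt0 ?invr_gt0.
apply: filterS => k kE; rewrite (le_trans (cE _ (c^-1 * eps) _ _))//.
- by rewrite mulr_ge0 ?invr_ge0// ltW.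
- by move=> i; rewrite crdB.
- by rewrite mulrA divff ?mul1r// gt_eqF.
Qed.

End coordinates.

Section sequences.
Context {R : realType} {E : normedVectType R}.

Lemma cauchy_rate_real (u : nat -> R) (e : nat -> R) n0 :
  (forall n k, (n0 <= n)%N -> `|u (n + k)%N - u n| <= e n) ->
  (forall eps : R, 0 < eps -> exists2 n, (n0 <= n)%N & e n <= eps) ->
  cvgn u.
Proof.
move=> ue e0; apply: cauchy_cvg; apply: cauchy_exP => eps eps0.
have [n n0n en] := e0 _ (divr_gt0 eps0 (ltr0n _ 2)).
exists (u n); exists n => // m /= nm.
rewrite /ball/= distrC -(subnKC nm).
rewrite (le_lt_trans (ue _ _ _))// (le_lt_trans en)//; lra.
Qed.

(** Completeness is obtained from the real line, one coordinate at a time. *)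
Lemma cauchy_rate_cvg (u : nat -> E) (e : nat -> R) n0 :
  (forall n k, (n0 <= n)%N -> `|u (n + k)%N - u n| <= e n) ->
  (forall eps : R, 0 < eps -> exists2 n, (n0 <= n)%N & e n <= eps) ->
  cvgn u.
Proof.
move=> ue e0; have [c c0 cE] := @crd_le R E.
have /choice[l lE] i : exists l : R, (crd i (u k) @[k --> \oo] --> l).
  apply/cvg_ex; apply: (@cauchy_rate_real _ (fun n => c * e n) n0).
    by move=> n k n0n; rewrite -crdB (le_trans (cE _ _))// ler_wpM2l ?ue// ltW.
  move=> eps eps0; have [|n n0n en] := e0 (c^-1 * eps); first by rewrite mulr_gt0 ?invr_gt0.
  by exists n => //; rewrite mulrC -ler_pdivlMr// mulrC.
apply/cvg_ex; exists (\sum_i l i *: (vbasis {:E})`_i); apply: crd_cvg => i.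
rewrite (_ : crd i _ = l i)//; rewrite /crd coord_sum_free//.
exact: basis_free (vbasisP {:E}).
Qed.

Lemma cvg_rate (u : nat -> E) (l : E) n (e : R) : u @ \oo --> l ->
  (forall k, `|u (n + k)%N - u n| <= e) -> `|u n - l| <= e.
Proof.
move=> ul ue; apply/ler_addgt0Pr => eps eps0.
have /cvgrPdist_le /(_ _ eps0)[m _ mP] := ul.
rewrite (_ : u n - l = - (u (n + m)%N - u n) - (l - u (n + m)%N)); last by zmod.
apply: normB_le; rewrite ?normrN//; apply: mP => /=; exact: leq_addl.
Qed.

Lemma vanishing_step (p : R) : 0 < p -> forall n0 (M eps : R), 0 <= M -> 0 < eps ->
  exists2 n, (n0 <= n)%N & M * (2 ^- n) `^ p <= eps.
Proof.
move=> p0 n0 M eps M0 eps0.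
have M1 : 0 < M + 1 by rewrite ltr_wpDl.
have [tau /andP[tau0 _] tauE] := small_power p0 (divr_gt0 eps0 M1).
pose m := Num.bound (tau^-1).
exists (maxn n0 m); first exact: leq_maxl.
rewrite (@le_trans _ _ (M * tau `^ p))//.
  rewrite ler_wpM2l// le_powR ?invr_ge0 ?exprn_ge0// ?(ltW p0)//.
  by rewrite invf_ple ?posrE ?exprn_gt0// ltW// upper_nthrootP// leq_maxr.
rewrite (le_trans (ler_wpM2l M0 tauE))// mulrCA ler_piMr ?(ltW eps0)//.
by rewrite ler_pdivrMr// mul1r lerDl.
Qed.

End sequences.

(** * Convergence of the Euler scheme, uniqueness of the limit *)

Section bounded_lipschitz.
Context {R : realType} {W : normedModType R}.

Definition bounded_lipschitz (L : R) (F0 : W -> W) : Prop :=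
  (forall y, `|F0 y| <= L) /\ (forall y z, `|F0 y - F0 z| <= L * `|y - z|).

End bounded_lipschitz.

Section euler_path.
Context {R : realType} {W : normedVectType R}.
Variables (A : R -> R -> W -> W) (F0 : W -> W).

Fixpoint euler (h : R) (y : W) (n : nat) : W :=
  if n is m.+1 then
    let x := euler h y m in x + A (m%:R * h) (m.+1%:R * h) x + h *: F0 x
  else y.

(** The scheme is frozen between grid times, so that its value at t depends on t
    only through a number of steps. *)
Definition euler_path (n : nat) (y : W) (t : R) : W :=
  euler (2 ^- n) y (Num.truncn (t * 2 ^+ n)).

Definition euler_lim (y : W) (t : R) : W := limn (fun n => euler_path n y t).

Definition davie_rem (Y : R -> W) (s t : R) : W :=
  Y t - Y s - A s t (Y s) - (t - s) *: F0 (Y s).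

Variable alpha : R.

(** The expansion is demanded for nearby times only: this is enough to
    determine the path, and is what the estimates provide directly. *)
Definition forward_davie (Y : R -> W) := forall T : R, exists K tau : R,
  [/\ 0 <= K, 0 < tau & forall s t : R, 0 <= s -> s <= t -> t <= T -> t - s <= tau ->
      `|davie_rem Y s t| <= K * (t - s) `^ (3 * alpha)].

Definition davie (Y : R -> W) := forall T : R, exists K tau : R,
  [/\ 0 <= K, 0 < tau & forall s t : R, `|s| <= T -> `|t| <= T -> `|t - s| <= tau ->
      `|davie_rem Y s t| <= K * `|t - s| `^ (3 * alpha)].

Lemma davie_forward (Y : R -> W) : davie Y -> forward_davie Y.
Proof.
move=> dY T; have [K [tau [K0 tau0 D]]] := dY T; exists K, tau; split => // s t s0 st tT sttau.
have t0 := le_trans s0 st; have sT := le_trans st tT.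
have := D s t; rewrite !ger0_norm ?subr_ge0//; exact.
Qed.

Lemma euler_almost h y N : almost_euler alpha A F0 0 h N (euler h y).
Proof.
move=> i _; rewrite mul0r normr_le0 /=; apply/eqP; zmod.
Qed.

End euler_path.

Section dyadic_grid.
Context {R : realType}.
Implicit Types t : R.

Lemma step_gt0 n : 0 < 2 ^- n :> R.
Proof. by rewrite invr_gt0 exprn_gt0. Qed.

Lemma step_le1 n : 2 ^- n <= 1 :> R.
Proof. by rewrite invf_le1 ?exprn_gt0// exprn_ege1// ler1n. Qed.

Lemma step_small (tau : R) : 0 < tau -> exists n0, forall n, (n0 <= n)%N -> 2 ^- n <= tau.
Proof.
move=> tau0; exists (Num.bound tau^-1) => n n0n.
by rewrite invf_ple ?posrE ?exprn_gt0// ltW// upper_nthrootP.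
Qed.

Lemma step_addM n k : 2 ^- n = (2 ^ k)%:R * 2 ^- (n + k) :> R.
Proof.
by rewrite natrX exprD invfM mulrCA divff ?mulr1// gt_eqF// exprn_gt0.
Qed.

Lemma grid_floor n t : 0 <= t ->
  let i := Num.truncn (t * 2 ^+ n) in
  i%:R * 2 ^- n <= t /\ t < i%:R * 2 ^- n + 2 ^- n.
Proof.
move=> t0 /=; have t2 : 0 <= t * 2 ^+ n by rewrite mulr_ge0// exprn_ge0.
split; first by rewrite ler_pdivrMr ?exprn_gt0// -truncn_ge_nat.
by rewrite -[X in _ + X]mul1r -mulrDl ltr_pdivlMr ?exprn_gt0// -(natrD _ _ 1) addn1 truncnS_gt.
Qed.

Lemma grid_floor_dist n t : 0 <= t ->
  `|t - (Num.truncn (t * 2 ^+ n))%:R * 2 ^- n| <= 2 ^- n.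
Proof.
by move=> /(grid_floor n)[t1 t2]; rewrite ger0_norm ?subr_ge0//; lra.
Qed.

Lemma grid_floor_le n s t : 0 <= s -> s <= t ->
  (Num.truncn (s * 2 ^+ n) <= Num.truncn (t * 2 ^+ n))%N.
Proof. by move=> s0 st; rewrite le_truncn// ler_wpM2r// exprn_ge0. Qed.

Lemma grid_floor_refine n k t : 0 <= t ->
  (Num.truncn (t * 2 ^+ n) * 2 ^ k <= Num.truncn (t * 2 ^+ (n + k)))%N /\
  (Num.truncn (t * 2 ^+ (n + k)) < Num.truncn (t * 2 ^+ n) * 2 ^ k + 2 ^ k)%N.
Proof.
move=> t0; have t2 m : 0 <= t * 2 ^+ m by rewrite mulr_ge0// exprn_ge0.
have k0 : 0 < 2 ^+ k :> R by rewrite exprn_gt0.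
split.
  rewrite truncn_ge_nat// natrM natrX exprD mulrA ler_pM2r// -truncn_ge_nat//.
rewrite [X in (_ < X)%N]addnC -mulSn truncn_lt_nat// natrM natrX exprD mulrA ltr_pM2r//.
exact: truncnS_gt.
Qed.

End dyadic_grid.

Section euler_convergence.
Context {R : realType} {W : normedVectType R}.
Variables (alpha L : R) (A : R -> R -> W -> W) (F0 : W -> W).
Hypothesis halpha : 3^-1 < alpha <= 2^-1.
Hypothesis gA : rough_germ alpha A.
Hypothesis F0bl : bounded_lipschitz L F0.

Let F0_bd : forall y, `|F0 y| <= L. Proof. by case: F0bl. Qed.
Let F0_lip : forall y z, `|F0 y - F0 z| <= L * `|y - z|. Proof. by case: F0bl. Qed.
Let L0 : 0 <= L. Proof. exact: le_trans (normr_ge0 _) (F0_bd 0). Qed.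
Let al0 : 0 < alpha.
Proof. by case/andP: halpha => + _; apply: lt_trans; rewrite invr_gt0. Qed.
Let al3 : 1 < 3 * alpha.
Proof. by case/andP: halpha => + _; lra. Qed.
Let al1 : alpha <= 1.
Proof. by case/andP: halpha => _; lra. Qed.

Definition rate : R := (3 * alpha - 1) / 2.

Let rate0 : 0 < rate. Proof. by rewrite /rate; move: al3; lra. Qed.
Let rate_al : rate <= alpha.
Proof. by rewrite /rate; case/andP: halpha => _; lra. Qed.

Let step_al n : (2 ^- n : R) `^ alpha <= (2 ^- n) `^ rate.
Proof. by apply: powR_expo_anti; rewrite ?(ltW (step_gt0 n)) ?step_le1. Qed.

(** Reading the finer scheme every 2^k steps gives an almost Euler sequence for
    the step 2^-n with a constant independent of k, so that stability compares
    it with the scheme of that step; rounding t costs an alpha-Hölder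
    increment. *)
Lemma euler_path_cauchy (T : R) : exists M n0,
  0 <= M /\ forall n k (t : R) y, (n0 <= n)%N -> 0 <= t -> t <= T ->
  `|euler_path A F0 (n + k) y t - euler_path A F0 n y t| <= M * (2 ^- n) `^ rate.
Proof.
have [C gC] := gA T.
have [E [tau1 [E0 /andP[tau10 _] coarsen]]] := almost_euler_coarsen halpha gC F0_bd F0_lip (lexx 0).
have [K2 [tau2 [K20 /andP[tau20 _] stab]]] := almost_euler_stable halpha gC F0_bd F0_lip E0.
have [K3 [tau3 [K30 /andP[tau30 _] hol]]] := almost_euler_holder halpha gC F0_bd (lexx 0).
have [n1 n1P] := step_small tau10.
have [n2 n2P] := step_small tau20.
have [n3 n3P] := step_small tau30.
exists (K2 + K3), (maxn n1 (maxn n2 n3)); split; first by rewrite addr_ge0.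
move=> n k t y; rewrite !geq_max => /and3P[n1n n2n n3n] t0 tT.
rewrite /euler_path.
set i := Num.truncn (t * 2 ^+ n); set j := Num.truncn _.
pose h : R := 2 ^- (n + k); pose p := (2 ^ k)%N.
have h0 : 0 < h by exact: step_gt0.
have hp : 2 ^- n = p%:R * h by exact: step_addM.
have [ipj jip] := grid_floor_refine n k t0; rewrite -/i -/j -/p in ipj jip.
have [it _] := grid_floor n t0; rewrite -/i in it.
have [jt _] := grid_floor (n + k) t0; rewrite -/j -/h in jt.
have ipT : (i * p)%:R * h <= T by rewrite natrM -mulrA -hp (le_trans it).
have iT : i%:R * 2 ^- n <= T by exact: le_trans tT.
have jT : j%:R * h <= T by exact: le_trans tT.
have pt1 : p%:R * h <= tau1 by rewrite -hp n1P.
have ye := coarsen h i p _ h0 pt1 ipT (@euler_almost _ _ A F0 alpha h y _).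
rewrite -hp in ye.
have ze : almost_euler alpha A F0 E (2 ^- n) i (euler A F0 (2 ^- n) y).
  move=> l li; rewrite (le_trans (euler_almost A F0 alpha _ y li))//.
  by rewrite mul0r mulr_ge0// powR_ge0.
have := stab _ _ _ _ (step_gt0 n) (n2P _ n2n) iT ye ze i (leqnn i).
rewrite mul0n subrr normr0 add0r -/rate => s1.
have jE : (i * p + (j - i * p) = j)%N by rewrite subnKC.
have jN : (i * p + (j - i * p) <= j)%N by rewrite jE.
have jpn : (j - i * p)%:R * h <= 2 ^- n.
  by rewrite hp ler_wpM2r ?(ltW h0)// ler_nat leq_subLR ltnW.
have [_ ] := hol h j _ h0 jT (@euler_almost _ _ A F0 alpha h y _) _ _ jN (le_trans jpn (n3P _ n3n)).
rewrite jE => s2.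
rewrite (_ : _ - _ = euler A F0 h y (i * p)%N - euler A F0 (2 ^- n) y i +
  (euler A F0 h y j - euler A F0 h y (i * p)%N)); last by zmod.
rewrite mulrDl; apply: normD_le => //; rewrite (le_trans s2)//.
rewrite ler_wpM2l// (le_trans _ (step_al n))// le_powR ?(ltW al0)// mulr_ge0// ltW//.
Qed.

Lemma euler_path_cvg t y : 0 <= t -> (fun n => euler_path A F0 n y t) @ \oo --> euler_lim A F0 y t.
Proof.
move=> t0; have [M [n0 [M0 cau]]] := euler_path_cauchy t.
apply: (@cauchy_rate_cvg _ _ _ (fun n => M * (2 ^- n) `^ rate) n0).
  by move=> n k n0n; apply: cau.
by move=> eps eps0; exact: vanishing_step.
Qed.

Lemma euler_path_rate (T : R) : exists M n0,
  0 <= M /\ forall n (t : R) y, (n0 <= n)%N -> 0 <= t -> t <= T ->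
  `|euler_path A F0 n y t - euler_lim A F0 y t| <= M * (2 ^- n) `^ rate.
Proof.
have [M [n0 [M0 cau]]] := euler_path_cauchy T.
exists M, n0; split => // n t y n0n t0 tT.
have := @cvg_rate R W (fun n => euler_path A F0 n y t) (euler_lim A F0 y t) n (M * (2 ^- n) `^ rate) (@euler_path_cvg t y t0).
by apply=> k; exact: cau.
Qed.

Lemma euler_lim0 y : euler_lim A F0 y 0 = y.
Proof.
rewrite /euler_lim; apply/cvg_lim => //.
rewrite (_ : (fun n => _) = fun=> y); first exact: cvg_cst.
by apply/funext => n; rewrite /euler_path mul0r truncn0.
Qed.

(** The expansion of the scheme between the grid points next to s and t passes
    to the limit: moving the times, the state and the time increment costs
    M' h^rate, which is at most eps for a fine grid. *)
Lemma euler_lim_davie y : forward_davie A F0 alpha (euler_lim A F0 y).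
Proof.
move=> T; have [C gC] := gA T.
have C1 : 1 <= C := germ_ge1 gC.
have C0 : 0 <= C by exact: le_trans C1.
have [M [n0 [M0 rt]]] := euler_path_rate T.
have [K [tau [K0 /andP[tau0 tau1] win]]] :=
  almost_euler_window halpha gC F0_bd F0_lip (lexx 0).
have th0 : 0 <= 3 * alpha by rewrite mulr_ge0// ltW.
exists (K * 2 `^ (3 * alpha)), (tau / 2); split.
- by rewrite mulr_ge0// powR_ge0.
- by rewrite divr_gt0.
move=> s t s0 st tT sttau.
have tT' : `|t| <= T by rewrite ger0_norm// (le_trans s0).
have sT' : `|s| <= T by rewrite ger0_norm// (le_trans st).
have t0 := le_trans s0 st; have sT := le_trans st tT.
have [->|snt] := eqVneq s t.
  rewrite /davie_rem !subrr (germ_diag _ al0 gC)// scale0r !subr0 normr0.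
  by rewrite mulr_ge0 ?powR_ge0// mulr_ge0// powR_ge0.
have lt_st : s < t by rewrite lt_def eq_sym snt.
have [n1 n1P] := @step_small _ (t - s) (ltac:(by rewrite subr_gt0)).
apply/ler_addgt0Pr => eps eps0.
pose M' := 2 * M + (2 * C + C * M) + (2 * L + L * M).
have M'0 : 0 <= M' by rewrite /M' !addr_ge0 ?mulr_ge0.
have [n] := @vanishing_step _ rate rate0 (maxn n0 n1) M' eps M'0 eps0.
rewrite geq_max => /andP[n0n n1n] M'e.
set Y := euler_lim A F0 y.
have Ys := rt n s y n0n s0 sT; have Yt := rt n t y n0n t0 tT.
rewrite -/Y in Ys Yt.
move: Ys Yt; rewrite /euler_path.
set i := Num.truncn (s * _); set j := Num.truncn _; set h : R := 2 ^- n.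
set yi := euler _ _ _ _ i; set yj := euler _ _ _ _ j.
set e := h `^ rate => Ys Yt.
have e0 : 0 <= e by exact: powR_ge0.
have h0 : 0 < h by exact: step_gt0.
have si : `|s - i%:R * h| <= h by exact: grid_floor_dist.
have tj : `|t - j%:R * h| <= h by exact: grid_floor_dist.
have [jt _] := grid_floor n t0; rewrite -/j -/h in jt.
have [is_ si'] := grid_floor n s0; rewrite -/i -/h in is_ si'.
have ij : (i <= j)%N by exact: grid_floor_le.
have jE : (i + (j - i) = j)%N by rewrite subnKC.
have hst : h <= t - s by exact: n1P.
have jih : (j - i)%:R * h <= 2 * (t - s) by rewrite natrB// mulrBl; lra.
have jitau : (j - i)%:R * h <= tau by rewrite (le_trans jih)//; lra.
have jT := le_trans jt tT.
have := win h j _ h0 jT (@euler_almost _ _ A F0 alpha h y _) i (j - i)%N _ jitau.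
rewrite jE => /(_ (leqnn j)); rewrite -/yi -/yj.
set q := (j - i)%:R * h in jih jitau *.
have q0 : 0 <= q by rewrite mulr_ge0// ltW.
have q1 : q <= 1 by rewrite (le_trans jitau).
have qE : q = j%:R * h - i%:R * h by rewrite /q natrB// mulrBl.
set a := A (i%:R * h) (j%:R * h) => w.
have halE : h `^ alpha <= e by exact: step_al.
have hE : h <= e.
  rewrite -[leLHS](@powRr1 _ h (ltW h0)); apply: powR_expo_anti => //.
  - by rewrite (le_trans rate_al).
  - by rewrite (ltW h0) step_le1.
have iT' : `|i%:R * h| <= T.
  by rewrite ger0_norm ?(le_trans is_)// mulr_ge0// ltW.
have jT' : `|j%:R * h| <= T.
  by rewrite ger0_norm ?(le_trans jt)// mulr_ge0// ltW.
have pal x : `|x| <= h -> `|x| `^ alpha <= e.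
  by move=> xh; rewrite (le_trans _ halE)// le_powR// ltW.
have a1 : `|a (Y s) - A s t (Y s)| <= 2 * C * e.
  rewrite (le_trans (germ_time gC _ sT' tT' iT' jT'))//.
  have -> : 2 * C * e = C * (e + e) by ring.
  by rewrite ler_wpM2l// lerD// distrC pal.
have a2 : `|a (Y s) - a yi| <= C * M * e.
  rewrite (le_trans (germ_lip _ _ gC iT' jT'))// -mulrA -[leRHS]mulrA ler_wpM2l//.
  rewrite (@le_trans _ _ (1 * `|Y s - yi|))//; last by rewrite mul1r distrC.
  by rewrite ler_wpM2r// -qE ger0_norm// powR_le1 ?q0// ltW.
have d1 : `|((t - s) - q) *: F0 (Y s)| <= 2 * L * e.
  rewrite normrZ qE (_ : t - s - _ = (t - j%:R * h) - (s - i%:R * h)); last by ring.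
  rewrite (@le_trans _ _ ((e + e) * L))//; last by rewrite le_eqVlt; apply/orP; left; apply/eqP; ring.
  by apply: ler_pM => //; apply: normB_le; exact: le_trans hE.
have d2 : `|q *: (F0 (Y s) - F0 yi)| <= L * M * e.
  rewrite normrZ ger0_norm// -mulrA (@le_trans _ _ (1 * (L * `|Y s - yi|)))//.
    by apply: ler_pM.
  by rewrite mul1r ler_wpM2l// distrC.
rewrite (_ : davie_rem _ _ _ _ _ = (yj - yi - a yi - q *: F0 yi) - (yj - Y t) + (yi - Y s)
   + (a (Y s) - A s t (Y s)) - (a (Y s) - a yi)
   - (((t - s) - q) *: F0 (Y s) + q *: (F0 (Y s) - F0 yi))); last first.
  by rewrite /davie_rem scalerBr [(t - s - q) *: _]scalerBl; zmod.
have qth : q `^ (3 * alpha) <= 2 `^ (3 * alpha) * (t - s) `^ (3 * alpha).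
  by rewrite -powRM ?subr_ge0// le_powR.
have Kq : K * q `^ (3 * alpha) <= K * (2 `^ (3 * alpha) * (t - s) `^ (3 * alpha)).
  by rewrite ler_wpM2l.
rewrite (le_trans (normB_le (normB_le (normD_le (normD_le (normB_le w Yt) Ys) a1) a2)
  (normD_le d1 d2)))//.
move: M'e; rewrite /M' -/e; lra.
Qed.

End euler_convergence.

Section uniqueness.
Context {R : realType} {W : normedVectType R}.
Variables (alpha L : R) (A : R -> R -> W -> W) (F0 : W -> W).
Hypothesis halpha : 3^-1 < alpha <= 2^-1.
Hypothesis gA : rough_germ alpha A.
Hypothesis F0bl : bounded_lipschitz L F0.

(** Sampled with step t / 2^n, both paths are almost Euler sequences with the
    same initial value, so stability bounds their distance at t by a vanishing
    power of the step. *)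
Lemma forward_davie_unique (Y1 Y2 : R -> W) :
  forward_davie A F0 alpha Y1 -> forward_davie A F0 alpha Y2 -> Y1 0 = Y2 0 ->
  forall t, 0 <= t -> Y1 t = Y2 t.
Proof.
move=> dY1 dY2 Y0 t t0; have [->//|tn0] := eqVneq t 0.
have tgt0 : 0 < t by rewrite lt_def tn0.
have [C gC] := gA t; have [F0_bd F0_lip] := F0bl.
have [K1 [tau1 [K10 tau10 dav1]]] := dY1 t.
have [K2 [tau2 [K20 tau20 dav2]]] := dY2 t.
have E0 : 0 <= K1 + K2 by rewrite addr_ge0.
have [K [tau [K0 /andP[tau0 tau1'] stab]]] := almost_euler_stable halpha gC F0_bd F0_lip E0.
have rate0 : 0 < rate alpha by rewrite /rate; case/andP: halpha => ? _; lra.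
apply/eqP; rewrite -subr_eq0 -normr_le0; apply/ler_addgt0Pr => eps eps0; rewrite add0r.
pose tm := Num.min tau (Num.min tau1 tau2).
have tm0 : 0 < tm / t by rewrite divr_gt0// !lt_min tau0 tau10 tau20.
have [n0 n0P] := step_small tm0.
have M0 : 0 <= K * t `^ rate alpha by rewrite mulr_ge0// powR_ge0.
have [n n0n nE] := vanishing_step rate0 n0 M0 eps0.
pose h := t * 2 ^- n.
have h0 : 0 < h by rewrite mulr_gt0// step_gt0.
have : h <= tm by rewrite /h mulrC -ler_pdivlMr// n0P.
rewrite !le_min => /and3P[htau htau1 htau2].
have NT : (2 ^ n)%N%:R * h = t.
  by rewrite natrX /h mulrCA divff ?mulr1// gt_eqF// exprn_gt0.
have hS i : i.+1%:R * h - i%:R * h = h by rewrite -mulrBl -natrB// subSnn mul1r.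
have ae (Y : R -> W) K' (tau' : R) : 0 <= K' <= K1 + K2 -> h <= tau' ->
    (forall s t0, 0 <= s -> s <= t0 -> t0 <= t -> t0 - s <= tau' ->
      `|davie_rem A F0 Y s t0| <= K' * (t0 - s) `^ (3 * alpha)) ->
    almost_euler alpha A F0 (K1 + K2) h (2 ^ n) (fun i => Y (i%:R * h)).
  move=> /andP[K'0 K'K] ht' dY i iN.
  have := dY (i%:R * h) (i.+1%:R * h); rewrite /davie_rem hS.
  move=> /(_ _ _ _ ht') H; rewrite (le_trans (H _ _ _))//.
  - by rewrite mulr_ge0// ltW.
  - by rewrite ler_wpM2r ?ler_nat// ltW.
  - by rewrite -NT ler_wpM2r ?ler_nat// ltW.
  - by rewrite ler_wpM2r// powR_ge0.
have ae1 := ae Y1 K1 tau1 _ htau1 dav1.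
have ae2 := ae Y2 K2 tau2 _ htau2 dav2.
have := stab h (2 ^ n)%N _ _ h0 htau _ (ae1 _) (ae2 _) (2 ^ n)%N (leqnn _).
rewrite NT lexx mul0r Y0 subrr normr0 add0r => H.
rewrite (le_trans (H _ _ _))//.
- by rewrite K10 lerDl.
- by rewrite K20 lerDr.
- move: nE; rewrite -mulrA -powRM ?(ltW tgt0)// ltW// step_gt0.
Qed.

End uniqueness.

(** * Two-sided time *)

Section time_reversal.
Context {R : realType} {W : normedVectType R}.
Variables (alpha L : R) (A : R -> R -> W -> W) (F0 : W -> W).

Definition reverse_germ (s t : R) : W -> W := A (- s) (- t).

Lemma rough_germ_reverse : rough_germ alpha A -> rough_germ alpha reverse_germ.
Proof.
move=> gA T; have [C gC] := gA T; exists C.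
have NB (x y : R) : `|- x - - y| = `|x - y| by rewrite -opprD normrN.
have NT (x : R) : `|x| <= T -> `|- x| <= T by rewrite normrN.
split; first exact: germ_ge1 gC.
- by move=> s t y sT tT; rewrite -NB; apply: (germ_norm gC); exact: NT.
- by move=> s t a r b q sT tT; rewrite -NB; apply: (germ_diff2 gC); exact: NT.
- move=> h s u t y sT uT tT su ut; apply: (germ_defect gC); rewrite ?NB//; exact: NT.
- move=> h s u t y z sT uT tT su ut; apply: (germ_defect_lip gC); rewrite ?NB//; exact: NT.
- move=> s t s' t' y sT tT sT' tT'; rewrite -(NB s') -(NB t').
  by apply: (germ_time gC); exact: NT.
Qed.

Lemma bounded_lipschitz_opp : bounded_lipschitz L F0 -> bounded_lipschitz L (fun y => - F0 y).
Proof.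
by case=> bd lip; split => [y|y z]; rewrite ?normrN// -opprD normrN.
Qed.

Lemma davie_rem_reverse (Y : R -> W) s t :
  davie_rem reverse_germ (fun y => - F0 y) (fun r => Y (- r)) s t =
  davie_rem A F0 Y (- s) (- t).
Proof.
rewrite /davie_rem /reverse_germ scalerN -scaleNr; congr (_ - _ *: _); ring.
Qed.

End time_reversal.

Section two_sided.
Context {R : realType} {W : normedVectType R}.
Variables (alpha L : R) (A : R -> R -> W -> W) (F0 : W -> W).
Hypothesis halpha : 3^-1 < alpha <= 2^-1.
Hypothesis gA : rough_germ alpha A.
Hypothesis F0bl : bounded_lipschitz L F0.

Let F0_bd : forall y, `|F0 y| <= L. Proof. by case: F0bl. Qed.
Let F0_lip : forall y z, `|F0 y - F0 z| <= L * `|y - z|. Proof. by case: F0bl. Qed.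
Let L0 : 0 <= L. Proof. exact: le_trans (normr_ge0 _) (F0_bd 0). Qed.
Let al0 : 0 < alpha.
Proof. by case/andP: halpha => + _; apply: lt_trans; rewrite invr_gt0. Qed.
Let al3 : 1 < 3 * alpha.
Proof. by case/andP: halpha => + _; lra. Qed.
Let al1 : alpha <= 1.
Proof. by case/andP: halpha => _; lra. Qed.
Let al2 : 3 * alpha <= 1 + alpha.
Proof. by case/andP: halpha => _; lra. Qed.

(** Expansions from s to u and from s to t combine, through the Chen defect,
    into one from u to t.  With t = s this reverses the direction of an
    expansion. *)
Lemma davie_rem_rebase (T K : R) : 0 <= K -> exists2 K' : R, 0 <= K' &
  forall (Y : R -> W) (s u t H : R), `|s| <= T -> `|u| <= T -> `|t| <= T ->
    `|u - s| <= H -> `|t - s| <= H -> `|t - u| <= H -> H <= 1 ->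
    `|davie_rem A F0 Y s u| <= K * H `^ (3 * alpha) ->
    `|davie_rem A F0 Y s t| <= K * H `^ (3 * alpha) ->
    `|davie_rem A F0 Y u t| <= K' * H `^ (3 * alpha).
Proof.
move=> K0; have [C gC] := gA T.
have C0 : 0 <= C by rewrite (le_trans _ (germ_ge1 gC)).
exists (K + K + C + C * (K + L) + L * (C + K + L)); first by rewrite !addr_ge0 ?mulr_ge0 ?addr_ge0.
move=> Y s u t H sT uT tT us ts tu H1 Du Dt.
have H0 : 0 <= H by exact: le_trans us.
have H01 : 0 <= H <= 1 by rewrite H0.
have Hal : H <= H `^ alpha.
  by rewrite -[leLHS](powRr1 H0); exact: powR_expo_anti.
have Hth : H `^ (3 * alpha) <= H.
  by rewrite -[leRHS](powRr1 H0); apply: powR_expo_anti => //; exact: ltW.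
have HalH : H `^ alpha * H <= H `^ (3 * alpha).
  rewrite -[X in _ * X](powRr1 H0) -powR_add//.
  by apply: powR_expo_anti; rewrite ?mulr_gt0// addrC.
have pal (x : R) : `|x| <= H -> `|x| `^ alpha <= H `^ alpha.
  by move=> xH; apply: le_powR => //; exact: ltW.
have inc : `|Y s + A s u (Y s) - Y u| <= (K + L) * H.
  rewrite (_ : _ - _ = - davie_rem A F0 Y s u - (u - s) *: F0 (Y s)); last first.
    by rewrite /davie_rem; zmod.
  rewrite mulrDl; apply: normB_le.
    by rewrite normrN (le_trans Du)// ler_wpM2l.
  by rewrite normrZ mulrC; apply: ler_pM.
have inc' : `|Y s - Y u| <= (C + K + L) * H `^ alpha.
  rewrite (_ : _ - _ = (Y s + A s u (Y s) - Y u) - A s u (Y s)); last by zmod.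
  rewrite (_ : C + K + L = K + L + C); last by ring.
  rewrite [leRHS]mulrDl; apply: normB_le.
    by rewrite (le_trans inc)// ler_wpM2l// addr_ge0.
  rewrite (le_trans (germ_norm gC _ _ _))// ler_wpM2l// pal//.
rewrite (_ : davie_rem A F0 Y u t = davie_rem A F0 Y s t - davie_rem A F0 Y s u
  + chen_defect A s u t (Y s) + (A u t (Y s + A s u (Y s)) - A u t (Y u))
  + (t - u) *: (F0 (Y s) - F0 (Y u))); last first.
  rewrite /davie_rem /chen_defect scalerBr (_ : t - u = (t - s) - (u - s)); last by ring.
  by rewrite [(t - s - (u - s)) *: F0 (Y s)]scalerBl; zmod.
have tr := germ_defect gC (Y s) sT uT tT us tu.
have e1 : `|A u t (Y s + A s u (Y s)) - A u t (Y u)| <= C * (K + L) * H `^ (3 * alpha).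
  rewrite (le_trans (germ_lip _ _ gC uT tT))//.
  rewrite (@le_trans _ _ (C * H `^ alpha * ((K + L) * H)))//.
    apply: ler_pM => //; first by rewrite mulr_ge0 ?powR_ge0.
    by rewrite ler_wpM2l// pal.
  by rewrite mulrACA ler_wpM2l// mulr_ge0// addr_ge0.
have e2 : `|(t - u) *: (F0 (Y s) - F0 (Y u))| <= L * (C + K + L) * H `^ (3 * alpha).
  rewrite normrZ (@le_trans _ _ (H * (L * ((C + K + L) * H `^ alpha))))//.
    by apply: ler_pM => //; rewrite (le_trans (F0_lip _ _))// ler_wpM2l.
  rewrite (_ : H * _ = L * (C + K + L) * (H `^ alpha * H)); last by ring.
  by rewrite ler_wpM2l// mulr_ge0// !addr_ge0.
by rewrite (le_trans (normD_le (normD_le (normD_le (normB_le Dt Du) tr) e1) e2))// -!mulrDl.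
Qed.

Lemma davie_rem_diag (T : R) (Y : R -> W) t : `|t| <= T -> davie_rem A F0 Y t t = 0.
Proof.
move=> tT; have [C gC] := gA T.
by rewrite /davie_rem (germ_diag _ al0 gC)// !subrr scale0r !subr0.
Qed.

Lemma davie_reverse (Y : R -> W) : davie A F0 alpha Y ->
  davie (reverse_germ A) (fun y => - F0 y) alpha (fun r => Y (- r)).
Proof.
move=> dY T; have [K [tau [K0 tau0 D]]] := dY T; exists K, tau; split => // s t sT tT st.
have NB (x y : R) : `|- x - - y| = `|x - y| by rewrite -opprD normrN.
by rewrite davie_rem_reverse -NB; apply: D; rewrite ?NB ?normrN.
Qed.

(** Each half provides expansions away from 0.  An arbitrary pair s, t is reduced
    to these by rebasing at the median of 0, s and t, from which both s and t are
    reached by moving away from 0. *)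
Lemma davie_glue (Yp Ym : R -> W) : Yp 0 = Ym 0 ->
  forward_davie A F0 alpha Yp ->
  forward_davie (reverse_germ A) (fun y => - F0 y) alpha Ym ->
  davie A F0 alpha (fun t => if 0 <= t then Yp t else Ym (- t)).
Proof.
pose Y t := if 0 <= t then Yp t else Ym (- t).
move=> Y0 dp dm; rewrite -/Y => T.
have [Kp [taup [Kp0 taup0 Dp]]] := dp T.
have [Km [taum [Km0 taum0 Dm]]] := dm T.
have Ym_ (r : R) : 0 <= r -> Y (- r) = Ym r.
  rewrite /Y oppr_ge0 opprK => r0; case: ifPn => // r0'.
  have -> : r = 0 by apply/eqP; rewrite eq_le r0 r0'.
  by rewrite oppr0.
have Yp_ (r : R) : 0 <= r -> Y r = Yp r by rewrite /Y => ->.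
pose K := Kp + Km.
have K0 : 0 <= K by rewrite addr_ge0.
have [K' K'0 rebase] := davie_rem_rebase T K0.
exists K', (Num.min 1 (Num.min taup taum)); split => //.
  by rewrite !lt_min ltr01 taup0.
move=> s t sT tT; rewrite !le_min => /and3P[st1 stp stm].
have away (b r : R) : `|b| <= T -> `|r| <= T -> (0 <= b /\ b <= r) \/ (b <= 0 /\ r <= b) ->
    `|r - b| <= `|t - s| ->
    `|davie_rem A F0 Y b r| <= K * `|t - s| `^ (3 * alpha).
  move=> bT rT br rb.
  have mono : `|r - b| `^ (3 * alpha) <= `|t - s| `^ (3 * alpha).
    by apply: le_powR => //; rewrite ltW// (lt_trans _ al3).
  have [rbp rbm] : `|r - b| <= taup /\ `|r - b| <= taum by split; exact: le_trans rb _.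
  case: br => -[b0 br].
    have r0 := le_trans b0 br.
    have rem : davie_rem A F0 Y b r = davie_rem A F0 Yp b r by rewrite /davie_rem !Yp_.
    rewrite rem mulrDl ler_wpDr ?mulr_ge0 ?powR_ge0//.
    have rbE : `|r - b| = r - b by rewrite ger0_norm ?subr_ge0.
    have rT' : r <= T by rewrite (le_trans (ler_norm _)).
    have := Dp b r b0 br rT'; rewrite -rbE => /(_ rbp) /le_trans; apply.
    by rewrite ler_wpM2l.
  have r0 := le_trans br b0.
  have rem : davie_rem A F0 Y b r =
      davie_rem (reverse_germ A) (fun y => - F0 y) Ym (- b) (- r).
    have := davie_rem_reverse A F0 Y (- b) (- r); rewrite !opprK => <-.
    by rewrite /davie_rem !Ym_ ?oppr_ge0.
  rewrite rem mulrDl ler_wpDl ?mulr_ge0 ?powR_ge0//.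
  have rbE : `|r - b| = - r - - b by rewrite ler0_norm ?subr_le0// opprB opprK addrC.
  have rT' : - r <= T by rewrite (le_trans (ler_norm _))// normrN.
  have := Dm (- b) (- r); rewrite oppr_ge0 lerN2 -rbE => /(_ b0 br rT' rbm) /le_trans.
  by apply; rewrite ler_wpM2l.
(* b is the median of 0, s and t *)
suff [b [bT bs bt bs' bt']] : exists b : R, [/\ `|b| <= T,
    (0 <= b /\ b <= s) \/ (b <= 0 /\ s <= b), (0 <= b /\ b <= t) \/ (b <= 0 /\ t <= b),
    `|s - b| <= `|t - s| & `|t - b| <= `|t - s|].
  by apply: (rebase _ b) => //; apply: away.
have T0 : 0 <= T by exact: le_trans sT.
have [s0|s0] := leP 0 s; have [t0|t0] := leP 0 t.
- have [st|ts] := leP s t.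
    by exists s; split => //; [left|left|rewrite subrr normr0].
  exists t; split => //; [by left; split => //; exact: ltW|by left|by rewrite distrC|].
  by rewrite subrr normr0.
- exists 0; split; rewrite ?normr0//; [by left|by right; split => //; exact: ltW| |].
    by rewrite subr0 [leRHS]distrC !ger0_norm ?subr_ge0//; lra.
  by rewrite subr0 !ler0_norm//; lra.
- exists 0; split; rewrite ?normr0//; [by right; split => //; exact: ltW|by left| |].
    by rewrite subr0 ler0_norm ?ger0_norm//; lra.
  by rewrite subr0 !ger0_norm//; lra.
- have s0' := ltW s0; have t0' := ltW t0; have [st|ts] := leP s t.
    exists t; split => //; [by right|by right|by rewrite distrC|].
    by rewrite subrr normr0.
  by exists s; split => //; [right|right; split => //; exact: ltW|rewrite subrr normr0].
Qed.

Lemma davie_unique (Y1 Y2 : R -> W) :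
  davie A F0 alpha Y1 -> davie A F0 alpha Y2 -> Y1 0 = Y2 0 -> Y1 = Y2.
Proof.
move=> d1 d2 Y0; apply/funext => t; have [t0|t0] := leP 0 t.
  by apply: (forward_davie_unique halpha gA F0bl) => //; exact: davie_forward.
rewrite -(opprK t).
pose Yr (Y : R -> W) := fun r => Y (- r).
have /(_ halpha (rough_germ_reverse gA) (bounded_lipschitz_opp F0bl)) uni :=
  @forward_davie_unique _ _ alpha L (reverse_germ A) (fun y => - F0 y).
apply: (uni (Yr Y1) (Yr Y2)); rewrite /Yr ?oppr0 ?oppr_ge0 ?(ltW t0)//.
  exact: davie_forward (davie_reverse d1).
exact: davie_forward (davie_reverse d2).
Qed.

End two_sided.

Section two_sided_solution.
Context {R : realType} {W : normedVectType R}.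
Variables (alpha L : R) (A : R -> R -> W -> W) (F0 : W -> W).

Definition euler_approx (n : nat) (y : W) (t : R) : W :=
  if 0 <= t then euler_path A F0 n y t
  else euler_path (reverse_germ A) (fun y => - F0 y) n y (- t).

Hypothesis halpha : 3^-1 < alpha <= 2^-1.
Hypothesis gA : rough_germ alpha A.
Hypothesis F0bl : bounded_lipschitz L F0.

Theorem davie_exists y : exists Y : R -> W,
  [/\ Y 0 = y, davie A F0 alpha Y &
      forall t, (fun n => euler_approx n y t) @ \oo --> Y t].
Proof.
have gA' := rough_germ_reverse gA; have F0bl' := bounded_lipschitz_opp F0bl.
exists (fun t => if 0 <= t then euler_lim A F0 y t
  else euler_lim (reverse_germ A) (fun y => - F0 y) y (- t)); split.
- by rewrite lexx euler_lim0.
- apply: (davie_glue halpha gA F0bl); first by rewrite !euler_lim0.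
    exact: euler_lim_davie halpha gA F0bl y.
  exact: euler_lim_davie halpha gA' F0bl' y.
- move=> t; rewrite /euler_approx; have [t0|t0] := leP 0 t.
    exact: (euler_path_cvg halpha gA F0bl).
  by apply: (euler_path_cvg halpha gA' F0bl'); rewrite oppr_ge0 ltW.
Qed.

End two_sided_solution.

(** * Calculus with uniform bounds *)

Section mean_value.
Context {R : realType} {E G : normedVectType R}.
Implicit Types (f : E -> G).

Lemma is_derive_cvg f a v w : is_derive a v f w <->
  (fun h : R => h^-1 *: (f (h *: v + a) - f a)) @ 0^' --> w.
Proof.
split=> [[d <-]|H]; first exact: d.
by split; [apply/cvg_ex; exists w|exact: cvg_lim].
Qed.

Lemma is_derive_shift f a q v w :
  is_derive (a + q) v f w -> is_derive a v (fun x => f (x + q)) w.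
Proof.
move=> /is_derive_cvg H; apply/is_derive_cvg; apply: cvg_trans H.
by apply: near_eq_cvg; near=> h; rewrite addrA.
Unshelve. all: by end_near. Qed.

Lemma fderiveE f x v : fderive f x v = 'd f x v.
Proof. exact: lfunE. Qed.

Lemma is_derive_fderive f x v : differentiable f x -> is_derive x v f (fderive f x v).
Proof.
move=> df; rewrite fderiveE; split; first exact: diff_derivable.
by rewrite deriveE.
Qed.

Lemma is_derive_line f a v w (i : 'I_(\dim {:G})) (t : R) :
  is_derive (a + t *: v) v f w ->
  is_derive t 1 (fun r : R => crd i (f (a + r *: v))) (crd i w).
Proof.
move=> /is_derive_cvg H.
have {}H : (fun h : R => crd i (h^-1 *: (f (h *: v + (a + t *: v)) - f (a + t *: v)))) @ 0^' --> crd i w.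
  by apply: (cvg_comp _ _ H); exact: crd_continuous.
have e : (fun h : R => h^-1 *: (crd i (f (a + (h *: (1 : R) + t) *: v)) - crd i (f (a + t *: v)))) @ 0^' --> crd i w.
  apply: cvg_trans H; apply: near_eq_cvg; near=> h.
  rewrite /crd linearZ linearB /= scalerDl [h *: (1 : R)]mulr1.
  by rewrite addrCA.
by split; [apply/cvg_ex; exists (crd i w)|exact: cvg_lim].
Unshelve. all: by end_near. Qed.

(** The one-dimensional theorem applies to every coordinate along the segment;
    K is the price of passing from the norm to coordinates and back.  The
    reference value w is arbitrary, so that first-order remainders are covered
    by the same statement. *)
Lemma mean_value_bound : exists2 K : R, 0 < K & forall f df a v w (M : R), 0 <= M ->
  (forall x, is_derive x v f (df x)) ->
  (forall t : R, 0 <= t <= 1 -> `|df (a + t *: v) - w| <= M) ->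
  `|f (a + v) - f a - w| <= K * M.
Proof.
have [c c0 cE] := @norm_le_crd R G; have [c' c'0 c'E] := @crd_le R G.
exists (c * c'); first by rewrite mulr_gt0.
move=> f df a v w M M0 fdf dfM; rewrite -mulrA; apply: cE => [|i].
  by rewrite mulr_ge0// ltW.
pose g (r : R) := crd i (f (a + r *: v)).
have dg (r : R) : is_derive r (1 : R) g (crd i (df (a + r *: v))) by apply: is_derive_line.
have cg : {within `[0, 1], continuous g}.
  apply: derivable_within_continuous => r _.
  exact: (@ex_derive _ _ _ _ _ _ _ (dg r)).
have [r r01 gE] := MVT_segment (ler01 : (0 : R) <= 1) (fun r _ => dg r) cg.
rewrite !crdB; move: gE; rewrite /g scale1r scale0r addr0 subr0 mulr1 => ->.
rewrite -crdB (le_trans (c'E _ _))// ler_wpM2l ?(ltW c'0)// dfM//.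
Qed.

End mean_value.

Section lfun_sub.
Context {R : realType} {E G : normedVectType R}.

Lemma lfunB (f : 'Hom(E, G)) x y : f (x - y) = f x - f y.
Proof. exact: linearB. Qed.

Lemma lfunD (f : 'Hom(E, G)) x y : f (x + y) = f x + f y.
Proof. exact: linearD. Qed.

Lemma sub_lfunE (f g : 'Hom(E, G)) x : (f - g) x = f x - g x.
Proof. by rewrite add_lfunE opp_lfunE. Qed.

Lemma lfun_norm_le (f : 'Hom(E, G)) x : `|f x| <= `|f| * `|x|.
Proof. exact: opnormP. Qed.

End lfun_sub.

Section C2_classes.
Context {R : realType} {E : normedVectType R}.

(** What two bounded derivatives give, in terms of differences only: this form is
    stable under sums and products without computing any derivative. *)
Record bounded_C2 {G : normedModType R} (C : R) (f : E -> G) : Prop := BoundedC2 {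
  bC2_norm : forall y, `|f y| <= C ;
  bC2_lip : forall y z, `|f y - f z| <= C * `|y - z| ;
  bC2_diff2 : forall a b q,
    `|f (a + q) - f a - (f (b + q) - f b)| <= C * (`|q| * `|a - b|) }.

Lemma bounded_C2_le {G : normedModType R} (C C' : R) (f : E -> G) :
  C <= C' -> bounded_C2 C f -> bounded_C2 C' f.
Proof.
move=> CC' [b1 b2 b3]; split => [y|y z|a b q].
- exact: le_trans CC'.
- by rewrite (le_trans (b2 _ _))// ler_wpM2r.
- by rewrite (le_trans (b3 _ _ _))// ler_wpM2r// mulr_ge0.
Qed.

Lemma bounded_C2_ge0 {G : normedModType R} (C : R) (f : E -> G) : bounded_C2 C f -> 0 <= C.
Proof. by case=> b _ _; exact: le_trans (b 0). Qed.

Lemma bounded_C2D {G : normedModType R} (C D : R) (f g : E -> G) :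
  bounded_C2 C f -> bounded_C2 D g -> bounded_C2 (C + D) (fun y => f y + g y).
Proof.
move=> [f1 f2 f3] [g1 g2 g3]; split => [y|y z|a b q].
- exact: normD_le.
- rewrite (_ : _ - _ = (f y - f z) + (g y - g z)); last by zmod.
  by rewrite mulrDl; exact: normD_le.
- rewrite (_ : _ - _ = (f (a + q) - f a - (f (b + q) - f b)) +
    (g (a + q) - g a - (g (b + q) - g b))); last by zmod.
  by rewrite mulrDl; exact: normD_le.
Qed.

Lemma bounded_C2_sum {G : normedModType R} n (C : 'I_n -> R) (f : 'I_n -> E -> G) :
  (forall i, bounded_C2 (C i) (f i)) ->
  bounded_C2 (\sum_i C i) (fun y => \sum_i f i y).
Proof.
elim: n C f => [|n IH] C f fC.
  rewrite big_ord0; have -> : (fun y => \sum_(i < 0) f i y) = fun=> 0.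
    by apply/funext => y; rewrite big_ord0.
  by split => *; rewrite ?subrr ?normr0 ?mul0r.
rewrite big_ord_recl; have -> : (fun y => \sum_(i < n.+1) f i y) =
    fun y => f ord0 y + \sum_(i < n) f (lift ord0 i) y.
  by apply/funext => y; rewrite big_ord_recl.
by apply: bounded_C2D => //; apply: IH => i; exact: fC.
Qed.

Lemma bounded_C2_app {G H : normedVectType R} (C D : R)
    (f : E -> 'Hom(G, H)) (g : E -> G) :
  bounded_C2 C f -> bounded_C2 D g -> bounded_C2 (4 * (C * D)) (fun y => f y (g y)).
Proof.
move=> fC gD; have C0 := bounded_C2_ge0 fC; have D0 := bounded_C2_ge0 gD.
case: fC gD => f1 f2 f3 [g1 g2 g3].
have app (l : 'Hom(G, H)) (x : G) (c d : R) : `|l| <= c -> `|x| <= d -> `|l x| <= c * d.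
  by move=> lc xd; rewrite (le_trans (lfun_norm_le _ _))//; apply: ler_pM => //; exact: opnorm_ge0.
have CD0 : 0 <= C * D by rewrite mulr_ge0.
split => [y|y z|a b q].
- by rewrite (le_trans (app _ _ _ _ (f1 y) (g1 y)))//; lra.
- rewrite (_ : _ - _ = (f y - f z) (g y) + f z (g y - g z)); last first.
    by rewrite linearB add_lfunE opp_lfunE; zmod.
  rewrite (le_trans (normD_le (app _ _ _ _ (f2 _ _) (g1 _)) (app _ _ _ _ (f1 _) (g2 _ _))))//.
  have : 0 <= C * D * `|y - z| by rewrite mulr_ge0.
  lra.
- rewrite (_ : _ - _ = (f (a + q) - f a - (f (b + q) - f b)) (g (a + q))
    + (f (b + q) - f b) (g (a + q) - g (b + q))
    + ((f a - f b) (g (a + q) - g a) + f b (g (a + q) - g a - (g (b + q) - g b)))); last first.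
    by rewrite !linearB /= !(add_lfunE, opp_lfunE); zmod.
  have ab : `|g (a + q) - g (b + q)| <= D * `|a - b|.
    rewrite (le_trans (g2 _ _))// (_ : a + q - (b + q) = a - b)//; zmod.
  have bq : `|f (b + q) - f b| <= C * `|q|.
    rewrite (le_trans (f2 _ _))// (_ : b + q - b = q)//; zmod.
  have aq : `|g (a + q) - g a| <= D * `|q|.
    rewrite (le_trans (g2 _ _))// (_ : a + q - a = q)//; zmod.
  rewrite (le_trans (normD_le (normD_le (app _ _ _ _ (f3 _ _ _) (g1 _)) (app _ _ _ _ bq ab))
    (normD_le (app _ _ _ _ (f2 _ _) aq) (app _ _ _ _ (f1 _) (g3 _ _ _)))))//.
  by rewrite le_eqVlt; apply/orP; left; apply/eqP; ring.
Qed.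

Lemma bounded_C2_eval {G H : normedVectType R} (C : R) (f : E -> 'Hom(G, H)) (u : G) :
  bounded_C2 C f -> bounded_C2 (C * `|u|) (fun y => f y u).
Proof.
move=> fC; have C0 := bounded_C2_ge0 fC; case: fC => f1 f2 f3.
have app (l : 'Hom(G, H)) (c : R) : `|l| <= c -> `|l u| <= c * `|u|.
  by move=> lc; rewrite (le_trans (lfun_norm_le _ _))// ler_wpM2r.
split => [y|y z|a b q].
- exact: app.
- by rewrite mulrAC -opp_lfunE -add_lfunE; exact: app.
- by rewrite mulrAC -!opp_lfunE -!add_lfunE -opp_lfunE -add_lfunE; exact: app.
Qed.

End C2_classes.

Section Cb_estimates.
Context {R : realType} {E : normedVectType R}.

Lemma Cb_bound {G : normedVectType R} k (f : E -> G) : Cb k f ->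
  exists2 M : R, 0 <= M & forall x, `|f x| <= M.
Proof.
case: k => [|k] [[M fM] _]; exists M => //; exact: le_trans (normr_ge0 _) (fM 0).
Qed.

Lemma Cb_pred {G : normedVectType R} k (f : E -> G) : Cb k.+1 f -> Cb k f.
Proof.
elim: k G f => [|k IH] G f [fb [df Df]]; split => //.
  by move=> x; exact/differentiable_continuous.
by split => //; exact: IH.
Qed.

Lemma fderive_le {G : normedVectType R} (f : E -> G) x v (M : R) :
  `|fderive f x| <= M -> `|fderive f x v| <= M * `|v|.
Proof. by move=> fM; rewrite (le_trans (lfun_norm_le _ _))// ler_wpM2r. Qed.

Lemma Cb1_lipschitz {G : normedVectType R} (f : E -> G) : Cb 1 f ->
  exists2 L : R, 0 <= L & forall y z, `|f y - f z| <= L * `|y - z|.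
Proof.
move=> [_ [df Df]]; have [M M0 DM] := Cb_bound (Df : Cb 0 (fderive f)).
have [K K0 mvb] := @mean_value_bound R E G.
exists (K * M); first by rewrite mulr_ge0// ltW.
move=> y z; have := mvb f (fun x => fderive f x (y - z)) z (y - z) 0 (M * `|y - z|).
rewrite subr0 (_ : z + (y - z) = y) ?mulrA; last by zmod.
apply.
- by rewrite mulr_ge0.
- by move=> x; exact: is_derive_fderive.
- by move=> t _; rewrite subr0; apply: fderive_le.
Qed.

Lemma Cb2_diff2 {G : normedVectType R} (f : E -> G) : Cb 2 f ->
  exists2 C : R, 0 <= C & forall a b q,
    `|f (a + q) - f a - (f (b + q) - f b)| <= C * (`|q| * `|a - b|).
Proof.
move=> [_ [df Df]]; have [L L0 DL] := Cb1_lipschitz (Df : Cb 1 (fderive f)).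
have [K K0 mvb] := @mean_value_bound R E G.
exists (K * L); first by rewrite mulr_ge0// ltW.
move=> a b q; pose g x := f (x + q) - f x.
have := mvb g (fun x => fderive f (x + q) (a - b) - fderive f x (a - b)) b (a - b) 0
  (L * `|q| * `|a - b|).
rewrite subr0 -!mulrA /g (_ : b + (a - b) = a); last by zmod.
apply.
- by rewrite !mulr_ge0.
- by move=> x; apply: is_deriveB; [apply: is_derive_shift|]; exact: is_derive_fderive.
- move=> t _; rewrite subr0 -opp_lfunE -add_lfunE mulrA (le_trans (lfun_norm_le _ _))//.
  rewrite ler_wpM2r// (le_trans (DL _ _))// (_ : _ + q - _ = q)//; zmod.
Qed.

Lemma Cb2_bounded_C2 {G : normedVectType R} (f : E -> G) : Cb 2 f -> exists C, bounded_C2 C f.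
Proof.
move=> f2; have [M M0 fM] := Cb_bound f2.
have [L L0 fL] := Cb1_lipschitz (Cb_pred f2).
have [D D0 fD] := Cb2_diff2 f2.
exists (M + L + D); split => [y|y z|a b q].
- by rewrite (le_trans (fM _))// -addrA lerDl addr_ge0.
- by rewrite (le_trans (fL _ _))// ler_wpM2r// [M + _]addrC -addrA lerDl addr_ge0.
- by rewrite (le_trans (fD _ _ _))// ler_wpM2r ?mulr_ge0// lerDr addr_ge0.
Qed.

Definition taylor1 {G : normedVectType R} (f : E -> G) (y v : E) : G :=
  f (y + v) - f y - fderive f y v.

(** Increments of the Taylor remainder in v are increments of f minus a linear
    map, and the derivative of f differs from that at y by at most a multiple of
    |v| + |v'| along the segment from y + v' to y + v. *)
Lemma taylor1_lip {G : normedVectType R} (f : E -> G) : Cb 2 f ->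
  exists2 C : R, 0 <= C & forall y v v',
    `|taylor1 f y v - taylor1 f y v'| <= C * ((`|v| + `|v'|) * `|v - v'|).
Proof.
move=> [_ [df Df]]; have [L L0 DL] := Cb1_lipschitz (Df : Cb 1 (fderive f)).
have [K K0 mvb] := @mean_value_bound R E G.
exists (K * L); first by rewrite mulr_ge0// ltW.
move=> y v v'; rewrite /taylor1 (_ : _ - _ = f (y + v' + (v - v')) - f (y + v')
    - fderive f y (v - v')); last first.
  rewrite (_ : y + v' + (v - v') = y + v); last by zmod.
  by rewrite lfunB; zmod.
rewrite -!mulrA; apply: (mvb f (fun x => fderive f x (v - v'))).
- by rewrite !mulr_ge0// addr_ge0.
- by move=> x; exact: is_derive_fderive.
- move=> t /andP[t0 t1]; rewrite -opp_lfunE -add_lfunE mulrA (le_trans (lfun_norm_le _ _))//.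
  rewrite ler_wpM2r// (le_trans (DL _ _))// ler_wpM2l//.
  rewrite (_ : y + v' + t *: (v - v') - y = t *: v + (1 - t) *: v'); last first.
    by rewrite scalerBr scalerBl scale1r; zmod.
  apply: normD_le; rewrite normrZ ger0_norm// ?subr_ge0//; apply: ler_piMl => //; lra.
Qed.

(** Seen as a function of v, the difference has as derivative a second difference
    of Df.  Differentiating in the base point instead would require the symmetry
    of the second derivative. *)
Lemma taylor1_base {G : normedVectType R} (f : E -> G) : Cb 3 f ->
  exists2 C : R, 0 <= C & forall y z v,
    `|taylor1 f y v - taylor1 f z v| <= C * (`|v| ^+ 2 * `|y - z|).
Proof.
move=> [_ [df Df]]; have [D D0 DD] := Cb2_diff2 (Df : Cb 2 (fderive f)).
have [K K0 mvb] := @mean_value_bound R E G.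
exists (K * D); first by rewrite mulr_ge0// ltW.
move=> y z v; pose g x := f (x + y) - f (x + z).
rewrite /taylor1 (_ : _ - _ = g (0 + v) - g 0 - (fderive f y v - fderive f z v)); last first.
  by rewrite /g !add0r ![v + _]addrC; zmod.
rewrite -!mulrA; apply: (mvb g (fun x => fderive f (x + y) v - fderive f (x + z) v)).
- by rewrite !mulr_ge0// exprn_ge0.
- by move=> x; apply: is_deriveB; apply: is_derive_shift; exact: is_derive_fderive.
- move=> t /andP[t0 t1]; rewrite add0r -!opp_lfunE -!add_lfunE -opp_lfunE -add_lfunE.
  rewrite (le_trans (lfun_norm_le _ _))// (_ : D * _ = D * (`|v| * `|y - z|) * `|v|); last by ring.
  rewrite ler_wpM2r// (_ : _ - _ = fderive f (y + t *: v) - fderive f y -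
     (fderive f (z + t *: v) - fderive f z)); last by rewrite ![t *: v + _]addrC; zmod.
  rewrite (le_trans (DD _ _ _))// ler_wpM2l// ler_wpM2r// normrZ ger0_norm//.
  exact: ler_piMl.
Qed.

End Cb_estimates.

Section bounded_lipschitz_calculus.
Context {R : realType} {W : normedVectType R}.
Implicit Types (f g v : W -> W) (C D m : R).

Lemma bounded_lipschitz_le C D f : C <= D -> bounded_lipschitz C f -> bounded_lipschitz D f.
Proof.
move=> CD [f1 f2]; split => [y|y z]; first exact: le_trans CD.
by rewrite (le_trans (f2 _ _))// ler_wpM2r.
Qed.

Lemma bounded_lipschitz_ext C f g : (forall y, f y = g y) ->
  bounded_lipschitz C g -> bounded_lipschitz C f.
Proof. by move=> /funext ->. Qed.

Lemma bounded_lipschitzD C D f g : bounded_lipschitz C f -> bounded_lipschitz D g ->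
  bounded_lipschitz (C + D) (fun y => f y + g y).
Proof.
move=> [f1 f2] [g1 g2]; split => [y|y z]; first exact: normD_le.
rewrite (_ : _ - _ = (f y - f z) + (g y - g z)); last by zmod.
by rewrite mulrDl; exact: normD_le.
Qed.

Lemma bounded_lipschitzB C D f g : bounded_lipschitz C f -> bounded_lipschitz D g ->
  bounded_lipschitz (C + D) (fun y => f y - g y).
Proof. by move=> fC gD; apply: bounded_lipschitzD => //; exact: bounded_lipschitz_opp. Qed.

Lemma bounded_C2_perturb C f a r b q : bounded_C2 C f ->
  `|f (a + r) - f a - (f (b + q) - f b)| <= C * (`|r - q| + `|q| * `|a - b|).
Proof.
move=> [f1 f2 f3].
rewrite (_ : _ - _ = (f (a + r) - f (a + q)) + (f (a + q) - f a - (f (b + q) - f b)));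
  last by zmod.
rewrite mulrDr; apply: normD_le => //; rewrite (le_trans (f2 _ _))//.
by rewrite (_ : a + r - (a + q) = r - q)//; zmod.
Qed.

(** Of first order in the size m of the shift, both in sup norm and in Lipschitz
    constant; a bound on Df alone would not control the latter. *)
Lemma bounded_C2_shift C m f v : bounded_C2 C f -> bounded_lipschitz m v ->
  bounded_lipschitz (2 * (C * m)) (fun y => f (y + v y) - f y).
Proof.
move=> fC [v1 v2]; have C0 := bounded_C2_ge0 fC.
have m0 : 0 <= m by exact: le_trans (v1 0).
split => [y|y z].
  case: fC => f1 f2 f3; rewrite (le_trans (f2 _ _))//.
  rewrite (_ : y + v y - y = v y); last by zmod.
  have := ler_wpM2l C0 (v1 y).
  have : 0 <= C * m by rewrite mulr_ge0.
  lra.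
rewrite (le_trans (bounded_C2_perturb _ _ _ _ fC))//.
have e : `|v z| * `|y - z| <= m * `|y - z| by rewrite ler_wpM2r.
have := ler_wpM2l C0 (lerD (v2 y z) e); lra.
Qed.

End bounded_lipschitz_calculus.

(** * Second-order terms and areas for reversed times *)

Section second_level.
Context {R : realType} {U V W : normedVectType R}.
Variable F : W -> 'Hom(U, W).
Hypothesis hF : Cb 3 F.

Definition second_coef (y : W) (u1 u2 : U) : W := fderive F y (F y u1) u2.

(** DF(y) F(y) contracted with (P (x) P') T.  Keeping P and P' apart makes the
    expression multilinear, so that the effect of varying Z' is split
    linearly. *)
Definition second_lift (y : W) (P P' : 'Hom(V, U)) (T : tensor2 V) : W :=
  tens_lift (fun x x' => second_coef y (P x) (P' x')) T.

Let F2 : exists C, bounded_C2 C F.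
Proof. exact: Cb2_bounded_C2 (Cb_pred hF). Qed.

Let DF2 : exists C, bounded_C2 C (fderive F).
Proof. by apply: Cb2_bounded_C2; case: hF => _ []. Qed.

Lemma first_coef_C2 : exists2 C : R, 0 <= C &
  forall u, bounded_C2 (C * `|u|) (fun y => F y u).
Proof.
have [C FC] := F2; exists C; first exact: bounded_C2_ge0 FC.
by move=> u; exact: bounded_C2_eval.
Qed.

Lemma second_coef_C2 : exists2 C : R, 0 <= C &
  forall u1 u2, bounded_C2 (C * (`|u1| * `|u2|)) (fun y => second_coef y u1 u2).
Proof.
have [C FC] := F2; have [D DC] := DF2.
have C0 := bounded_C2_ge0 FC; have D0 := bounded_C2_ge0 DC.
exists (4 * (D * C)) => [|u1 u2]; first by rewrite !mulr_ge0.
have -> : 4 * (D * C) * (`|u1| * `|u2|) = 4 * (D * (C * `|u1|)) * `|u2| by ring.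
apply: bounded_C2_eval; apply: bounded_C2_app => //; exact: bounded_C2_eval.
Qed.

Lemma second_coefBl y u1 u2 u : second_coef y (u1 - u2) u = second_coef y u1 u - second_coef y u2 u.
Proof. by rewrite /second_coef !lfunB sub_lfunE. Qed.

Lemma second_coefBr y u1 u2 u : second_coef y u (u1 - u2) = second_coef y u u1 - second_coef y u u2.
Proof. by rewrite /second_coef lfunB. Qed.

Lemma second_coefDr y u1 u2 u : second_coef y u (u1 + u2) = second_coef y u u1 + second_coef y u u2.
Proof. by rewrite /second_coef linearD. Qed.

Lemma second_liftBl y P Q P' T :
  second_lift y (P - Q) P' T = second_lift y P P' T - second_lift y Q P' T.
Proof.
by rewrite /second_lift /tens_lift -sumrB; apply: eq_bigr => i _; rewrite sub_lfunE second_coefBl.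
Qed.

Lemma second_liftBr y P P' Q T :
  second_lift y P (P' - Q) T = second_lift y P P' T - second_lift y P Q T.
Proof.
by rewrite /second_lift /tens_lift -sumrB; apply: eq_bigr => i _; rewrite sub_lfunE second_coefBr.
Qed.

Lemma second_liftD y P P' T T' :
  second_lift y P P' (T + T') = second_lift y P P' T + second_lift y P P' T'.
Proof.
rewrite /second_lift /tens_lift -big_split; apply: eq_bigr => i _ /=.
by rewrite add_lfunE linearD second_coefDr.
Qed.

Lemma second_liftB y P P' T T' :
  second_lift y P P' (T - T') = second_lift y P P' T - second_lift y P P' T'.
Proof. by have := second_liftD y P P' (T - T') T'; rewrite subrK => ->; rewrite addrK. Qed.

Lemma second_lift_tens y P P' x x' :
  second_lift y P P' (tens x x') = second_coef y (P x) (P' x').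
Proof.
rewrite /second_lift /tens_lift [in RHS](coord_vbasis (memvf x)).
rewrite /second_coef !linear_sum sum_lfunE; apply: eq_bigr => i _.
by rewrite tensE dual_vbasisE !linearZ scale_lfunE.
Qed.

Lemma second_lift_C2 : exists2 C : R, 0 <= C &
  forall P P' T, bounded_C2 (C * (`|P| * `|P'| * `|T|)) (fun y => second_lift y P P' T).
Proof.
have [C C0 qC] := second_coef_C2.
exists (\sum_(i < \dim {:V}) C * (`|(vbasis {:V})`_i| * `|@dual_vbasis R V i|)).
  by apply: sumr_ge0 => i _; rewrite !mulr_ge0.
move=> P P' T; rewrite mulr_suml; apply: bounded_C2_sum => i.
apply: bounded_C2_le (qC _ _).
rewrite -mulrA ler_wpM2l// (le_trans (ler_pM _ _ (lfun_norm_le _ _) (lfun_norm_le _ _)))//.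
rewrite (@le_trans _ _ (`|P| * `|(vbasis {:V})`_i| * (`|P'| * (`|T| * `|@dual_vbasis R V i|))))//.
  by rewrite ler_wpM2l ?mulr_ge0// ler_wpM2l// lfun_norm_le.
by rewrite le_eqVlt; apply/orP; left; apply/eqP; ring.
Qed.

(** When the displacement v depends on y as well, varying y moves both the base
    point and the displacement of the Taylor remainder. *)
Lemma taylor1_coef : exists2 C : R, 0 <= C & forall (v : W -> W) (m : R) z,
  bounded_lipschitz m v ->
  bounded_lipschitz (C * (m ^+ 2 * `|z|)) (fun y => taylor1 F y (v y) z).
Proof.
have [C C0 TC] := taylor1_lip (Cb_pred hF).
have [D D0 TD] := taylor1_base hF.
exists (2 * C + D) => [|v m z [v1 v2]]; first by rewrite addr_ge0 ?mulr_ge0.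
have m0 : 0 <= m by exact: le_trans (v1 0).
have m20 : 0 <= m ^+ 2 by rewrite exprn_ge0.
have T0 y : taylor1 F y 0 = 0 by rewrite /taylor1 addr0 linear0 subrr subr0.
split => [y|y y'].
  rewrite mulrA (le_trans (lfun_norm_le _ _))// ler_wpM2r//.
  have := TC y (v y) 0; rewrite T0 !subr0 normr0 addr0 => H; rewrite (le_trans H)//.
  have : `|v y| * `|v y| <= m ^+ 2 by rewrite expr2 ler_pM.
  move=> /(ler_wpM2l C0).
  have : 0 <= C * m ^+ 2 by rewrite mulr_ge0.
  have : 0 <= D * m ^+ 2 by rewrite mulr_ge0.
  lra.
rewrite -sub_lfunE (le_trans (lfun_norm_le _ _))//.
rewrite (_ : _ * `|y - y'| = (2 * C + D) * (m ^+ 2 * `|y - y'|) * `|z|); last by ring.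
rewrite ler_wpM2r//.
rewrite (_ : _ - _ = (taylor1 F y (v y) - taylor1 F y (v y')) +
  (taylor1 F y (v y') - taylor1 F y' (v y'))); last by zmod.
rewrite mulrDl; apply: normD_le.
  rewrite (le_trans (TC _ _ _))//.
  rewrite (@le_trans _ _ (C * ((m + m) * (m * `|y - y'|))))//.
    by rewrite ler_wpM2l// ler_pM// ?addr_ge0// lerD.
  by rewrite le_eqVlt; apply/orP; left; apply/eqP; ring.
rewrite (le_trans (TD _ _ _))// ler_wpM2l// ler_wpM2r//.
by rewrite !expr2 ler_pM.
Qed.

End second_level.

Section tensor_norm.
Context {R : realType} {V : normedVectType R}.

Lemma tens_norm (v w : V) : `|tens v w| <= `|v| * `|w|.
Proof.
apply: opnorm_le => [|l]; first by rewrite mulr_ge0.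
rewrite tensE normrZ (_ : `|v| * `|w| * `|l| = `|l| * `|v| * `|w|); last by ring.
by rewrite ler_wpM2r// lfun_norm_le.
Qed.

Lemma tensDl (v v' w : V) : tens (v + v') w = tens v w + tens v' w.
Proof. by apply/lfunP => l; rewrite add_lfunE !tensE linearD scalerDl. Qed.

Lemma tensNr (v w : V) : tens v (- w) = - tens v w.
Proof. by apply/lfunP => l; rewrite opp_lfunE !tensE scalerN. Qed.

Lemma tensDr (v w w' : V) : tens v (w + w') = tens v w + tens v w'.
Proof. by apply/lfunP => l; rewrite add_lfunE !tensE scalerDr. Qed.

End tensor_norm.

Section two_sided_rough_path.
Context {R : realType} {V : normedVectType R}.
Variables (X : R -> V) (XX : R -> R -> tensor2 V).

(** For t < s, Chen's relation over s, t, s together with XX s s = 0 leaves no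
    other choice. *)
Definition ext_area (s t : R) : tensor2 V :=
  if s <= t then XX s t else tens (increment X t s) (increment X t s) - XX t s.

Hypothesis chen : forall s u t, s <= u -> u <= t ->
  XX s t = XX s u + XX u t + tens (increment X s u) (increment X u t).

(** With all areas expressed from a common earlier time b, Chen's relation for
    times in any order becomes an algebraic identity. *)
Lemma ext_area_base b s t : b <= s -> b <= t ->
  ext_area s t = XX b t - XX b s - tens (increment X b s) (increment X s t).
Proof.
move=> bs bt; rewrite /ext_area; case: ifPn => [st|].
  by rewrite (chen bs st); zmod.
rewrite -ltNge => /ltW ts; rewrite (chen bt ts).
rewrite (_ : increment X b s = increment X b t + increment X t s); last first.
  by rewrite /increment; zmod.
rewrite (_ : increment X s t = - increment X t s); last by rewrite /increment; zmod.
by rewrite tensNr tensDl; zmod.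
Qed.

Lemma ext_area_chen s u t :
  ext_area s t = ext_area s u + ext_area u t + tens (increment X s u) (increment X u t).
Proof.
pose b := Num.min s (Num.min u t).
have [bs bu bt] : [/\ b <= s, b <= u & b <= t].
  by rewrite /b !ge_min !lexx !orbT.
rewrite !(@ext_area_base b)//.
rewrite (_ : increment X b u = increment X b s + increment X s u); last first.
  by rewrite /increment; zmod.
rewrite (_ : increment X s t = increment X s u + increment X u t); last first.
  by rewrite /increment; zmod.
by rewrite tensDl tensDr; zmod.
Qed.

End two_sided_rough_path.

(** * The germ of the equation *)

Section driver.
Context {R : realType} {U V W : normedVectType R}.
Variables (alpha : R) (X : R -> V) (XX : R -> R -> tensor2 V).
Variables (Z : R -> U) (Z' : R -> 'Hom(V, U)) (F : W -> 'Hom(U, W)).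

Local Notation area := (ext_area X XX).

(** Two-sided versions of the Hölder bounds.  Orders are written as powers of
    |t - s|^alpha, so that products of bounds are monomials; the weaker bounds
    on the path and the area serve where a factor is only required to be bounded
    or of order alpha. *)
Record driver_bound (T D : R) : Prop := DriverBound {
  driver_ge0 : 0 <= D ;
  driver_path : forall s t : R, `|s| <= T -> `|t| <= T ->
    `|increment X s t| <= D * `|t - s| `^ alpha /\ `|increment X s t| <= D ;
  driver_area : forall s t : R, `|s| <= T -> `|t| <= T ->
    `|area s t| <= D * (`|t - s| `^ alpha) ^+ 2 /\
    `|area s t| <= D * `|t - s| `^ alpha /\ `|area s t| <= D ;
  driver_Z : forall s t : R, `|s| <= T -> `|t| <= T ->
    `|increment Z s t| <= D * `|t - s| `^ alpha ;
  driver_Z' : forall s : R, `|s| <= T -> `|Z' s| <= D ;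
  driver_Z'_incr : forall s t : R, `|s| <= T -> `|t| <= T ->
    `|Z' t - Z' s| <= D * `|t - s| `^ alpha ;
  driver_rem : forall s t : R, `|s| <= T -> `|t| <= T ->
    `|remainder X Z Z' s t| <= D * (`|t - s| `^ alpha) ^+ 2 }.

Definition rde_germ (s t : R) (y : W) : W :=
  F y (increment Z s t) + second_lift F y (Z' s) (Z' s) (area s t).

Hypothesis halpha : 3^-1 < alpha <= 2^-1.
Hypothesis hX : rough_path alpha X XX.
Hypothesis hZ : controlled alpha X Z Z'.
Hypothesis hF : Cb 3 F.

Let al0 : 0 < alpha.
Proof. by case/andP: halpha => + _; apply: lt_trans; rewrite invr_gt0. Qed.

Let chen s u t : area s t = area s u + area u t + tens (increment X s u) (increment X u t).
Proof. by case: hX => _ _ c; exact: ext_area_chen. Qed.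

Lemma loc_holder_pos {E : normedVectType R} (b : R) (A : R -> R -> E) (T : R) : loc_holder b A ->
  exists2 C : R, 0 <= C & forall s t : R, - T <= s -> s < t -> t <= T ->
    `|A s t| <= C * (t - s) `^ b.
Proof.
move=> /(_ (- T) T)[C CP]; exists `|C| => // s t Ts st tT.
by rewrite (le_trans (CP _ _ Ts st tT))// ler_wpM2r ?powR_ge0// ler_norm.
Qed.

Lemma holder_sym {E : normedVectType R} (b C T : R) (A : R -> R -> E) : 0 <= C ->
  (forall s, A s s = 0) -> (forall s t, `|A t s| = `|A s t|) ->
  (forall s t : R, - T <= s -> s < t -> t <= T -> `|A s t| <= C * (t - s) `^ b) ->
  forall s t : R, `|s| <= T -> `|t| <= T -> `|A s t| <= C * `|t - s| `^ b.
Proof.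
move=> C0 A0 Asym AC s t; rewrite !ler_norml => /andP[s1 s2] /andP[t1 t2].
case: (ltgtP s t) => [st|ts|<-].
- by rewrite gtr0_norm ?subr_gt0// AC.
- by rewrite distrC gtr0_norm ?subr_gt0// Asym AC.
- by rewrite A0 normr0 mulr_ge0// powR_ge0.
Qed.

Lemma increment_sym {E : normedVectType R} (Y : R -> E) s t : `|increment Y t s| = `|increment Y s t|.
Proof. by rewrite /increment distrC. Qed.

Lemma powR_double (x : R) : 0 <= x -> x `^ (2 * alpha) = (x `^ alpha) ^+ 2.
Proof. by move=> x0; rewrite mulrC powRrM powR_mulrn ?powR_ge0. Qed.

Lemma powR_triple (x : R) : 0 <= x -> x `^ (3 * alpha) = (x `^ alpha) ^+ 3.
Proof. by move=> x0; rewrite mulrC powRrM powR_mulrn ?powR_ge0. Qed.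

Lemma driver_bounds T : exists D, driver_bound T D.
Proof.
have [T0|T0] := ltP T 0.
  exists 0; split => // *; exfalso;
  match goal with H : is_true (`|_| <= T) |- _ =>
    by move: (le_trans (normr_ge0 _) H); rewrite leNgt T0 end.
case: hX => hX1 hX2 _; case: hZ => hZ1 hZ2.
have [c1 c10 X1] := loc_holder_pos T hX1.
have [c2 c20 X2] := loc_holder_pos T hX2.
have [c3 c30 Z1] := loc_holder_pos T hZ1.
have [c4 c40 Z2] := loc_holder_pos T hZ2.
have {}X1 := holder_sym c10 (fun s => subrr _) (increment_sym X) X1.
have {}Z1 := holder_sym c30 (fun s => subrr _) (increment_sym Z') Z1.
pose B := (2 * T) `^ alpha.
have B0 : 0 <= B by exact: powR_ge0.
have Bst (s t : R) : `|s| <= T -> `|t| <= T -> `|t - s| `^ alpha <= B.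
  move=> sT tT; apply: le_powR => //; first exact: ltW.
  by rewrite (le_trans (normB_le tT sT))//; lra.
pose p (s t : R) := `|t - s| `^ alpha.
have p0 (s t : R) : 0 <= p s t by exact: powR_ge0.
have {}X2 (s t : R) : `|s| <= T -> `|t| <= T -> `|area s t| <= (c1 ^+ 2 + c2) * p s t ^+ 2.
  move=> sT tT; have := sT; have := tT; rewrite !ler_norml => /andP[t1 t2] /andP[s1 s2].
  have le2 (s' t' : R) : - T <= s' -> s' <= t' -> t' <= T -> `|XX s' t'| <= c2 * p s' t' ^+ 2.
    move=> s1' st' t2'; have [->|n] := eqVneq s' t'.
      case: hX => _ _ /(_ t' t' t' (lexx _) (lexx _)).
      rewrite /increment subrr => /eqP; rewrite -addrA -subr_eq0 opprD addrA subrr sub0r.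
      rewrite oppr_eq0 => /eqP e.
      have -> : XX t' t' = - tens (0 : V) 0.
        by apply/eqP; rewrite -subr_eq0 opprK e.
      rewrite normrN (le_trans (tens_norm _ _))// normr0 mul0r mulr_ge0// exprn_ge0//.
    rewrite -powR_double// ger0_norm ?subr_ge0//; apply: X2 => //.
    by rewrite lt_def eq_sym n.
  rewrite /ext_area; case: ifPn => [st|].
    by rewrite (le_trans (le2 _ _ _ _ _))// ler_wpM2r ?exprn_ge0// lerDr exprn_ge0.
  rewrite -ltNge => /ltW ts; rewrite mulrDl; apply: normB_le.
    have h := X1 _ _ tT sT; rewrite [`|s - t|]distrC -/(p s t) in h.
    rewrite (le_trans (tens_norm _ _))// -exprMn expr2.
    by apply: ler_pM.
  by have := le2 _ _ t1 ts s2; rewrite /p [`|s - t|]distrC.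
have rem (s t : R) : `|s| <= T -> `|t| <= T -> `|remainder X Z Z' s t| <= (c4 + c3 * c1) * p s t ^+ 2.
  move=> sT tT; have := sT; have := tT; rewrite !ler_norml => /andP[t1 t2] /andP[s1 s2].
  have lt2 (s' t' : R) : - T <= s' -> s' < t' -> t' <= T -> `|remainder X Z Z' s' t'| <= c4 * p s' t' ^+ 2.
    by move=> s1' st' t2'; rewrite -powR_double// ger0_norm ?subr_ge0 ?(ltW st')//; exact: Z2.
  have c0 : 0 <= c3 * c1 * p s t ^+ 2 by rewrite mulr_ge0 ?exprn_ge0// mulr_ge0.
  have c0' : 0 <= c4 * p s t ^+ 2 by rewrite mulr_ge0 ?exprn_ge0.
  case: (ltgtP s t) => [st|ts|<-].
  - by rewrite mulrDl (le_trans (lt2 _ _ _ _ _))// lerDl.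
  - rewrite (_ : remainder X Z Z' s t = - remainder X Z Z' t s
      + (increment Z' s t) (increment X s t)); last first.
      rewrite /remainder (_ : increment X t s = - increment X s t); last first.
        by rewrite /increment; zmod.
      by rewrite linearN /= /increment sub_lfunE; zmod.
    rewrite mulrDl; apply: normD_le.
      by rewrite normrN; have := lt2 _ _ t1 ts s2; rewrite /p [`|s - t|]distrC.
    rewrite (le_trans (lfun_norm_le _ _))//.
    rewrite (_ : c3 * c1 * _ = (c3 * p s t) * (c1 * p s t)); last by ring.
    by apply: ler_pM => //; [exact: Z1|exact: X1].
  - rewrite /remainder /increment !subrr linear0 subrr normr0 mulr_ge0 ?exprn_ge0//.
    by rewrite addr_ge0// mulr_ge0.
have Z'b (s : R) : `|s| <= T -> `|Z' s| <= c3 * B + `|Z' 0|.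
  move=> sT; rewrite -[Z' s](subrK (Z' 0)); apply: normD_le => //.
  have T00 : `|0 : R| <= T by rewrite normr0.
  by rewrite (le_trans (Z1 _ _ T00 sT))// ler_wpM2l// Bst.
pose D := c1 + c1 * B + (c1 ^+ 2 + c2) + (c1 ^+ 2 + c2) * B + (c1 ^+ 2 + c2) * B ^+ 2 +
   c3 + (c4 + c3 * c1) + (c4 + c3 * c1) * B + (c3 * B + `|Z' 0|) * c1 + (c3 * B + `|Z' 0|).
have n1 : 0 <= c1 * B by rewrite mulr_ge0.
have n2 : 0 <= c1 ^+ 2 + c2 by rewrite addr_ge0 ?exprn_ge0.
have n3 : 0 <= (c1 ^+ 2 + c2) * B by rewrite mulr_ge0.
have n4 : 0 <= (c1 ^+ 2 + c2) * B ^+ 2 by rewrite mulr_ge0 ?exprn_ge0.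
have n5 : 0 <= c4 + c3 * c1 by rewrite addr_ge0 ?mulr_ge0.
have n6 : 0 <= (c4 + c3 * c1) * B by rewrite mulr_ge0.
have n7 : 0 <= c3 * B + `|Z' 0| by rewrite addr_ge0 ?mulr_ge0.
have n8 : 0 <= (c3 * B + `|Z' 0|) * c1 by rewrite mulr_ge0.
have D0 : 0 <= D by rewrite /D; lra.
exists D; split => //.
- move=> s t sT tT; have := X1 _ _ sT tT; rewrite -/(p s t) => h; split.
    by rewrite (le_trans h)// ler_wpM2r// /D; lra.
  rewrite (le_trans h)// (@le_trans _ _ (c1 * B))//; first by rewrite ler_wpM2l// Bst.
  by rewrite /D; lra.
- move=> s t sT tT; have h := X2 _ _ sT tT; rewrite -/(p s t).
  have pB : p s t <= B by exact: Bst.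
  have p2B : p s t ^+ 2 <= p s t * B by rewrite expr2 ler_wpM2l.
  have p2B2 : p s t ^+ 2 <= B ^+ 2 by rewrite ler_pXn2r ?nnegrE.
  split; [|split].
  + by rewrite (le_trans h)// ler_wpM2r ?exprn_ge0// /D; lra.
  + rewrite (le_trans h)// (@le_trans _ _ ((c1 ^+ 2 + c2) * (p s t * B)))//.
      by rewrite ler_wpM2l.
    by rewrite mulrCA mulrC ler_wpM2r// /D; lra.
  + rewrite (le_trans h)// (@le_trans _ _ ((c1 ^+ 2 + c2) * B ^+ 2))//.
      by rewrite ler_wpM2l.
    by rewrite /D; lra.
- move=> s t sT tT; rewrite -/(p s t).
  rewrite (_ : increment Z s t = remainder X Z Z' s t + Z' s (increment X s t)); last first.
    by rewrite /remainder subrK.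
  have h1 := rem _ _ sT tT; have h2 := X1 _ _ sT tT; rewrite -/(p s t) in h2.
  have pB : p s t <= B by exact: Bst.
  have e1 : `|remainder X Z Z' s t| <= (c4 + c3 * c1) * B * p s t.
    by rewrite (le_trans h1)// -mulrA expr2 ler_wpM2l// ler_wpM2r.
  have e2 : `|Z' s (increment X s t)| <= (c3 * B + `|Z' 0|) * c1 * p s t.
    by rewrite (le_trans (lfun_norm_le _ _))// -mulrA; apply: ler_pM => //; exact: Z'b.
  rewrite (le_trans (normD_le e1 e2))// -mulrDl ler_wpM2r// /D; lra.
- by move=> s sT; rewrite (le_trans (Z'b _ sT))// /D; lra.
- move=> s t sT tT; have := Z1 _ _ sT tT; rewrite -/(p s t) => h.
  by rewrite (le_trans h)// ler_wpM2r// /D; lra.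
- move=> s t sT tT; rewrite (le_trans (rem _ _ sT tT))// -/(p s t).
  by rewrite ler_wpM2r ?exprn_ge0// /D; lra.
Qed.

Lemma rde_germ_C2 (T : R) : exists2 C : R, 0 <= C & forall s t : R, `|s| <= T -> `|t| <= T ->
  bounded_C2 (C * `|t - s| `^ alpha) (rde_germ s t).
Proof.
have [D dD] := driver_bounds T; have D0 := driver_ge0 dD.
have [C1 C10 FC] := first_coef_C2 hF.
have [C2 C20 LC] := @second_lift_C2 R U V W F hF.
exists (C1 * D + C2 * (D * D * D)) => [|s t sT tT]; first by rewrite addr_ge0 ?mulr_ge0.
set p := `|t - s| `^ alpha; have p0 : 0 <= p by exact: powR_ge0.
rewrite mulrDl; apply: bounded_C2D.
  by apply: bounded_C2_le (FC _); rewrite -mulrA ler_wpM2l//; exact: (driver_Z dD).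
apply: bounded_C2_le (LC _ _ _); rewrite -[leRHS]mulrA ler_wpM2l// -[leRHS]mulrA.
have [_ [Xp _]] := driver_area dD sT tT.
by apply: ler_pM; rewrite ?mulr_ge0// ?ler_pM//; exact: (driver_Z' dD sT).
Qed.

(** Chen's relation for the area and Z_{s,u} = Z'_s X_{s,u} + R_{s,u} cancel
    everything of order below 3 alpha: in each term left, the orders of the
    factors (alpha for increments, 2 alpha for areas and remainders, 2 alpha for
    a Taylor remainder) add up to 3 alpha at least. *)
Lemma rde_germ_defectE s u t y (v := rde_germ s u y) :
  chen_defect rde_germ s u t y =
  - taylor1 F y v (increment Z u t)
  - fderive F y (second_lift F y (Z' s) (Z' s) (area s u)) (increment Z u t)
  - second_coef F y (remainder X Z Z' s u) (increment Z u t)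
  - second_coef F y (Z' s (increment X s u))
      ((Z' u - Z' s) (increment X u t) + remainder X Z Z' u t)
  - (second_lift F y (Z' u - Z' s) (Z' s) (area u t)
     + second_lift F y (Z' u) (Z' u - Z' s) (area u t))
  - (second_lift F (y + v) (Z' u) (Z' u) (area u t)
     - second_lift F y (Z' u) (Z' u) (area u t)).
Proof.
have -> : chen_defect rde_germ s u t y = rde_germ s t y - v - rde_germ u t (y + v) by [].
have vE : v = F y (increment Z s u) + second_lift F y (Z' s) (Z' s) (area s u) by [].
clearbody v.
have Dv : fderive F y v (increment Z u t) = second_coef F y (increment Z s u) (increment Z u t)
    + fderive F y (second_lift F y (Z' s) (Z' s) (area s u)) (increment Z u t).
  by rewrite vE lfunD add_lfunE.
rewrite (_ : _ - v - _ = rde_germ s t y - (F y (increment Z s u) +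
  second_lift F y (Z' s) (Z' s) (area s u)) - rde_germ u t (y + v)); last by rewrite -vE.
rewrite /rde_germ (chen s u t) !second_liftD second_lift_tens.
rewrite (_ : increment Z s t = increment Z s u + increment Z u t); last first.
  by rewrite /increment; zmod.
rewrite lfunD !second_liftBl !second_liftBr.
rewrite (_ : (Z' u - Z' s) (increment X u t) + remainder X Z Z' u t =
   increment Z u t - Z' s (increment X u t)); last first.
  by rewrite /remainder sub_lfunE; zmod.
rewrite (_ : remainder X Z Z' s u = increment Z s u - Z' s (increment X s u))//.
rewrite second_coefBl (second_coefBr F y (increment Z u t)) /taylor1 !sub_lfunE Dv.
zmod.
Qed.

(** The defect is estimated term by term along [rde_germ_defectE], as a bounded
    Lipschitz function of y: K1, ..., K6 are the constants of the six terms. *)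
Lemma rde_germ_rough : rough_germ alpha rde_germ.
Proof.
move=> T; have [D dD] := driver_bounds T; have D0 := driver_ge0 dD.
have [C3 C30 AC] := rde_germ_C2 T.
have [C1 C10 FC] := first_coef_C2 hF.
have [C2 C20 QC] := second_coef_C2 hF.
have [C4 C40 LC] := @second_lift_C2 R U V W F hF.
have [C5 C50 TC] := taylor1_coef hF.
have [C6 DF6] : exists C, bounded_C2 C (fderive F).
  by apply: Cb2_bounded_C2; case: hF => _ [].
have C60 := bounded_C2_ge0 DF6.
have defect : exists2 C : R, 0 <= C & forall h s u t : R,
    `|s| <= T -> `|u| <= T -> `|t| <= T -> `|u - s| <= h -> `|t - u| <= h ->
    bounded_lipschitz (C * h `^ (3 * alpha)) (chen_defect rde_germ s u t).
  pose K1 := C5 * (C3 ^+ 2 * D).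
  pose K2 := 4 * (C6 * (C4 * (D * D * D))) * D.
  pose K3 := C2 * (D * D).
  pose K4 := C2 * (D * D * (D * D + D)).
  pose K5 := C4 * (D * D * D) + C4 * (D * D * D).
  pose K6 := 2 * (C4 * (D * D * D) * C3).
  exists (K1 + K2 + K3 + K4 + K5 + K6).
    by rewrite /K1 /K2 /K3 /K4 /K5 /K6 !addr_ge0// ?mulr_ge0 ?addr_ge0 ?mulr_ge0// exprn_ge0.
  move=> h s u t sT uT tT us tu.
  have h0 : 0 <= h by exact: le_trans us.
  rewrite powR_triple//; set b := h `^ alpha.
  have b0 : 0 <= b by exact: powR_ge0.
  have pb (x : R) : `|x| <= h -> `|x| `^ alpha <= b.
    by move=> xh; apply: le_powR => //; exact: ltW.
  have p2b (x : R) : `|x| <= h -> (`|x| `^ alpha) ^+ 2 <= b ^+ 2.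
    by move=> /pb xb; rewrite ler_pXn2r ?nnegrE ?powR_ge0.
  have Xsu : `|increment X s u| <= D * b.
    by have [h1 _] := driver_path dD sT uT; rewrite (le_trans h1)// ler_wpM2l// pb.
  have Xut : `|increment X u t| <= D * b.
    by have [h1 _] := driver_path dD uT tT; rewrite (le_trans h1)// ler_wpM2l// pb.
  have XXsu : `|area s u| <= D * b ^+ 2.
    by have [h1 _] := driver_area dD sT uT; rewrite (le_trans h1)// ler_wpM2l// p2b.
  have XXut : `|area u t| <= D * b ^+ 2.
    by have [h1 _] := driver_area dD uT tT; rewrite (le_trans h1)// ler_wpM2l// p2b.
  have Zut : `|increment Z u t| <= D * b.
    by rewrite (le_trans (driver_Z dD uT tT))// ler_wpM2l// pb.
  have Rsu : `|remainder X Z Z' s u| <= D * b ^+ 2.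
    by rewrite (le_trans (driver_rem dD sT uT))// ler_wpM2l// p2b.
  have Rut : `|remainder X Z Z' u t| <= D * b ^+ 2.
    by rewrite (le_trans (driver_rem dD uT tT))// ler_wpM2l// p2b.
  have Ps := driver_Z' dD sT; have Pu := driver_Z' dD uT.
  have dP : `|Z' u - Z' s| <= D * b.
    by rewrite (le_trans (driver_Z'_incr dD sT uT))// ler_wpM2l// pb.
  have vbl : bounded_lipschitz (C3 * b) (rde_germ s u).
    case: (AC s u sT uT) => a1 a2 _; apply: (@bounded_lipschitz_le _ _ (C3 * `|u - s| `^ alpha)).
      by rewrite ler_wpM2l// pb.
    by split.
  have C2bl (c d : R) (f : W -> W) : c <= d -> bounded_C2 c f -> bounded_lipschitz d f.
    by move=> cd [f1 f2 _]; apply: (bounded_lipschitz_le cd); split.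
  apply: (bounded_lipschitz_ext (rde_germ_defectE s u t)).
  have -> : (K1 + K2 + K3 + K4 + K5 + K6) * b ^+ 3 = K1 * b ^+ 3 + K2 * b ^+ 3 +
    K3 * b ^+ 3 + K4 * b ^+ 3 + K5 * b ^+ 3 + K6 * b ^+ 3 by ring.
  apply: bounded_lipschitzB; last first.
    apply: bounded_lipschitz_le (bounded_C2_shift (LC _ _ _) vbl).
    rewrite (_ : K6 * b ^+ 3 = 2 * (C4 * (D * D * (D * b ^+ 2)) * (C3 * b))); last first.
      by rewrite /K6; ring.
    rewrite ler_wpM2l// ler_wpM2r ?mulr_ge0// ler_wpM2l//.
    by apply: ler_pM; rewrite ?mulr_ge0// ler_pM.
  apply: bounded_lipschitzB; last first.
    rewrite mulrDl; apply: bounded_lipschitzD; apply: C2bl (LC _ _ _);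
    rewrite (_ : C4 * _ * _ = C4 * (D * b * D * (D * b ^+ 2))) ?ler_wpM2l//; try ring.
    - by apply: ler_pM; rewrite ?mulr_ge0// ler_pM.
    - by apply: ler_pM; rewrite ?mulr_ge0// mulrC ler_pM.
  apply: bounded_lipschitzB; last first.
    apply: C2bl (QC _ _).
    rewrite (_ : K4 * b ^+ 3 = C2 * (D * (D * b) * (D * b * (D * b) + D * b ^+ 2))); last first.
      by rewrite /K4; ring.
    rewrite ler_wpM2l//; apply: ler_pM => //.
      by rewrite (le_trans (lfun_norm_le _ _))// ler_pM.
    by apply: normD_le => //; rewrite (le_trans (lfun_norm_le _ _))// ler_pM.
  apply: bounded_lipschitzB; last first.
    apply: C2bl (QC _ _).
    rewrite (_ : K3 * b ^+ 3 = C2 * (D * b ^+ 2 * (D * b))); last by rewrite /K3; ring.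
    by rewrite ler_wpM2l// ler_pM.
  apply: bounded_lipschitzB; last first.
    apply: C2bl (bounded_C2_eval _ (bounded_C2_app DF6 (LC _ _ _))).
    rewrite (_ : K2 * b ^+ 3 = 4 * (C6 * (C4 * (D * D * (D * b ^+ 2)))) * (D * b)); last first.
      by rewrite /K2; ring.
    apply: ler_pM => //; first by rewrite !mulr_ge0.
    do 3!rewrite ler_wpM2l//.
    by apply: ler_pM; rewrite ?mulr_ge0// ler_pM.
  apply: bounded_lipschitz_opp; apply: bounded_lipschitz_le (TC _ _ _ vbl).
  rewrite (_ : K1 * b ^+ 3 = C5 * ((C3 * b) ^+ 2 * (D * b))); last by rewrite /K1; ring.
  by rewrite ler_wpM2l// ler_wpM2l// exprn_ge0// mulr_ge0.
have time : exists2 C : R, 0 <= C & forall (s t s' t' : R) y,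
    `|s| <= T -> `|t| <= T -> `|s'| <= T -> `|t'| <= T ->
    `|rde_germ s' t' y - rde_germ s t y| <=
      C * (`|s' - s| `^ alpha + `|t' - t| `^ alpha).
  exists (C1 * D + C4 * (D * D * D + D * D * D + D * D * (D + D * D))).
    by rewrite !(addr_ge0, mulr_ge0).
  move=> s t s' t' y sT tT s'T t'T.
  set p := `|s' - s| `^ alpha; set q := `|t' - t| `^ alpha.
  have p0 : 0 <= p by exact: powR_ge0.
  have q0 : 0 <= q by exact: powR_ge0.
  have Lb (P P' : 'Hom(V, U)) (Th : tensor2 V) (a b c : R) : `|P| <= a -> `|P'| <= b -> `|Th| <= c ->
      `|second_lift F y P P' Th| <= C4 * (a * b * c).
    move=> Pa Pb Tc; rewrite (le_trans (bC2_norm (LC _ _ _) y))// ler_wpM2l//.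
    by apply: ler_pM; rewrite ?mulr_ge0// ler_pM.
  have zE : `|increment Z s' t' - increment Z s t| <= D * (p + q).
    rewrite (_ : _ - _ = increment Z t t' - increment Z s s'); last by rewrite /increment; zmod.
    have -> : D * (p + q) = D * q + D * p by ring.
    apply: normB_le; exact: (driver_Z dD).
  have aE : `|area s' t' - area s t| <= (D + D * D) * (p + q).
    rewrite (chen s' s t') (chen s t t').
    rewrite (_ : _ - _ = (area s' s + tens (increment X s' s) (increment X s t')) +
       (area t t' + tens (increment X s t) (increment X t t'))); last by zmod.
    have [_ [h1 _]] := driver_area dD s'T sT; rewrite [`|s - s'|]distrC -/p in h1.
    have [_ [h2 _]] := driver_area dD tT t'T; rewrite -/q in h2.
    have [h3 _] := driver_path dD s'T sT; rewrite [`|s - s'|]distrC -/p in h3.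
    have [h4 _] := driver_path dD tT t'T; rewrite -/q in h4.
    have [_ h5] := driver_path dD sT t'T.
    have [_ h6] := driver_path dD sT tT.
    rewrite mulrDr !mulrDl; apply: normD_le; apply: normD_le => //.
      by rewrite (le_trans (tens_norm _ _))// mulrAC ler_pM.
    by rewrite (le_trans (tens_norm _ _))// -mulrA ler_pM.
  have dP := driver_Z'_incr dD sT s'T; rewrite -/p in dP.
  have Ps := driver_Z' dD sT; have Ps' := driver_Z' dD s'T.
  have [_ [_ a'D]] := driver_area dD s'T t'T.
  rewrite /rde_germ (_ : _ - _ = F y (increment Z s' t' - increment Z s t) +
    (second_lift F y (Z' s' - Z' s) (Z' s') (area s' t')
     + second_lift F y (Z' s) (Z' s' - Z' s) (area s' t')
     + second_lift F y (Z' s) (Z' s) (area s' t' - area s t))); last first.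
    by rewrite (lfunB _ (increment Z s' t')) second_liftBl second_liftBr second_liftB; zmod.
  have e1 : `|F y (increment Z s' t' - increment Z s t)| <= C1 * (D * (p + q)).
    by rewrite (le_trans (bC2_norm (FC _) y))// ler_wpM2l.
  have e2 := Lb _ _ _ _ _ _ dP Ps' a'D.
  have e3 := Lb _ _ _ _ _ _ Ps dP a'D.
  have e4 := Lb _ _ _ _ _ _ Ps Ps aE.
  rewrite (le_trans (normD_le e1 (normD_le (normD_le e2 e3) e4)))//.
  have : 0 <= C4 * (D * D * D) * q by rewrite !mulr_ge0.
  lra.
case: defect => K K0 KP; case: time => K' K'0 K'P.
exists (1 + C3 + K + K'); split.
- by rewrite -!addrA lerDl !addr_ge0.
- move=> s t y sT tT; rewrite (le_trans (bC2_norm (AC _ _ sT tT) y))//.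
  by rewrite ler_wpM2r ?powR_ge0//; lra.
- move=> s t a r b q sT tT; rewrite (le_trans (bounded_C2_perturb _ _ _ _ (AC _ _ sT tT)))//.
  rewrite ler_wpM2r ?addr_ge0 ?mulr_ge0// ler_wpM2r ?powR_ge0//; lra.
- move=> h s u t y sT uT tT us tu; have [k1 _] := KP h s u t sT uT tT us tu.
  by rewrite (le_trans (k1 _))// ler_wpM2r ?powR_ge0//; lra.
- move=> h s u t y z sT uT tT us tu; have [_ k1] := KP h s u t sT uT tT us tu.
  by rewrite (le_trans (k1 _ _))// ler_wpM2r// ler_wpM2r ?powR_ge0//; lra.
- move=> s t s' t' y sT tT s'T t'T; rewrite (le_trans (K'P _ _ _ _ _ sT tT s'T t'T))//.
  by rewrite ler_wpM2r ?addr_ge0 ?powR_ge0//; lra.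
Qed.

End driver.

(** * Integrals over oriented intervals and fine partitions *)

Section orientation.
Context {R : realType} {W : normedVectType R}.

Lemma additive_diag (I : R -> R -> W) :
  (forall s u t, s <= u -> u <= t -> I s t = I s u + I u t) -> I 0 0 = 0.
Proof.
move=> add; have /eqP := add 0 0 0 (lexx _) (lexx _).
by rewrite -subr_eq0 opprD addrA subrr sub0r oppr_eq0 => /eqP.
Qed.

Lemma oriented_sub (I : R -> R -> W) :
  (forall s u t, s <= u -> u <= t -> I s t = I s u + I u t) ->
  forall s t, s <= t -> oriented I 0 t - oriented I 0 s = I s t.
Proof.
move=> add s t st; rewrite /oriented.
have I0 := additive_diag add.
have [t0|t0] := leP 0 t; have [s0|s0] := leP 0 s.
- by rewrite (add 0 s t)//; zmod.
- by rewrite (add s 0 t) ?(ltW s0)//; zmod.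
- by have := le_lt_trans (le_trans s0 st) t0; rewrite ltxx.
- by rewrite (add s t 0) ?(ltW t0)//; zmod.
Qed.

(** The sign convention for reversed limits agrees with that of increments. *)
Lemma oriented_path (I : R -> R -> W) (f : R -> W) :
  (forall s t, s <= t -> I s t = f t - f s) -> forall t, oriented I 0 t = f t - f 0.
Proof.
move=> If t; rewrite /oriented; case: ifPn => [|]; first exact: If.
by rewrite -ltNge => /ltW t0; rewrite If// opprB.
Qed.

End orientation.

Section time_integral_facts.
Context {R : realType}.
Let mu := @lebesgue_measure R.

Lemma continuous_integrable_itv (f : R -> R) (s t : R) : continuous f ->
  mu.-integrable `[s, t] (EFin \o f).
Proof.
move=> cf; apply: continuous_compact_integrable; first exact: segment_compact.
exact: continuous_subspaceT.
Qed.

Lemma Rintegral_itv_add (f : R -> R) (s u t : R) : continuous f -> s <= u -> u <= t ->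
  Rintegral mu `[s, t] f = Rintegral mu `[s, u] f + Rintegral mu `[u, t] f.
Proof.
move=> cf su ut; have int := continuous_integrable_itv s t cf.
have := Rintegral_itvB int; rewrite -/mu => /(_ u).
rewrite !bnd_simp su ut => /(_ isT isT) H.
apply/eqP; rewrite addrC -subr_eq; apply/eqP; rewrite H.
apply: Rintegral_itv_obnd_cbnd.
apply: (@integrableS _ _ _ mu `[u, t]) => //; last exact: continuous_integrable_itv.
by apply: subset_itvr; rewrite bnd_simp.
Qed.

Lemma Rintegral_itv_close (f : R -> R) (s t c m : R) : continuous f -> s <= t ->
  (forall r, s <= r <= t -> `|f r - c| <= m) ->
  `|Rintegral mu `[s, t] f - (t - s) * c| <= (t - s) * m.
Proof.
move=> cf st fm.
have len : fine (mu `[s, t]%classic) = t - s.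
  rewrite /mu lebesgue_measure_itv /= lte_fin; case: ifPn => //.
  rewrite -leNgt => ts; have -> : s = t by apply/eqP; rewrite eq_le st ts.
  by rewrite subrr.
have cst (a : R) : Rintegral mu `[s, t] (fun=> a) = (t - s) * a.
  by rewrite Rintegral_cst// len mulrC.
have ccst (a : R) : continuous (fun _ : R => a) by move=> x; exact: cvg_cst.
rewrite -cst -RintegralB//; [|exact: continuous_integrable_itv..].
have cB : continuous (fun x => f x - c).
  by move=> x; apply: cvgB; [exact: cf|exact: cvg_cst].
rewrite (le_trans (le_normr_Rintegral _ _))//; first exact: continuous_integrable_itv.
rewrite -cst; apply: le_Rintegral => //.
- apply: continuous_integrable_itv => x; apply: (@cvg_norm _ _ _ (nbhs x)); exact: cB.
- exact: continuous_integrable_itv.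
Qed.

End time_integral_facts.

Section time_integral_vector.
Context {R : realType} {W : normedVectType R}.
Implicit Types (g : R -> W).

Definition itv_integral g (s t : R) : W :=
  \sum_(i < \dim {:W}) Rintegral (@lebesgue_measure R) `[s, t] (fun r => crd i (g r))
     *: (vbasis {:W})`_i.

Lemma time_integralE g : time_integral g = oriented (itv_integral g).
Proof. by []. Qed.

Let crd_path_continuous g i : continuous g -> continuous (fun r => crd i (g r) : R).
Proof. by move=> cg x; apply: (cvg_comp _ _ (cg x)); exact: crd_continuous. Qed.

Lemma itv_integral_add g s u t : continuous g -> s <= u -> u <= t ->
  itv_integral g s t = itv_integral g s u + itv_integral g u t.
Proof.
move=> cg su ut; rewrite /itv_integral -big_split; apply: eq_bigr => i _ /=.
by rewrite (Rintegral_itv_add (@crd_path_continuous g i cg) su ut) scalerDl.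
Qed.

Lemma itv_integral_close : exists2 K : R, 0 <= K & forall g (s t m : R) c,
  continuous g -> s <= t -> 0 <= m -> (forall r, s <= r <= t -> `|g r - c| <= m) ->
  `|itv_integral g s t - (t - s) *: c| <= K * ((t - s) * m).
Proof.
have [k k0 kE] := @crd_le R W; have [k' k'0 k'E] := @norm_le_crd R W.
exists (k' * k); first by rewrite mulr_ge0// ltW.
move=> g s t m c cg st m0 gm.
have ts0 : 0 <= t - s by rewrite subr_ge0.
rewrite -mulrA; apply: k'E => [|i]; first by rewrite mulr_ge0 ?(ltW k0)// mulr_ge0.
rewrite crdB (_ : crd i (itv_integral g s t) =
    Rintegral (@lebesgue_measure R) `[s, t] (fun r => crd i (g r))); last first.
  rewrite /crd /itv_integral coord_sum_free//; exact: basis_free (vbasisP {:W}).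
rewrite (_ : crd i ((t - s) *: c) = (t - s) * crd i c); last by rewrite /crd linearZ.
rewrite mulrCA; apply: Rintegral_itv_close => //; first exact: crd_path_continuous.
by move=> r rst; rewrite -crdB (le_trans (kE _ _))// ler_wpM2l ?(ltW k0)// gm.
Qed.

End time_integral_vector.

Section partitions.
Context {R : realType}.
Implicit Types (s t : R) (p : seq R).

Lemma mesh_cons s x p : mesh s (x :: p) = Num.max (x - s) (mesh x p).
Proof. by rewrite /mesh big_ord_recl. Qed.

Lemma mesh_nil s : mesh s [::] = 0.
Proof. by rewrite /mesh big_ord0. Qed.

Lemma partition_sum_cons {W : normedVectType R} (A : R -> R -> W) s x p :
  partition_sum A s (x :: p) = A s x + partition_sum A x p.
Proof. by rewrite /partition_sum big_ord_recl. Qed.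

Lemma fine_partition s t e : 0 < e -> s <= t ->
  exists p, itv_partition s t p /\ mesh s p <= e.
Proof.
move=> e0 st.
have [n tsn] : exists n : nat, t - s <= n%:R * e.
  exists (Num.bound ((t - s) / e)); rewrite -ler_pdivrMr// ltW// archi_boundP//.
  by rewrite divr_ge0 ?subr_ge0// ltW.
elim: n s st tsn => [|n IH] s st tsn.
  have -> : s = t by apply/eqP; rewrite eq_le st -subr_le0 -(mul0r e).
  by exists [::]; rewrite mesh_nil ltW//; split => //; split.
have [->|snt] := eqVneq s t.
  by exists [::]; rewrite mesh_nil ltW//; split => //; split.
have lt_st : s < t by rewrite lt_def eq_sym snt.
have [tse|tse] := leP (t - s) e.
  exists [:: t]; split; first exact: itv_partition1.
  by rewrite mesh_cons mesh_nil ge_max tse ltW.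
have [||p [[pp pl] pm]] := IH (s + e).
- by rewrite -lerBrDl ltW.
- by move: tsn; rewrite -natr1 mulrDl mul1r; lra.
exists (s + e :: p); split; first by split => //=; rewrite ltrDl e0.
by rewrite mesh_cons ge_max pm andbT addrC addKr lexx.
Qed.

Lemma vanishing_mesh_proper s t : s <= t -> ProperFilter (vanishing_mesh s t).
Proof.
move=> st; apply: filter_from_proper; last first.
  by move=> e /= e0; have [p pP] := fine_partition e0 st; exists p.
apply: filter_from_filter; first by exists 1 => /=.
move=> e f /= e0 f0; exists (Num.min e f); rewrite /= ?lt_min ?e0//.
by move=> p /= [pP]; rewrite le_min => /andP[pe pf].
Qed.

(** Each interval of the partition contributes K (v - u)^th, which is at most
    K e^(th - 1) (v - u), and these bounds sum to a multiple of t - s. *)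
Lemma partition_sum_close {W : normedVectType R} (A : R -> R -> W) (f : R -> W)
    (s t th K e : R) p : 1 < th -> 0 <= K ->
  (forall u v, s <= u -> u < v -> v <= t -> v - u <= e ->
    `|f v - f u - A u v| <= K * (v - u) `^ th) ->
  itv_partition s t p -> mesh s p <= e ->
  `|f t - f s - partition_sum A s p| <= K * e `^ (th - 1) * (t - s).
Proof.
move=> th1 K0; elim: p s => [|x p IH] s fA pP.
  rewrite (itv_partition_nil pP) !subrr mulr0 /partition_sum big_ord0 subr0 normr0//.
rewrite mesh_cons ge_max => /andP[xse pm].
have xt : x <= t by exact: itv_partition_le (itv_partition_cons pP).
have sx : s < x by case: pP => /=/andP[].
rewrite partition_sum_cons (_ : _ - _ = (f t - f x - partition_sum A x p) +
  (f x - f s - A s x)); last by zmod.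
have xs0 : 0 < x - s by rewrite subr_gt0.
have -> : K * e `^ (th - 1) * (t - s) =
  K * e `^ (th - 1) * (t - x) + K * e `^ (th - 1) * (x - s) by ring.
apply: normD_le.
  apply: IH => //; last exact: itv_partition_cons pP.
  by move=> u v xu; apply: fA; rewrite (le_trans (ltW sx)).
rewrite (le_trans (fA _ _ _ _ _ _))// -mulrA ler_wpM2l//.
rewrite -(@mulr_powRB1 _ (x - s)) ?(ltW xs0) ?(lt_trans ltr01)// mulrC.
by rewrite ler_wpM2r ?(ltW xs0)// le_powR ?(ltW xs0)// subr_ge0 ltW.
Qed.

(** Evaluates the limit of compensated sums without proving that they are
    Cauchy: a path whose increments agree with the summand to an order th > 1 is
    exhibited instead. *)
Lemma partition_sum_lim {W : normedVectType R} (A : R -> R -> W) (f : R -> W)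
    (s t th K tau : R) : 1 < th -> 0 <= K -> 0 < tau -> s <= t ->
  (forall u v, s <= u -> u < v -> v <= t -> v - u <= tau ->
    `|f v - f u - A u v| <= K * (v - u) `^ th) ->
  lim (partition_sum A s @ vanishing_mesh s t) = f t - f s.
Proof.
move=> th1 K0 tau0 st fA; apply/cvg_lim => //.
  have := @vanishing_mesh_proper s t st; exact: fmap_proper_filter.
have FF := vanishing_mesh_proper st; apply/cvgrPdist_le => eps eps0.
have th10 : 0 < th - 1 by rewrite subr_gt0.
have c0 : 0 <= K * (t - s) by rewrite mulr_ge0// subr_ge0.
have c1 : 0 < K * (t - s) + 1 by rewrite ltr_wpDl.
have [e /andP[e0 _] ee] := small_power th10 (divr_gt0 eps0 c1).
exists (Num.min e tau) => /=; first by rewrite lt_min e0.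
move=> p [pP pm].
rewrite (le_trans (partition_sum_close th1 K0 _ pP pm))//.
  by move=> u v su uv vt; rewrite le_min => /andP[_ vu]; exact: fA.
rewrite (@le_trans _ _ (K * e `^ (th - 1) * (t - s)))//.
  rewrite ler_wpM2r ?subr_ge0// ler_wpM2l// le_powR ?(ltW th10)//.
    by rewrite le_min (ltW e0) ltW.
  by rewrite ge_min lexx.
rewrite mulrAC (le_trans (ler_wpM2l c0 ee))// mulrCA ler_piMr ?(ltW eps0)//.
by rewrite ler_pdivrMr// mul1r lerDl.
Qed.

End partitions.

Section path_holder.
Context {R : realType} {W : normedVectType R}.
Variable alpha : R.
Hypothesis al0 : 0 < alpha.

Definition path_holder (Y : R -> W) := forall T : R, exists2 K : R, 0 <= K &
  forall s t : R, `|s| <= T -> `|t| <= T -> `|Y t - Y s| <= K * `|t - s| `^ alpha.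

Lemma path_holder_continuous (Y : R -> W) : path_holder Y -> continuous Y.
Proof.
move=> hY x; have [K K0 KP] := hY (`|x| + 1); apply/cvgrPdist_le => eps eps0.
have K1 : 0 < K + 1 by rewrite ltr_wpDl.
have [e /andP[e0 e1] ee] := small_power al0 (divr_gt0 eps0 K1).
near=> y.
have xy : `|x - y| <= e by near: y; apply: cvgr_dist_le.
have yT : `|y| <= `|x| + 1.
  have : `|x + (y - x)| <= `|x| + 1 by apply: normD_le; rewrite // distrC (le_trans xy).
  by rewrite addrC subrK.
rewrite (le_trans (KP _ _ yT _))//; first by rewrite lerDl.
rewrite (@le_trans _ _ (K * e `^ alpha))//.
  by rewrite ler_wpM2l// le_powR// ltW.
rewrite (le_trans (ler_wpM2l K0 ee))// mulrCA ler_piMr ?(ltW eps0)//.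
by rewrite ler_pdivrMr// mul1r lerDl.
Unshelve. all: by end_near. Qed.

(** Splits [s, t] at the point u at the fraction n / (n + 1) of the way. *)
Lemma increments_chain (Y : R -> W) (T C tau : R) : 0 < tau ->
  (forall s t : R, `|s| <= T -> `|t| <= T -> `|t - s| <= tau -> `|Y t - Y s| <= C) ->
  forall n (s t : R), `|s| <= T -> `|t| <= T -> `|t - s| <= n%:R * tau ->
    `|Y t - Y s| <= n%:R * C.
Proof.
move=> tau0 YC; elim=> [|n IH] s t sT tT.
  rewrite !mul0r !normr_le0 subr_eq0 => /eqP ->; by rewrite subrr.
move=> tsn; have n1 : 0 < n.+1%:R :> R by rewrite ltr0n.
have [l [l0 l1 ln]] : exists l : R, [/\ 0 <= l, l <= 1 & l * n.+1%:R = n%:R].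
  exists (n%:R / n.+1%:R); split; first by rewrite divr_ge0.
    by rewrite ler_pdivrMr// mul1r ler_nat.
  by rewrite mulfVK// gt_eqF.
pose u := s + l * (t - s).
have uT : `|u| <= T.
  have -> : u = (1 - l) * s + l * t by rewrite /u; ring.
  rewrite (le_trans (ler_normD _ _))// !normrM (ger0_norm l0) ger0_norm ?subr_ge0//.
  have := ler_wpM2l l0 tT; have l10 : 0 <= 1 - l by rewrite subr_ge0.
  have := ler_wpM2l l10 sT; lra.
have us : `|u - s| <= n%:R * tau.
  rewrite /u addrC addKr normrM ger0_norm// (le_trans (ler_wpM2l l0 tsn))//.
  by rewrite mulrA ln.
have tu : `|t - u| <= tau.
  have -> : t - u = (1 - l) * (t - s) by rewrite /u; ring.
  have l10 : 0 <= 1 - l by rewrite subr_ge0.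
  rewrite normrM ger0_norm// (le_trans (ler_wpM2l l10 tsn))// mulrA mulrBl ln mul1r.
  by rewrite -natrB// subSnn mul1r.
rewrite -(subrK (Y u) (Y t)) -addrA -natr1 mulrDl mul1r addrC.
by apply: normD_le; [exact: IH|exact: YC].
Qed.

(** Times at distance more than tau are joined by at most n short steps, and
    |t - s|^alpha is then bounded from below by tau^alpha. *)
Lemma path_holder_local (Y : R -> W) :
  (forall T : R, exists K tau : R, [/\ 0 <= K, 0 < tau & forall s t : R,
    `|s| <= T -> `|t| <= T -> `|t - s| <= tau -> `|Y t - Y s| <= K * `|t - s| `^ alpha]) ->
  path_holder Y.
Proof.
move=> loc T; have [K [tau [K0 tau0 KP]]] := loc T.
have [T0|T0] := ltP T 0.
  by exists 0 => // s t sT; move: (le_trans (normr_ge0 _) sT); rewrite leNgt T0.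
pose n := Num.bound (2 * T / tau).
have nT : 2 * T <= n%:R * tau.
  by rewrite -ler_pdivrMr// ltW// archi_boundP// divr_ge0 ?mulr_ge0// ltW.
have C0 : 0 <= K * tau `^ alpha by rewrite mulr_ge0// powR_ge0.
have chain := @increments_chain Y T (K * tau `^ alpha) tau tau0 _ n.
exists (K + n%:R * K); first by rewrite addr_ge0 ?mulr_ge0.
move=> s t sT tT; have [st|st] := leP `|t - s| tau.
  rewrite (le_trans (KP _ _ sT tT st))// ler_wpM2r ?powR_ge0// lerDl mulr_ge0//.
rewrite (le_trans (chain _ _ _ sT tT _))//.
- move=> a b aT bT ab; rewrite (le_trans (KP _ _ aT bT ab))// ler_wpM2l// le_powR//.
  exact: ltW.
- rewrite (le_trans _ nT)// (le_trans (normB_le tT sT))//; lra.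
- rewrite mulrA (@le_trans _ _ (n%:R * K * `|t - s| `^ alpha))//.
    by rewrite ler_wpM2l ?mulr_ge0// le_powR ?(ltW al0)// ltW.
  by rewrite ler_wpM2r ?powR_ge0// lerDr.
Qed.

End path_holder.

(** * Solutions are the paths with the local expansion *)

Lemma norm_between {R : realType} (a b r : R) : a <= r -> r <= b ->
  `|r| <= Num.max `|a| `|b|.
Proof.
move=> ar rb; rewrite le_max; apply/orP; have [r0|r0] := leP 0 r; [right|left].
  by rewrite !ger0_norm// (le_trans r0).
by rewrite !ltr0_norm ?lerN2// (le_lt_trans ar).
Qed.

Section rde_davie.
Context {R : realType} {U V W : normedVectType R}.
Variables (alpha : R) (X : R -> V) (XX : R -> R -> tensor2 V).
Variables (Z : R -> U) (Z' : R -> 'Hom(V, U)).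
Variables (F : W -> 'Hom(U, W)) (F0 : W -> W) (L : R).
Hypothesis halpha : 3^-1 < alpha <= 2^-1.
Hypothesis hX : rough_path alpha X XX.
Hypothesis hZ : controlled alpha X Z Z'.
Hypothesis hF : Cb 3 F.
Hypothesis F0bl : bounded_lipschitz L F0.

Let A := rde_germ X XX Z Z' F.
Let gA : rough_germ alpha A. Proof. exact: rde_germ_rough. Qed.
Let al0 : 0 < alpha.
Proof. by case/andP: halpha => + _; apply: lt_trans; rewrite invr_gt0. Qed.
Let al3 : 1 < 3 * alpha.
Proof. by case/andP: halpha => + _; lra. Qed.
Let al1 : alpha <= 1.
Proof. by case/andP: halpha => _; lra. Qed.
Let al2 : 3 * alpha <= 1 + alpha.
Proof. by case/andP: halpha => _; lra. Qed.
Let F0_bd : forall y, `|F0 y| <= L. Proof. by case: F0bl. Qed.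
Let F0_lip : forall y z, `|F0 y - F0 z| <= L * `|y - z|. Proof. by case: F0bl. Qed.
Let L0 : 0 <= L. Proof. exact: le_trans (normr_ge0 _) (F0_bd 0). Qed.

Definition rde_integrand (Y : R -> W) (Y' : R -> 'Hom(V, W)) (u v : R) : W :=
  F (Y u) (increment Z u v) +
    tens_lift (fun x y => fderive F (Y u) (Y' u x) (Z' u y)) (XX u v).

Lemma rde_integrandE Y Y' u v : (forall t, Y' t = (F (Y t) \o Z' t)%VF) -> u <= v ->
  rde_integrand Y Y' u v = A u v (Y u).
Proof.
move=> Y'E uv; rewrite /rde_integrand /A /rde_germ /ext_area uv; congr (_ + _).
rewrite /second_lift /tens_lift; apply: eq_bigr => i _.
by rewrite /second_coef Y'E comp_lfunE.
Qed.

(** Y is itself controlled by X, so the estimates made for Z apply to it; and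
    A s u (Y s) differs from Y'_s X_{s,u} = F(Y_s) Z'_s X_{s,u} by
    F(Y_s) R^Z_{s,u} and an area term, both of order 2 alpha. *)
Lemma controlled_weak_davie Y Y' : controlled alpha X Y Y' ->
  (forall t, Y' t = (F (Y t) \o Z' t)%VF) ->
  path_holder alpha Y /\ forall T : R, exists2 K : R, 0 <= K & forall s u : R,
    `|s| <= T -> `|u| <= T ->
    `|Y s + A s u (Y s) - Y u| <= K * (`|u - s| `^ alpha) ^+ 2.
Proof.
move=> hY Y'E; split=> T.
  have [D dD] := driver_bounds halpha hX hY T.
  by exists D; [exact: driver_ge0 dD|exact: driver_Z dD].
have [D dD] := driver_bounds halpha hX hY T.
have [D' dD'] := driver_bounds halpha hX hZ T.
have D0 := driver_ge0 dD; have D'0 := driver_ge0 dD'.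
have [C1 C10 FC] := first_coef_C2 hF.
have [C2 C20 LC] := @second_lift_C2 R U V W F hF.
exists (C1 * D' + C2 * (D' * D' * D') + D).
  by rewrite !addr_ge0// !mulr_ge0.
move=> s u sT uT; set p := `|u - s| `^ alpha.
rewrite (_ : _ - _ = F (Y s) (remainder X Z Z' s u)
  + second_lift F (Y s) (Z' s) (Z' s) (ext_area X XX s u) - remainder X Y Y' s u); last first.
  rewrite /remainder Y'E comp_lfunE (lfunB (F (Y s)) (increment Z s u)) /A /rde_germ /(increment Y).
  by zmod.
rewrite !mulrDl; apply: normB_le; last exact: driver_rem dD _ _ sT uT.
apply: normD_le.
  rewrite (le_trans (bC2_norm (FC _) _))// -mulrA ler_wpM2l//.
  exact: driver_rem dD' _ _ sT uT.
rewrite (le_trans (bC2_norm (LC _ _ _) _))// -[leRHS]mulrA ler_wpM2l// -[leRHS]mulrA.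
have [Xp _] := driver_area dD' sT uT; have Ps := driver_Z' dD' sT.
by apply: ler_pM; rewrite ?mulr_ge0// ler_pM.
Qed.

(** Along Y the germ is a function of the times alone.  By the expansion at order
    2 alpha it is additive up to the order 3 alpha, so that it is again a rough
    germ, constant in the state variable; its solution without drift is a path
    whose increments are approximated by A s t (Y s). *)
Lemma path_germ_rough Y : path_holder alpha Y ->
  (forall T : R, exists2 K : R, 0 <= K & forall s u : R, `|s| <= T -> `|u| <= T ->
    `|Y s + A s u (Y s) - Y u| <= K * (`|u - s| `^ alpha) ^+ 2) ->
  rough_germ alpha (fun s t (_ : W) => A s t (Y s)).
Proof.
move=> hY wY T; have [C gC] := gA T; have [K K0 KY] := hY T; have [K' K'0 KW] := wY T.
have C1 := germ_ge1 gC; have C0 : 0 <= C by exact: le_trans C1.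
pose B := (2 * T) `^ alpha; have B0 : 0 <= B by exact: powR_ge0.
exists (C + C * K' + C * B * K).
have P1 : 0 <= C * K' by rewrite mulr_ge0.
have P2 : 0 <= C * B * K by rewrite !mulr_ge0.
have bd : C <= C + C * K' + C * B * K by rewrite -addrA lerDl addr_ge0.
have def h s u t : `|s| <= T -> `|u| <= T -> `|t| <= T -> `|u - s| <= h -> `|t - u| <= h ->
    `|A s t (Y s) - A s u (Y s) - A u t (Y u)| <= (C + C * K' + C * B * K) * h `^ (3 * alpha).
  move=> sT uT tT us tu; have h0 : 0 <= h by exact: le_trans us.
  rewrite (_ : _ - _ = chen_defect A s u t (Y s) + (A u t (Y s + A s u (Y s)) - A u t (Y u)));
    last by rewrite /chen_defect; zmod.
  have e1 := germ_defect gC (Y s) sT uT tT us tu.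
  have pb (x : R) : `|x| <= h -> `|x| `^ alpha <= h `^ alpha.
    by move=> xh; apply: le_powR => //; exact: ltW.
  have e2 : `|A u t (Y s + A s u (Y s)) - A u t (Y u)| <= C * K' * h `^ (3 * alpha).
    rewrite (le_trans (germ_lip _ _ gC uT tT))// powR_triple//.
    rewrite (_ : C * K' * _ = C * h `^ alpha * (K' * h `^ alpha ^+ 2)); last by ring.
    apply: ler_pM => //; first by rewrite mulr_ge0// powR_ge0.
      by rewrite ler_wpM2l// pb.
    rewrite (le_trans (KW _ _ sT uT))// ler_wpM2l//.
    by rewrite ler_pXn2r ?nnegrE ?powR_ge0// pb.
  rewrite (le_trans (normD_le e1 e2))// -mulrDl ler_wpM2r ?powR_ge0// lerDl//.
split.
- exact: le_trans bd.
- move=> s t y sT tT; rewrite (le_trans (germ_norm gC _ sT tT))//.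
  by rewrite ler_wpM2r// powR_ge0.
- move=> s t a r b q sT tT; rewrite !subrr normr0 mulr_ge0//.
  by rewrite mulr_ge0 ?powR_ge0// (le_trans C0).
- by move=> h s u t y; exact: def.
- move=> h s u t y z sT uT tT us tu; rewrite /chen_defect subrr normr0.
  by rewrite !mulr_ge0 ?powR_ge0// (le_trans C0).
- move=> s t s' t' _ sT tT s'T t'T.
  rewrite (_ : _ - _ = (A s' t' (Y s') - A s t (Y s')) + (A s t (Y s') - A s t (Y s)));
    last by zmod.
  have e1 := germ_time gC (Y s') sT tT s'T t'T.
  have e2 : `|A s t (Y s') - A s t (Y s)| <= C * B * K * `|s' - s| `^ alpha.
    rewrite (le_trans (germ_lip _ _ gC sT tT))// -[leRHS]mulrA; apply: ler_pM => //.
    - by rewrite mulr_ge0// powR_ge0.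
    - rewrite ler_wpM2l// le_powR ?(ltW al0)// (le_trans (normB_le tT sT))//; lra.
    - exact: KY.
  rewrite (le_trans (normD_le e1 e2))//.
  have : 0 <= C * K' * (`|s' - s| `^ alpha + `|t' - t| `^ alpha).
    by rewrite mulr_ge0// addr_ge0// powR_ge0.
  have : 0 <= C * B * K * `|t' - t| `^ alpha by rewrite mulr_ge0// powR_ge0.
  lra.
Qed.

Lemma drift_path_continuous Y : path_holder alpha Y -> continuous (F0 \o Y).
Proof.
move=> hY; apply: (@path_holder_continuous _ _ _ al0) => T; have [K K0 KP] := hY T.
exists (L * K) => [|s t sT tT]; first by rewrite mulr_ge0.
by rewrite (le_trans (F0_lip _ _))// -mulrA ler_wpM2l// KP.
Qed.

Lemma drift_integral_davie Y : path_holder alpha Y -> forall T : R, exists2 K : R, 0 <= K &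
  forall s t : R, `|s| <= T -> `|t| <= T -> s <= t -> t - s <= 1 ->
  `|itv_integral (F0 \o Y) s t - (t - s) *: F0 (Y s)| <= K * (t - s) `^ (3 * alpha).
Proof.
move=> hY T; have [K K0 KP] := hY T; have [k k0 kE] := @itv_integral_close R W.
exists (k * (L * K)); first by rewrite !mulr_ge0.
move=> s t sT tT st ts1; have ts0 : 0 <= t - s by rewrite subr_ge0.
rewrite (le_trans (kE _ s t (L * (K * (t - s) `^ alpha)) _ (drift_path_continuous hY) st _ _))//.
- by rewrite !mulr_ge0// powR_ge0.
- move=> r /andP[sr rt]; rewrite /= (le_trans (F0_lip _ _))// ler_wpM2l//.
  have rT : `|r| <= T.
    move: sT tT; rewrite !ler_norml => /andP[a _] /andP[_ b].
    by rewrite (le_trans a)// (le_trans rt).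
  rewrite (le_trans (KP _ _ sT rT))// ler_wpM2l// le_powR ?(ltW al0)//.
  by rewrite ger0_norm ?subr_ge0// lerD2r.
- rewrite (_ : k * _ = k * (L * K) * ((t - s) `^ alpha * (t - s))); last by ring.
  rewrite ler_wpM2l ?mulr_ge0//.
  rewrite -[X in _ * X](powRr1 ts0) -powR_add//; apply: powR_expo_anti; rewrite ?ts0//.
    by rewrite mulr_gt0.
  by rewrite addrC.
Qed.

(** Rebasing at the later time turns an expansion from t to s > t into one from s
    to t. *)
Lemma davie_of_ordered Y : path_holder alpha Y -> (forall T : R, exists K tau : R,
   [/\ 0 <= K, 0 < tau & forall s t : R, `|s| <= T -> `|t| <= T -> s <= t -> t - s <= tau ->
      `|davie_rem A F0 Y s t| <= K * (t - s) `^ (3 * alpha)]) -> davie A F0 alpha Y.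
Proof.
move=> hY dY T; have [K [tau [K0 tau0 D]]] := dY T.
have [K' K'0 rebase] := davie_rem_rebase halpha gA F0bl T K0.
exists (K + K'), (Num.min 1 tau); split; [by rewrite addr_ge0|by rewrite lt_min ltr01|].
move=> s t sT tT; rewrite le_min => /andP[st1 sttau].
rewrite mulrDl; have [st|ts] := leP s t.
  rewrite ler_wpDr ?mulr_ge0 ?powR_ge0//.
  have E : `|t - s| = t - s by rewrite ger0_norm ?subr_ge0.
  by rewrite E; apply: D; rewrite // -E.
rewrite ler_wpDl ?mulr_ge0 ?powR_ge0//.
have E : `|t - s| = s - t by rewrite distrC ger0_norm ?subr_ge0// ltW.
apply: (rebase Y t s t) => //; rewrite ?subrr ?normr0// ?(distrC s)//.
  by rewrite E; apply: D; rewrite // -?E// ltW.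
by rewrite (davie_rem_diag _ halpha gA _ tT) normr0 mulr_ge0 ?powR_ge0.
Qed.

(** The controlled integral is the increment of the path I obtained from
    [path_germ_rough], which approximates A s t (Y s) to order 3 alpha; the time
    integral approximates (t - s) F0 (Y s) to the order 1 + alpha, which is at
    least 3 alpha. *)
Lemma rde_solution_davie y Y : rde_solution alpha X XX Z Z' F F0 y Y ->
  Y.1 0 = y /\ davie A F0 alpha Y.1.
Proof.
case: Y => Y Y' [/= hY YE Y'E].
have [hol weak] := controlled_weak_davie hY Y'E.
have ga := path_germ_rough hol weak.
have bl0 : bounded_lipschitz 0 (fun _ : W => 0 : W).
  by split => *; rewrite ?subrr normr0// mul0r.
have [I [_ dI _]] := davie_exists halpha ga bl0 0.
have limI s t : s <= t ->
    lim (partition_sum (rde_integrand Y Y') s @ vanishing_mesh s t) = I t - I s.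
  move=> st; pose T := Num.max `|s| `|t|.
  have [K [tau [K0 tau0 D]]] := dI T.
  apply: (@partition_sum_lim _ _ _ I s t (3 * alpha) K tau) => // u v su uv vt vu.
  have inT r : s <= r -> r <= t -> `|r| <= T by exact: norm_between.
  have uT := inT u su (le_trans (ltW uv) vt); have vT := inT v (le_trans su (ltW uv)) vt.
  have E : `|v - u| = v - u by rewrite ger0_norm ?subr_ge0// ltW.
  have := D u v uT vT; rewrite E => /(_ vu).
  by rewrite /davie_rem scaler0 subr0 (rde_integrandE Y'E (ltW uv)).
have YE' t : Y t = y + (I t - I 0) + oriented (itv_integral (F0 \o Y)) 0 t.
  rewrite YE; congr (_ + _ + _); apply: oriented_path => s r sr; exact: limI.
have cont := drift_path_continuous hol.
have add s u t : s <= u -> u <= t -> itv_integral (F0 \o Y) s t =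
    itv_integral (F0 \o Y) s u + itv_integral (F0 \o Y) u t.
  exact: itv_integral_add.
have inc s t : s <= t -> Y t - Y s = (I t - I s) + itv_integral (F0 \o Y) s t.
  by move=> st; rewrite (YE' t) (YE' s) -(oriented_sub add st); zmod.
split.
  by rewrite (YE' 0) subrr addr0 /oriented lexx (additive_diag add) addr0.
apply: davie_of_ordered => // T.
have [K [tau [K0 tau0 D]]] := dI T.
have [K' K'0 D'] := drift_integral_davie hol T.
exists (K + K'), (Num.min 1 tau); split; [by rewrite addr_ge0|by rewrite lt_min ltr01|].
move=> s t sT tT st; rewrite le_min => /andP[st1 sttau].
rewrite /davie_rem (inc _ _ st) (_ : _ - _ = (I t - I s - A s t (Y s)) +
   (itv_integral (F0 \o Y) s t - (t - s) *: F0 (Y s))); last by zmod.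
rewrite mulrDl; apply: normD_le; last exact: D'.
have E : `|t - s| = t - s by rewrite ger0_norm ?subr_ge0.
have := D s t sT tT; rewrite E => /(_ sttau).
by rewrite /davie_rem scaler0 subr0.
Qed.

Lemma davie_path_holder Y : davie A F0 alpha Y -> path_holder alpha Y.
Proof.
move=> dY; apply: path_holder_local => // T; have [K [tau [K0 tau0 D]]] := dY T.
have [C gC] := gA T; have C0 : 0 <= C by exact: le_trans (germ_ge1 gC).
exists (K + C + L), (Num.min 1 tau); split; [by rewrite !addr_ge0|by rewrite lt_min ltr01|].
move=> s t sT tT; rewrite le_min => /andP[st1 sttau].
rewrite (_ : _ - _ = davie_rem A F0 Y s t + A s t (Y s) + (t - s) *: F0 (Y s)); last first.
  by rewrite /davie_rem; zmod.
rewrite !mulrDl; apply: normD_le; first apply: normD_le.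
- rewrite (le_trans (D _ _ sT tT sttau))// ler_wpM2l//; apply: powR_expo_anti => //.
    by rewrite ler_peMl ?ler1n// ltW.
  by rewrite normr_ge0.
- exact: germ_norm gC _ _ _ sT tT.
- rewrite normrZ mulrC; apply: ler_pM => //.
  by rewrite -[leLHS](powRr1 (normr_ge0 _)); apply: powR_expo_anti; rewrite ?normr_ge0.
Qed.

Lemma loc_holder_of_symmetric {E : normedVectType R} (b : R) (B : R -> R -> E) :
  (forall T : R, exists K : R, forall s t : R, `|s| <= T -> `|t| <= T ->
     `|B s t| <= K * `|t - s| `^ b) -> loc_holder b B.
Proof.
move=> BK T1 T2; have [K KP] := BK (Num.max `|T1| `|T2|); exists K => s t Ts st tT.
have E' : `|t - s| = t - s by rewrite ger0_norm ?subr_ge0// ltW.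
rewrite -E'; apply: KP; apply: norm_between => //; first exact: le_trans (ltW st) tT.
exact: le_trans Ts (ltW st).
Qed.

(** For nearby times the remainder of Y is read off the expansion; for distant
    ones it is merely bounded by a multiple of |t - s|^alpha, which suffices since
    |t - s|^alpha is at least q there. *)
Lemma davie_controlled Y : davie A F0 alpha Y ->
  controlled alpha X Y (fun t => (F (Y t) \o Z' t)%VF).
Proof.
move=> dY; have hY := davie_path_holder dY.
have [C1 C10 FC] := first_coef_C2 hF.
have [C2 C20 LC] := @second_lift_C2 R U V W F hF.
have [c Fc] : exists c, bounded_C2 c F by exact: Cb2_bounded_C2 (Cb_pred hF).
have c0 := bounded_C2_ge0 Fc; case: Fc => F1 F2 _.
split; apply: loc_holder_of_symmetric => T.
  have [D dD] := driver_bounds halpha hX hZ T; have D0 := driver_ge0 dD.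
  have [K K0 KY] := hY T.
  exists (c * K * D + c * D) => s t sT tT; set p := `|t - s| `^ alpha.
  have p0 : 0 <= p by exact: powR_ge0.
  apply: opnorm_le => [|x]; first by rewrite mulr_ge0// addr_ge0// !mulr_ge0.
  rewrite /increment sub_lfunE !comp_lfunE.
  rewrite (_ : _ - _ = (F (Y t) - F (Y s)) (Z' t x) + F (Y s) ((Z' t - Z' s) x)); last first.
    by rewrite !sub_lfunE lfunB; zmod.
  rewrite !mulrDl; apply: normD_le; rewrite (le_trans (lfun_norm_le _ _))//.
    rewrite (_ : c * K * D * p * `|x| = (c * (K * p)) * (D * `|x|)); last by ring.
    apply: ler_pM => //.
      by rewrite (le_trans (F2 _ _))// ler_wpM2l//; exact: KY.
    by rewrite (le_trans (lfun_norm_le _ _))// ler_wpM2r//; exact: driver_Z' dD _ tT.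
  rewrite -!mulrA; apply: ler_pM => //.
  rewrite mulrA (le_trans (lfun_norm_le _ _))// ler_wpM2r//.
  exact: driver_Z'_incr dD _ _ sT tT.
have [D dD] := driver_bounds halpha hX hZ T; have D0 := driver_ge0 dD.
have [K K0 KY] := hY T; have [M [tau [M0 tau0 dM]]] := dY T.
pose B := (2 * T) `^ alpha; have B0 : 0 <= B by exact: powR_ge0.
pose tm := Num.min 1 tau; have tm0 : 0 < tm by rewrite lt_min ltr01.
pose q := tm `^ alpha; have q0 : 0 < q by exact: powR_gt0.
exists (M * B + C2 * (D * D * D) + L + C1 * D + (K + C1 * (D * D)) / q) => s t sT tT.
rewrite powR_double//; set p := `|t - s| `^ alpha.
have p0 : 0 <= p by exact: powR_ge0.
have pB : p <= B.
  apply: le_powR => //; first exact: ltW.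
  by rewrite (le_trans (normB_le tT sT))//; lra.
have n1 : 0 <= (M * B + C2 * (D * D * D) + L + C1 * D) * p ^+ 2.
  by rewrite mulr_ge0 ?exprn_ge0// !addr_ge0// !mulr_ge0.
have n2 : 0 <= (K + C1 * (D * D)) / q * p ^+ 2.
  by rewrite mulr_ge0 ?exprn_ge0// divr_ge0 ?(ltW q0)// addr_ge0// !mulr_ge0.
rewrite mulrDl; have [st|st] := leP `|t - s| tm.
  move: st; rewrite le_min => /andP[st1 sttau].
  rewrite ler_wpDr// (_ : remainder _ _ _ _ _ = davie_rem A F0 Y s t +
    second_lift F (Y s) (Z' s) (Z' s) (ext_area X XX s t) + (t - s) *: F0 (Y s)
    + F (Y s) (remainder X Z Z' s t)); last first.
    rewrite /remainder comp_lfunE (lfunB (F (Y s)) (increment Z s t)) /davie_rem /A /rde_germ /(increment Y).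
    by zmod.
  rewrite !mulrDl; apply: normD_le; first apply: normD_le; first apply: normD_le.
  - rewrite (le_trans (dM _ _ sT tT sttau))// powR_triple// -mulrA ler_wpM2l//.
    by rewrite exprS ler_wpM2r// exprn_ge0.
  - rewrite (le_trans (bC2_norm (LC _ _ _) _))// -[leRHS]mulrA ler_wpM2l// -[leRHS]mulrA.
    have [Xp _] := driver_area dD sT tT; have Ps := driver_Z' dD sT.
    by apply: ler_pM; rewrite ?mulr_ge0// ler_pM.
  - rewrite normrZ mulrC; apply: ler_pM => //.
    rewrite -powR_double// -[leLHS](powRr1 (normr_ge0 _)).
    apply: powR_expo_anti; rewrite ?normr_ge0// ?mulr_gt0//.
    by case/andP: halpha => _; lra.
  - rewrite (le_trans (bC2_norm (FC _) _))// -mulrA ler_wpM2l//.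
    exact: driver_rem dD _ _ sT tT.
rewrite ler_wpDl//.
have qp : q <= p by apply: le_powR; rewrite ?ltW.
have e : `|remainder X Y (fun t => (F (Y t) \o Z' t)%VF) s t| <= (K + C1 * (D * D)) * p.
  rewrite /remainder comp_lfunE mulrDl; apply: normB_le; first exact: KY.
  rewrite (le_trans (bC2_norm (FC _) _))// -mulrA ler_wpM2l// -mulrA.
  rewrite (le_trans (lfun_norm_le _ _))//; apply: ler_pM => //; first exact: driver_Z' dD _ sT.
  by have [] := driver_path dD sT tT.
rewrite (le_trans e)// -mulrA ler_wpM2l ?addr_ge0 ?mulr_ge0//.
by rewrite ler_pdivlMl// expr2 ler_wpM2r.
Qed.

Lemma davie_rde_solution y Y : Y 0 = y -> davie A F0 alpha Y ->
  rde_solution alpha X XX Z Z' F F0 y (Y, fun t => (F (Y t) \o Z' t)%VF).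
Proof.
move=> Y0 dY; have hY := davie_path_holder dY; split => //=; first exact: davie_controlled.
have cont := drift_path_continuous hY.
have add s u t : s <= u -> u <= t -> itv_integral (F0 \o Y) s t =
    itv_integral (F0 \o Y) s u + itv_integral (F0 \o Y) u t.
  exact: itv_integral_add.
pose J t := oriented (itv_integral (F0 \o Y)) 0 t.
have J0 : J 0 = 0 by rewrite /J /oriented lexx (additive_diag add).
(* subtracting the time integral leaves a path whose increments agree with the
   germ to order 3 alpha: the controlled integral *)
pose f t := Y t - J t.
set Y' := (fun t => _).
suff lim_f s t : s <= t ->
    lim (partition_sum (rde_integrand Y Y') s @ vanishing_mesh s t) = f t - f s.
  move=> t; rewrite (_ : controlled_integral _ _ _ _ _ _ _ _ = f t - f 0).
    by rewrite time_integralE -/(J t) /f J0 Y0; zmod.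
  by apply: oriented_path => u v uv; exact: lim_f.
move=> st; pose T := Num.max `|s| `|t|.
have [K [tau [K0 tau0 D]]] := dY T.
have [K' K'0 D'] := drift_integral_davie hY T.
apply: (@partition_sum_lim _ _ _ f s t (3 * alpha) (K + K') (Num.min 1 tau)) => //.
- by rewrite addr_ge0.
- by rewrite lt_min ltr01.
move=> u v su uv vt; rewrite le_min => /andP[vu1 vutau].
have inT r : s <= r -> r <= t -> `|r| <= T by exact: norm_between.
have uT := inT u su (le_trans (ltW uv) vt); have vT := inT v (le_trans su (ltW uv)) vt.
have E : `|v - u| = v - u by rewrite ger0_norm ?subr_ge0// ltW.
rewrite (@rde_integrandE Y Y' u v _ (ltW uv))//.
have Juv : J v - J u = itv_integral (F0 \o Y) u v by exact: oriented_sub (ltW uv).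
rewrite (_ : _ - _ = davie_rem A F0 Y u v - ((J v - J u) - (v - u) *: F0 (Y u))); last first.
  by rewrite /f /davie_rem; zmod.
rewrite Juv mulrDl; apply: normB_le; last by apply: D' => //; exact: ltW.
by have := D u v uT vT; rewrite E => /(_ vutau).
Qed.

End rde_davie.

(** * Well-posedness and the cocycle property *)

Section rde_well_posed.
Context {R : realType} {U V W : normedVectType R}.
Variables (alpha : R) (X : R -> V) (XX : R -> R -> tensor2 V).
Variables (Z : R -> U) (Z' : R -> 'Hom(V, U)).
Variables (F : W -> 'Hom(U, W)) (F0 : W -> W) (L : R).
Hypothesis halpha : 3^-1 < alpha <= 2^-1.
Hypothesis hX : rough_path alpha X XX.
Hypothesis hZ : controlled alpha X Z Z'.
Hypothesis hF : Cb 3 F.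
Hypothesis F0bl : bounded_lipschitz L F0.

Let A := rde_germ X XX Z Z' F.
Let gA : rough_germ alpha A. Proof. exact: rde_germ_rough. Qed.

Lemma rde_sol_correct y :
  rde_solution alpha X XX Z Z' F F0 y (rde_sol alpha X XX Z Z' F F0 y).
Proof.
apply: (@xgetPex _ (fun=> 0, fun=> 0) [set Y | rde_solution alpha X XX Z Z' F F0 y Y]).
have [Y [Y0 dY _]] := davie_exists halpha gA F0bl y.
exists (Y, fun t => (F (Y t) \o Z' t)%VF) => /=.
exact: (davie_rde_solution halpha hX hZ hF F0bl Y0 dY).
Qed.

Lemma rde_sol_snd y t : (rde_sol alpha X XX Z Z' F F0 y).2 t =
  (F ((rde_sol alpha X XX Z Z' F F0 y).1 t) \o Z' t)%VF.
Proof. by case: (rde_sol_correct y) => _ _ ->. Qed.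

Lemma rde_sol_davie y : (rde_sol alpha X XX Z Z' F F0 y).1 0 = y /\
  davie A F0 alpha (rde_sol alpha X XX Z Z' F F0 y).1.
Proof. exact: (rde_solution_davie halpha hX hZ hF F0bl (rde_sol_correct y)). Qed.

Lemma rde_sol_unique y Y : Y 0 = y -> davie A F0 alpha Y ->
  (rde_sol alpha X XX Z Z' F F0 y).1 = Y.
Proof.
move=> Y0 dY; have [S0 dS] := rde_sol_davie y.
by apply: (davie_unique halpha gA F0bl dS dY); rewrite S0 Y0.
Qed.

Lemma euler_approx_cvg y t :
  (fun n => euler_approx A F0 n y t) @ \oo --> (rde_sol alpha X XX Z Z' F F0 y).1 t.
Proof.
have [Y [Y0 dY Yc]] := davie_exists halpha gA F0bl y.
by rewrite (rde_sol_unique Y0 dY); exact: Yc.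
Qed.

End rde_well_posed.

Section cocycle_property.
Context {R : realType} {U V W : normedVectType R} {d : measure_display}
  {Omega : measurableType d}.
Variables (alpha : R) (P : probability Omega R) (theta : R -> Omega -> Omega).
Variables (X : Omega -> R -> V) (XX : Omega -> R -> R -> tensor2 V).
Variables (Z : Omega -> R -> U) (Z' : Omega -> R -> 'Hom(V, U)).
Variables (F : W -> 'Hom(U, W)) (F0 : W -> W) (L : R).
Hypothesis halpha : 3^-1 < alpha <= 2^-1.
Hypothesis htheta : invertible_mpds P theta.
Hypothesis hX : rough_path_cocycle theta alpha X XX.
Hypothesis hZ : controlled_cocycle theta alpha X Z Z'.
Hypothesis hF : Cb 3 F.
Hypothesis F0bl : bounded_lipschitz L F0.

(** Both Y (theta s w) over [u, v] and Y w over [u + s, v + s] are compared with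
    the increment of Y (theta (u + s) w) over [0, v - u]. *)
Lemma cocycle_increment {E : normedVectType R} (Y : Omega -> R -> E) :
  (forall s t w, 0 <= t -> increment (Y w) s (s + t) = increment (Y (theta s w)) 0 t) ->
  forall s u v w, increment (Y (theta s w)) u v = increment (Y w) (u + s) (v + s).
Proof.
move=> Yc s.
have le u v w : u <= v -> increment (Y (theta s w)) u v = increment (Y w) (u + s) (v + s).
  move=> uv; have vu : 0 <= v - u by rewrite subr_ge0.
  have := Yc u (v - u) (theta s w) vu; rewrite -(mpds_flow htheta).
  rewrite -(Yc _ _ _ vu) (_ : u + (v - u) = v); last by ring.
  by rewrite (_ : u + s + (v - u) = v + s)//; ring.
move=> u v w; have [uv|vu] := leP u v; first exact: le.
have inc (f : R -> E) a b : increment f a b = - increment f b a by rewrite /increment opprB.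
by rewrite inc (le v u w (ltW vu)) -inc.
Qed.

Lemma cocycle_area s u v w :
  ext_area (X (theta s w)) (XX (theta s w)) u v = ext_area (X w) (XX w) (u + s) (v + s).
Proof.
have le a b : a <= b -> XX (theta s w) a b = XX w (a + s) (b + s).
  move=> ab; have ba : 0 <= b - a by rewrite subr_ge0.
  have := rpc_cocycle2 hX a (theta s w) ba; rewrite -(mpds_flow htheta).
  rewrite -(rpc_cocycle2 hX _ w ba) (_ : a + (b - a) = b); last by ring.
  by rewrite (_ : a + s + (b - a) = b + s)//; ring.
rewrite /ext_area lerD2r; case: ifPn => [uv|]; first exact: le.
rewrite -ltNge => /ltW vu; rewrite (le _ _ vu).
by rewrite (cocycle_increment (fun s t w => rpc_cocycle1 hX s w)).
Qed.

Lemma cocycle_derivative s t w : Z' (theta s w) t = Z' w (t + s).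
Proof.
have := cc_cocycle2 hZ t (theta s w) (lexx 0); rewrite -(mpds_flow htheta) addr0 => ->.
by rewrite -(cc_cocycle2 hZ _ _ (lexx 0)) addr0.
Qed.

Lemma cocycle_germ s w u v y :
  rde_germ (X (theta s w)) (XX (theta s w)) (Z (theta s w)) (Z' (theta s w)) F u v y =
  rde_germ (X w) (XX w) (Z w) (Z' w) F (u + s) (v + s) y.
Proof.
rewrite /rde_germ cocycle_area cocycle_derivative.
by rewrite (cocycle_increment (fun s t w => cc_cocycle1 hZ s w)).
Qed.

Lemma davie_shift s w Y :
  davie (rde_germ (X w) (XX w) (Z w) (Z' w) F) F0 alpha Y ->
  davie (rde_germ (X (theta s w)) (XX (theta s w)) (Z (theta s w)) (Z' (theta s w)) F)
    F0 alpha (fun r => Y (r + s)).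
Proof.
move=> dY T; have [K [tau [K0 tau0 D]]] := dY (T + `|s|).
exists K, tau; split => // a b aT bT ab.
have E (x y : R) : x + s - (y + s) = x - y by ring.
have bnd x : `|x| <= T -> `|x + s| <= T + `|s| by move=> xT; exact: normD_le.
have := D (a + s) (b + s) (bnd _ aT) (bnd _ bT); rewrite /davie_rem E => /(_ ab).
by rewrite cocycle_germ.
Qed.

(** The solution for w from Y0, translated by s, is the solution for theta s w
    from its value at s, by uniqueness; the second component follows, being a
    function of the first and of Z'. *)
Lemma solution_map_cocycle s t w (Y0 : W * 'Hom(V, W)) :
  solution_map alpha X XX Z Z' F F0 (t + s) w Y0 =
  solution_map alpha X XX Z Z' F F0 t (theta s w) (solution_map alpha X XX Z Z' F F0 s w Y0).
Proof.
have rX w' := rpc_rough_path hX w'; have rZ w' := cc_controlled hZ w'.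
have [S0 dS] := rde_sol_davie halpha (rX w) (rZ w) hF F0bl Y0.1.
have := rde_sol_unique halpha (rX (theta s w)) (rZ (theta s w)) hF F0bl (erefl _)
  (@davie_shift s w _ dS); rewrite /= add0r => uni.
rewrite /solution_map /= !(rde_sol_snd halpha (rX _) (rZ _) hF F0bl).
by rewrite uni cocycle_derivative.
Qed.

End cocycle_property.

(** * Measurability *)

Section borel_measurability.
Context {R : realType} {d : measure_display} {T : measurableType d}.

Lemma borel_measurable_comp {E : normedModType R} (f : T -> E) (g : E -> R) :
  measurable_fun setT (f : T -> borel E) -> continuous g ->
  measurable_fun setT (g \o f : T -> R).
Proof.
move=> mf cg mT; apply: (measurability _ (RGenOInfty.measurableE R)) => //.
move=> _ [_ [x ->] <-]; rewrite comp_preimage.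
apply: mf => //; apply: sub_sigma_algebra.
by apply: open_comp => [y _|]; [exact: cg|exact: rray_open].
Qed.

(** The preimage of an open set B is the countable union of the preimages of the
    rational boxes, in the functionals l, that are contained in B: the functionals
    dominate the norm, so a small box around a point of B lies in B. *)
Lemma borel_measurable_functionals {E : normedModType R} {I : finType}
    (l : I -> E -> R) (K : R) (f : T -> E) : 0 < K ->
  (forall x x' (m : R), 0 <= m -> (forall i, `|l i x - l i x'| <= m) -> `|x - x'| <= K * m) ->
  (forall i, measurable_fun setT (fun t => l i (f t) : R)) ->
  measurable_fun setT (f : T -> borel E).
Proof.
move=> K0 lK mf mT; apply: (@measurability _ _ T (borel E) setT f (@open E) erefl) => //.
move=> _ [B oB <-].
rewrite setTI.
pose e (k : nat) : R := k.+1%:R^-1.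
have e0 k : 0 < e k by rewrite invr_gt0.
pose box (q : {ffun I -> rat}) k := [set x : E | forall i, `|l i x - ratr (q i)| < e k].
pose piece (u : {ffun I -> rat} * nat) : set T :=
  if `[< box u.1 u.2 `<=` B >] then
    \bigcap_(i in [set: I]) [set t | `|l i (f t) - ratr (u.1 i)| < e u.2]
  else set0.
have -> : f @^-1` B = \bigcup_u piece u.
  apply/seteqP; split => [t /= Bt|t [u _]]; last first.
    rewrite /piece; case: asboolP => // uB tu; apply: uB => i; exact: tu.
  have /nbhs_ballP[r /= r0 rB] : nbhs (f t) B by exact: open_nbhs_nbhs.
  have [k kE] : exists k : nat, K * (2 * e k) < r.
    exists (Num.bound (r^-1 * (2 * K))); rewrite mulrCA mulrA /e ltr_pdivrMr//.
    rewrite -ltr_pdivrMl// (lt_le_trans (archi_boundP _)) ?ler_nat//.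
    by rewrite !mulr_ge0 ?invr_ge0// ltW.
  have /choice[q qE] i : exists q : rat, `|l i (f t) - ratr q| < e k.
    have [|q] := @rat_in_itvoo R (l i (f t) - e k) (l i (f t) + e k).
      by have := e0 k; lra.
    rewrite in_itv /= => /andP[q1 q2]; exists q; rewrite ltr_norml.
    by apply/andP; split; lra.
  exists ([ffun i => q i], k) => //; rewrite /piece /=.
  case: asboolP => [_ i _ /=|]; first by rewrite ffunE.
  case=> x bx; apply: rB; rewrite -ball_normE /ball_ /=.
  rewrite (le_lt_trans _ kE)//; apply: lK => [|i]; first by rewrite mulr_ge0// ltW.
  have := bx i; rewrite ffunE => h1; have h2 := qE i.
  rewrite (_ : _ - _ = (l i (f t) - ratr (q i)) - (l i x - ratr (q i))); last by ring.
  rewrite (le_trans (normB_le (ltW h2) (ltW h1)))//; lra.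
apply: countable_bigcupT_measurable; first exact: countableP.
move=> u; rewrite /piece; case: ifPn => _; last exact: measurable0.
apply: fin_bigcap_measurable => // i _.
pose q : R := ratr (u.1 i).
have mg : measurable_fun setT (fun t => `|l i (f t) - q| : R).
  apply: (measurableT_comp (@normr_measurable R setT)).
  exact: measurable_funB.
rewrite (_ : [set t | _] = setT `&` (fun t => `|l i (f t) - q|) @^-1` `]-oo, e u.2[).
  by apply: mg => //; exact: measurable_itv.
by rewrite setTI; apply/seteqP; split => t /=; rewrite in_itv.
Qed.

(** Equivalent to Borel measurability by the next two lemmas, and immediately
    compatible with sums, multiples and pointwise limits. *)
Definition vmeasurable {E : normedVectType R} (f : T -> E) :=
  forall i, measurable_fun setT (fun t => crd i (f t) : R).

Lemma vmeasurable_borel {E : normedVectType R} (f : T -> E) :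
  vmeasurable f -> measurable_fun setT (f : T -> borel E).
Proof.
move=> mf; have [c c0 cE] := @norm_le_crd R E.
apply: (@borel_measurable_functionals E _ (fun i => crd i) c) => // x x' m m0 xm.
by apply: cE => // i; rewrite crdB.
Qed.

Lemma vmeasurable_of_borel {E : normedVectType R} (f : T -> E) :
  measurable_fun setT (f : T -> borel E) -> vmeasurable f.
Proof. by move=> mf i; apply: (borel_measurable_comp mf); exact: crd_continuous. Qed.

Lemma vmeasurable_continuous {E G : normedVectType R} (f : T -> E) (g : E -> G) :
  vmeasurable f -> continuous g -> vmeasurable (fun t => g (f t)).
Proof.
move=> mf cg i.
apply: (borel_measurable_comp (g := fun x => crd i (g x)) (vmeasurable_borel mf)) => x.
by apply: (cvg_comp _ _ (cg x)); exact: crd_continuous.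
Qed.

Lemma vmeasurableD {E : normedVectType R} (f g : T -> E) :
  vmeasurable f -> vmeasurable g -> vmeasurable (fun t => f t + g t).
Proof.
move=> mf mg i; rewrite (_ : (fun t => _) = fun t => crd i (f t) + crd i (g t)).
  exact: measurable_funD.
by apply/funext => t; rewrite /crd linearD.
Qed.

Lemma vmeasurableZ {E : normedVectType R} (f : T -> E) (a : T -> R) :
  measurable_fun setT a -> vmeasurable f -> vmeasurable (fun t => a t *: f t).
Proof.
move=> ma mf i; rewrite (_ : (fun t => _) = fun t => a t * crd i (f t)).
  exact: measurable_funM.
by apply/funext => t; rewrite /crd linearZ.
Qed.

Lemma vmeasurable_cst {E : normedVectType R} (x : E) : vmeasurable (fun _ : T => x).
Proof. by move=> i; exact: measurable_cst. Qed.

Lemma vmeasurableN {E : normedVectType R} (f : T -> E) :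
  vmeasurable f -> vmeasurable (fun t => - f t).
Proof.
move=> mf; rewrite (_ : (fun t => - f t) = fun t => (-1 : R) *: f t).
  by apply: vmeasurableZ => //; exact: measurable_cst.
by apply/funext => t; rewrite scaleN1r.
Qed.

Lemma vmeasurableB {E : normedVectType R} (f g : T -> E) :
  vmeasurable f -> vmeasurable g -> vmeasurable (fun t => f t - g t).
Proof. by move=> mf mg; apply: vmeasurableD => //; exact: vmeasurableN. Qed.

Lemma vmeasurable_sum {E : normedVectType R} n (f : 'I_n -> T -> E) :
  (forall i, vmeasurable (f i)) -> vmeasurable (fun t => \sum_i f i t).
Proof.
elim: n f => [|n IH] f mf.
  rewrite (_ : (fun t => _) = fun=> 0); first exact: vmeasurable_cst.
  by apply/funext => t; rewrite big_ord0.
rewrite (_ : (fun t => _) = fun t => f ord0 t + \sum_(i < n) f (lift ord0 i) t).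
  by apply: vmeasurableD => //; apply: IH.
by apply/funext => t; rewrite big_ord_recl.
Qed.

Lemma vmeasurable_app_pointwise {E G : normedVectType R} (f : T -> 'Hom(E, G)) (z : T -> E) :
  (forall u, vmeasurable (fun t => f t u)) -> vmeasurable z -> vmeasurable (fun t => f t (z t)).
Proof.
move=> mf mz; rewrite (_ : (fun t => _) =
    fun t => \sum_(i < \dim {:E}) crd i (z t) *: f t (vbasis {:E})`_i).
  by apply: vmeasurable_sum => i; apply: vmeasurableZ => //; exact: mz.
apply/funext => t; rewrite {1}[z t]crd_sum linear_sum.
by apply: eq_bigr => i _; rewrite linearZ.
Qed.

Lemma lfun_eval_continuous {E G : normedVectType R} (u : E) : continuous (fun f : 'Hom(E, G) => f u).
Proof.
move=> f; have FF : Filter (nbhs f) by exact: nbhs_filter.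
apply: (proj2 (@cvgrPdist_le R G _ (nbhs f) FF (fun g : 'Hom(E, G) => g u) (f u))).
move=> eps eps0; have u1 : 0 < `|u| + 1 by rewrite ltr_wpDl.
apply/nbhs_ballP; exists (eps / (`|u| + 1)); first by rewrite /= divr_gt0.
move=> g; rewrite -ball_normE /ball_ /= => fg.
rewrite -sub_lfunE (le_trans (lfun_norm_le _ _))//.
rewrite (@le_trans _ _ (eps / (`|u| + 1) * (`|u| + 1)))//; last first.
  by rewrite mulfVK// gt_eqF.
by apply: ler_pM; rewrite ?lerDl// ltW.
Qed.

Lemma vmeasurable_app {E G : normedVectType R} (f : T -> 'Hom(E, G)) (z : T -> E) :
  vmeasurable f -> vmeasurable z -> vmeasurable (fun t => f t (z t)).
Proof.
move=> mf; apply: vmeasurable_app_pointwise => u.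
by apply: (@vmeasurable_continuous _ _ f (fun l => l u) mf); exact: lfun_eval_continuous.
Qed.

Lemma vmeasurable_cvg {E : normedVectType R} (f : nat -> T -> E) (g : T -> E) :
  (forall n, vmeasurable (f n)) -> (forall t, (fun n => f n t) @ \oo --> g t) ->
  vmeasurable g.
Proof.
move=> mf fg i; apply: (@measurable_fun_cvg _ T R setT (fun n t => crd i (f n t))).
  by move=> n; exact: mf.
by move=> t _; apply: (cvg_comp _ _ (fg t)); exact: crd_continuous.
Qed.

Lemma vmeasurable_select {E : normedVectType R} (f : nat -> T -> E) (N : T -> nat) :
  (forall n, vmeasurable (f n)) -> (forall k, measurable (N @^-1` [set k])) ->
  vmeasurable (fun t => f (N t) t).
Proof.
move=> mf mN i _ B mB; rewrite setTI.
rewrite (_ : _ @^-1` B = \bigcup_k (N @^-1` [set k] `&` (fun t => crd i (f k t)) @^-1` B)).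
  apply: bigcupT_measurable => k; apply: measurableI => //.
  by rewrite -[X in measurable X]setTI; exact: mf.
apply/seteqP; split => [t /= Bt|t [k _ [/= <-]]//].
by exists (N t).
Qed.

Lemma vmeasurable_if {E : normedVectType R} (b : T -> bool) (f g : T -> E) :
  measurable_fun setT b -> vmeasurable f -> vmeasurable g ->
  vmeasurable (fun t => if b t then f t else g t).
Proof.
move=> mb mf mg i; rewrite (_ : (fun t => _) =
  fun t => if b t then crd i (f t) else crd i (g t)); first exact: measurable_fun_ifT.
by apply/funext => t; case: (b t).
Qed.

Lemma measurable_truncn (c : T -> R) : measurable_fun setT c ->
  forall k, measurable ((fun t => Num.truncn (c t)) @^-1` [set k]).
Proof.
move=> mc k.
have le n : measurable [set t | (Num.truncn (c t) <= n)%N].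
  rewrite (_ : [set t | _] = setT `&` c @^-1` `]-oo, n.+1%:R[).
    by apply: mc => //; exact: measurable_itv.
  by rewrite setTI; apply/seteqP; split => t /=; rewrite in_itv /= truncn_le_nat.
case: k => [|k].
  rewrite (_ : _ @^-1` _ = [set t | (Num.truncn (c t) <= 0)%N])//.
  by apply/seteqP; split => t /=; rewrite leqn0 => /eqP.
rewrite (_ : _ @^-1` _ = [set t | (Num.truncn (c t) <= k.+1)%N] `\`
   [set t | (Num.truncn (c t) <= k)%N]).
  exact: measurableD.
apply/seteqP; split => t /= => [->|[h1 /negP]]; first by split => //; rewrite ltnn.
by rewrite -ltnNge => h2; apply/eqP; rewrite eqn_leq h1.
Qed.

End borel_measurability.

Section euler_measurable.
Context {R : realType} {d : measure_display} {T : measurableType d}.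

Lemma vmeasurable_precomp {d' : measure_display} {S : measurableType d'}
    {E : normedVectType R} (f : S -> E) (g : T -> S) :
  measurable_fun setT g -> vmeasurable f -> vmeasurable (fun t => f (g t)).
Proof. by move=> mg mf i; exact: (measurableT_comp (mf i) mg). Qed.

(** Exhibits the tensor product as a polynomial in the coordinates. *)
Lemma tens_basis {V : normedVectType R} (v w : V) :
  tens v w = \sum_(i < \dim {:V}) \sum_(j < \dim {:V})
    (crd i v * crd j w) *: tens (vbasis {:V})`_i (vbasis {:V})`_j.
Proof.
apply/lfunP => l; rewrite tensE sum_lfunE {1}(crd_sum v) linear_sum scaler_suml.
have lZ (a : R) x : l (a *: x) = a * l x by rewrite linearZ.
apply: eq_bigr => i _; rewrite sum_lfunE {1}(crd_sum w) scaler_sumr.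
apply: eq_bigr => j _; rewrite scale_lfunE tensE /= lZ !scalerA.
by congr (_ *: _); rewrite mulrAC.
Qed.

Lemma vmeasurable_tens {V : normedVectType R} (f g : T -> V) :
  vmeasurable f -> vmeasurable g -> vmeasurable (fun t => tens (f t) (g t)).
Proof.
move=> mf mg; rewrite (_ : (fun t => _) = fun t =>
    \sum_(i < \dim {:V}) \sum_(j < \dim {:V}) (crd i (f t) * crd j (g t)) *:
      tens (vbasis {:V})`_i (vbasis {:V})`_j); last first.
  by apply/funext => t; rewrite tens_basis.
apply: vmeasurable_sum => i; apply: vmeasurable_sum => j.
apply: (@vmeasurableZ _ _ _ _ (fun=> tens (vbasis {:V})`_i (vbasis {:V})`_j)
  (fun t => crd i (f t) * crd j (g t))); last exact: vmeasurable_cst.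
by apply: measurable_funM; [exact: mf|exact: mg].
Qed.

Lemma euler_vmeasurable {W : normedVectType R} (B : T -> R -> R -> W -> W) (G : W -> W)
    (y : T -> W) (h : R) :
  (forall s t Y, vmeasurable Y -> vmeasurable (fun x => B x s t (Y x))) ->
  continuous G -> vmeasurable y -> forall n, vmeasurable (fun x => euler (B x) G h (y x) n).
Proof.
move=> mB cG my; elim=> [//|n IH] /=.
apply: vmeasurableD; first by apply: vmeasurableD => //; exact: mB.
apply: (@vmeasurableZ _ _ _ _ _ (fun=> h)); first exact: measurable_cst.
exact: (vmeasurable_continuous IH cG).
Qed.

(** Once the time c is rounded towards 0 to the grid of step 2^-n, it matters only
    through its sign and the number of grid steps from 0. *)
Lemma vmeasurable_dyadic {E : normedVectType R} (f g : nat -> T -> E) (c : T -> R) n :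
  (forall k, vmeasurable (f k)) -> (forall k, vmeasurable (g k)) ->
  measurable_fun setT c ->
  vmeasurable (fun x => if 0 <= c x then f (Num.truncn (c x * 2 ^+ n)) x
                        else g (Num.truncn (- c x * 2 ^+ n)) x).
Proof.
move=> mf mg mc; apply: vmeasurable_if.
- by apply: measurable_fun_ler => //; exact: measurable_cst.
- apply: vmeasurable_select => // k; apply: measurable_truncn.
  by apply: measurable_funM => //; exact: measurable_cst.
- apply: vmeasurable_select => // k; apply: measurable_truncn.
  by apply: measurable_funM; [exact: measurable_funN|exact: measurable_cst].
Qed.

End euler_measurable.

Section germ_measurable.
Context {R : realType} {U V W : normedVectType R} {d d' : measure_display}
  {Omega : measurableType d} {T : measurableType d'}.
Variables (alpha : R) (theta : R -> Omega -> Omega).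
Variables (X : Omega -> R -> V) (XX : Omega -> R -> R -> tensor2 V).
Variables (Z : Omega -> R -> U) (Z' : Omega -> R -> 'Hom(V, U)).
Variables (F : W -> 'Hom(U, W)).
Hypothesis hX : rough_path_cocycle theta alpha X XX.
Hypothesis hZ : controlled_cocycle theta alpha X Z Z'.
Hypothesis hF : Cb 3 F.

Lemma germ_vmeasurable (o : T -> Omega) s t (Y : T -> W) :
  measurable_fun setT o -> vmeasurable Y ->
  vmeasurable (fun x => rde_germ (X (o x)) (XX (o x)) (Z (o x)) (Z' (o x)) F s t (Y x)).
Proof.
move=> mo mY.
have [_ [dF D2]] := hF; have [_ [dDF _]] : Cb 2 (fderive F) := D2.
have mX r : vmeasurable (fun x => X (o x) r).
  exact: (vmeasurable_precomp mo (vmeasurable_of_borel (rpc_measurable1 hX r))).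
have mXX a b : a <= b -> vmeasurable (fun x => XX (o x) a b).
  by move=> ab; exact: (vmeasurable_precomp mo (vmeasurable_of_borel (rpc_measurable2 hX ab))).
have mZ r : vmeasurable (fun x => Z (o x) r).
  exact: (vmeasurable_precomp mo (vmeasurable_of_borel (cc_measurable1 hZ r))).
have mZ' r : vmeasurable (fun x => Z' (o x) r).
  exact: (vmeasurable_precomp mo (vmeasurable_of_borel (cc_measurable2 hZ r))).
have mA : vmeasurable (fun x => ext_area (X (o x)) (XX (o x)) s t).
  rewrite /ext_area; case st : (s <= t); first exact: mXX.
  have ts : t <= s by rewrite ltW// ltNge st.
  by apply: vmeasurableB; [apply: vmeasurable_tens; exact: vmeasurableB|exact: mXX].
have mF : vmeasurable (fun x => F (Y x)).
  apply: (@vmeasurable_continuous _ _ _ _ _ Y F mY) => y; exact: differentiable_continuous.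
have mDF : vmeasurable (fun x => fderive F (Y x)).
  apply: (@vmeasurable_continuous _ _ _ _ _ Y (fderive F) mY) => y; exact: differentiable_continuous.
apply: vmeasurableD.
  by apply: vmeasurable_app => //; exact: vmeasurableB.
rewrite /second_lift /tens_lift; apply: vmeasurable_sum => i.
have mev (E G : normedVectType R) (f : T -> 'Hom(E, G)) u : vmeasurable f ->
    vmeasurable (fun x => f x u).
  by move=> mf; apply: vmeasurable_app => //; exact: vmeasurable_cst.
rewrite /second_coef; apply: vmeasurable_app; last first.
  by apply: vmeasurable_app => //; exact: mev.
by apply: vmeasurable_app => //; apply: vmeasurable_app => //; exact: mev.
Qed.

End germ_measurable.

Section product_borel.
Context {R : realType} {V W : normedVectType R} {d : measure_display} {T : measurableType d}.

(** Names the normed structure whose open sets generate the Borel sets of the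
    product. *)
Definition state_space : normedModType R := (W * 'Hom(V, W))%type.

(** The coordinates of the first component and the matrix entries of the second
    control the norm of a pair; only the values of the operators on fixed vectors
    intervene. *)
Lemma borel_measurable_pair (f : T -> W) (g : T -> 'Hom(V, W)) :
  vmeasurable f -> (forall u, vmeasurable (fun x => g x u)) ->
  measurable_fun setT (fun x => (f x, g x) : borel state_space).
Proof.
move=> mf mg; have [c c0 cE] := @norm_le_crd R W; have [k k0 kE] := @crd_le R V.
pose l (i : 'I_(\dim {:W}) + 'I_(\dim {:V}) * 'I_(\dim {:W})) (e : W * 'Hom(V, W)) : R :=
  match i with
  | inl a => crd a e.1
  | inr (a, b) => crd b (e.2 (vbasis {:V})`_a)
  end.
pose n : R := (\dim {:V})%:R.
apply: (@borel_measurable_functionals _ _ T state_space _ l (c + n * (k * c))).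
- by rewrite ltr_pwDl// mulr_ge0// mulr_ge0// ltW.
- move=> [x p] [x' p'] m m0 lm.
  have kc : 0 <= n * (k * c) by rewrite mulr_ge0// mulr_ge0// ltW.
  rewrite mulrDl prod_normE /= ge_max; apply/andP; split.
    apply: ler_wpDr; first by rewrite mulr_ge0.
    by apply: cE => // i; rewrite crdB; exact: (lm (inl i)).
  apply: ler_wpDl; first by rewrite mulr_ge0// ltW.
  apply: opnorm_le => [|v]; first by rewrite mulr_ge0.
  rewrite {1}(crd_sum v) linear_sum (le_trans (ler_norm_sum _ _ _))//.
  rewrite (@le_trans _ _ (\sum_(i < \dim {:V}) k * `|v| * (c * m)))//.
    apply: ler_sum => i _; rewrite linearZ /= normrZ; apply: ler_pM => //.
    by apply: cE => // j; rewrite sub_lfunE crdB; exact: (lm (inr (i, j))).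
  by rewrite sumr_const card_ord -mulr_natl le_eqVlt; apply/orP; left; apply/eqP; rewrite /n; ring.
- by case=> [i|[a b]] /=; [exact: mf|exact: mg].
Qed.

End product_borel.
Arguments state_space {R} V W.

Theorem theorem3p12 (R : realType) (U V W : normedVectType R) (alpha : R)
    (halpha : 3^-1 < alpha <= 2^-1)
    (d : measure_display) (Omega : measurableType d) (P : probability Omega R)
    (theta : R -> Omega -> Omega) (htheta : invertible_mpds P theta)
    (X : Omega -> R -> V) (XX : Omega -> R -> R -> tensor2 V)
    (hX : rough_path_cocycle theta alpha X XX)
    (Z : Omega -> R -> U) (Z' : Omega -> R -> 'Hom(V, U))
    (hZ : controlled_cocycle theta alpha X Z Z')
    (F : W -> 'Hom(U, W)) (hF : Cb 3 F) (F0 : W -> W) (hF0 : Cb 1 F0) :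
  measurable_cocycle theta (solution_map alpha X XX Z Z' F F0).
Proof.
have [L F0bl] : exists L, bounded_lipschitz L F0.
  have [M M0 FM] := Cb_bound hF0; have [L L0 FL] := Cb1_lipschitz hF0.
  exists (M + L); split => [y|y z]; first by rewrite (le_trans (FM y))// lerDl.
  by rewrite (le_trans (FL y z))// ler_wpM2r// lerDr.
have cF0 : continuous F0.
  by move=> y; apply: differentiable_continuous; case: hF0 => _ [].
have rX w := rpc_rough_path hX w; have rZ w := cc_controlled hZ w.
have al0 : 0 < alpha by case/andP: halpha => + _; apply: lt_trans; rewrite invr_gt0.
split; last first.
  by move=> s t w; apply/funext => Y0; exact: (solution_map_cocycle halpha htheta hX hZ hF F0bl).
pose S : measurableType _ := (measurableTypeR R * Omega * borel (state_space V W))%type.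
pose o (x : S) : Omega := x.1.2; pose c (x : S) : R := x.1.1; pose y0 (x : S) : W := x.2.1.
have mo : measurable_fun setT o by exact: measurableT_comp measurable_snd measurable_fst.
have mc : measurable_fun setT c by exact: measurableT_comp measurable_fst measurable_fst.
have my0 : vmeasurable y0.
  move=> i; apply: (borel_measurable_comp (E := state_space V W)
    (f := fun x : S => x.2) (g := fun e => crd i e.1)); first exact: measurable_snd.
  move=> e; apply: (@continuous_comp (W * 'Hom(V, W))%type W R fst (crd i) e).
    exact: cvg_fst.
  exact: crd_continuous.
(* the first component is the limit of the Euler schemes *)
pose A (x : S) := rde_germ (X (o x)) (XX (o x)) (Z (o x)) (Z' (o x)) F.
pose Y (x : S) := (rde_sol alpha (X (o x)) (XX (o x)) (Z (o x)) (Z' (o x)) F F0 (y0 x)).1 (c x).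
have mY : vmeasurable Y.
  apply: (@vmeasurable_cvg _ _ _ _ (fun n x => euler_approx (A x) F0 n (y0 x) (c x))).
    move=> n; rewrite /euler_approx /euler_path.
    apply: (vmeasurable_dyadic (f := fun k x => euler (A x) F0 (2 ^- n) (y0 x) k)
      (g := fun k x => euler (reverse_germ (A x)) (fun y => - F0 y) (2 ^- n) (y0 x) k)) => // k.
      apply: (euler_vmeasurable (B := A)) => // s t Yx mYx.
      exact: (germ_vmeasurable hX hZ hF).
    apply: (euler_vmeasurable (B := fun x => reverse_germ (A x))) => //.
      by move=> s t Yx mYx; exact: (germ_vmeasurable hX hZ hF).
    by move=> y; apply: cvgN; exact: cF0.
  by move=> x; exact: (euler_approx_cvg halpha (rX _) (rZ _) hF F0bl).
have mZ' u : vmeasurable (fun x => Z' (o x) (c x) u).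
  (* q n r is r rounded towards 0 to the grid of step 2^-n, and Z' is continuous *)
  pose q n (r : R) : R := if 0 <= r then (Num.truncn (r * 2 ^+ n))%:R * 2 ^- n
    else - ((Num.truncn (- r * 2 ^+ n))%:R * 2 ^- n).
  have qr n r : `|r - q n r| <= 2 ^- n.
    rewrite /q; case: ifPn => [r0|]; first exact: grid_floor_dist.
    rewrite -ltNge => r0; have r0' : 0 <= - r by rewrite oppr_ge0 ltW.
    by rewrite opprK; have := grid_floor_dist n r0'; rewrite -normrN opprB opprK addrC.
  have qc r : (fun n => q n r) @ \oo --> r.
    apply/cvgrPdist_le => eps eps0; have [n0 n0P] := step_small eps0.
    by exists n0 => // n /= n0n; rewrite (le_trans (qr n r))// n0P.
  have cZ' w : continuous (Z' w).
    apply: (path_holder_continuous al0) => r.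
    have [D dD] := driver_bounds halpha (rX w) (rZ w) r.
    by exists D; [exact: driver_ge0 dD|exact: driver_Z'_incr dD].
  have mZ'o r : vmeasurable (fun x => Z' (o x) r u).
    apply: vmeasurable_app; last exact: vmeasurable_cst.
    exact: (vmeasurable_precomp mo (vmeasurable_of_borel (cc_measurable2 hZ r))).
  apply: (@vmeasurable_cvg _ _ _ _ (fun n x => Z' (o x) (q n (c x)) u)) => [n|x].
    rewrite (_ : (fun x => _) = fun x => if 0 <= c x
      then Z' (o x) ((Num.truncn (c x * 2 ^+ n))%:R * 2 ^- n) u
      else Z' (o x) (- ((Num.truncn (- c x * 2 ^+ n))%:R * 2 ^- n)) u); last first.
      by apply/funext => x; rewrite /q; case: ifP.
    exact: (vmeasurable_dyadic (f := fun k x => Z' (o x) (k%:R * 2 ^- n) u)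
      (g := fun k x => Z' (o x) (- (k%:R * 2 ^- n)) u)).
  have H1 : (fun n => Z' (o x) (q n (c x))) @ \oo --> Z' (o x) (c x).
    exact: (cvg_comp _ _ (qc (c x)) (cZ' (o x) (c x))).
  have H2 := @lfun_eval_continuous R V U u (Z' (o x) (c x)).
  exact: (@cvg_comp _ _ _ (fun n => Z' (o x) (q n (c x))) (fun l => l u) _ _ _ H1 H2).
have solE : (fun x : S => solution_map alpha X XX Z Z' F F0 x.1.1 x.1.2 x.2) =
    fun x => (Y x, (F (Y x) \o Z' (o x) (c x))%VF).
  by apply/funext => x; rewrite /solution_map /= (rde_sol_snd halpha (rX _) (rZ _) hF F0bl).
rewrite solE; apply: borel_measurable_pair => // u.
rewrite (_ : (fun x => _) = fun x => F (Y x) (Z' (o x) (c x) u)); last first.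
  by apply/funext => x; rewrite comp_lfunE.
apply: vmeasurable_app => //.
apply: (@vmeasurable_continuous _ _ _ _ _ Y F mY) => y; apply: differentiable_continuous.
by case: hF => _ [].
Qed.
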